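(* Consider each of the two cases: the square case, with triangulation $T$, base $B = Q^0$, speeds $\zeta$ and target $\tau_0 = i$; and the hexagonal case, with triangulation $T'$, base $B = P^0$, speeds $\zeta'$ and target $\tau_0 = \rho = e^{i\pi/3}$ (all given in the context). In each case there is an open neighborhood $W$ of the base $B$ in the set $\mathcal{C}^\circ$ of configurations with nondegenerate faces such that: (1) The flat locus $\mathcal{F} \cap W$, i.e. the set of configurations in $W$ with all eight cone angles equal to $2\pi$, is a smooth manifold of dimension $17$. (2) The modulus $\tau : \mathcal{F}\cap W \to \mathbb{H}$ is a submersion, so each of its nonempty fibers is a smooth manifold of dimension $15$. (3) There are $\varepsilon > 0$ and a continuous map $x : (-\varepsilon,\varepsilon) \to \mathbb{R}^9$, with $x(0)$ the values at the base $B$ of the nine free horizontal coordinates, such that the configurations $q_t = q(x(t),t)$ (the configuration whose nine free horizontal coordinates are $x(t)$, whose other seven horizontal coordinates are those of $B$, and whose vertex heights are $t\zeta_v$, respectively $t\zeta'_v$) lie, for all sufficiently small $t > 0$, in the fiber $\{p \in \mathcal{F}\cap W : \tau(p) = \tau_0\}$, and for all sufficiently small $t>0$ they are embedded.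
   Context: Triangulations. $T$ has vertex set $\{0,\dots,7\}$ and the sixteen faces (written as positive boundary cycles, $abc$ meaning $(a,b,c)$) $356, 325, 364, 302, 341, 310, 506, 524, 547, 570, 674, 601, 617, 214, 207, 271$, marked by the ordered pair of loops $4\to2\to3\to4$ and $5\to2\to0\to5$. $T'$ has vertex set $\{0,\dots,7\}$ and the sixteen faces $012, 031, 024, 043, 152, 136, 145, 174, 167, 264, 257, 276, 347, 356, 375, 465$, marked by $1\to4\to0\to1$ and $1\to5\to6\to1$. Both are triangulations of the torus, and the marking loops represent a basis of $H_1(\,\cdot\,;\mathbb{Z})$. Configurations. Fix one of these triangulations, $V=\{0,\dots,7\}$. A configuration is a map $q : V \to \mathbb{R}^3$; the space of these is $\mathcal{C} \cong \mathbb{R}^{24}$. It extends uniquely to a piecewise linear map of the triangulation into $\mathbb{R}^3$, affine on faces; $q$ is embedded if this map is injective. $\mathcal{C}^\circ \subset \mathcal{C}$ is the open set of configurations with all faces nondegenerate. The cone angle at a vertex is the sum of the incident triangle angles measured in $\mathbb{R}^3$. The flat locus $\mathcal{F}\subset\mathcal{C}^\circ$ is the set of configurations with all cone angles $2\pi$. For $q\in\mathcal{F}$ the intrinsic metric is a flat torus; developing it (oriented by the face cycles) into the plane $\mathbb{C}$, the two marking loops act by translations $v_1,v_2$, well defined up to a common rotation and scaling, and the modulus is $\tau(q)=v_2/v_1$ (taking values in $\mathbb{H}$ near the bases). Square base $Q^0$ (heights $z=0$), planar positions of vertices $0,\dots,7$: $(0,0)$, $(\tfrac{73}{60},\tfrac{11}{10})$,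 $(\tfrac12,0)$, $(-\tfrac{15977}{50320},\tfrac{42471}{50320})$, $(1,0)$, $(\tfrac{35937}{25160},\tfrac{27357}{25160})$, $(0,\tfrac{33}{20})$, $(1,\tfrac{33}{20})$. Hexagonal base $P^0$ (heights $z=0$), planar positions of vertices $0,\dots,7$: $P_0=(0,0)$, $P_1=\tfrac{1}{8073677900}(896842303+729553300\sqrt3,\ 1029317275+568256878\sqrt3)$, $P_2=\tfrac{1}{47100}(-2625+7310\sqrt3,\ 8925-24854\sqrt3)$, $P_3=\tfrac{1}{10525}(3789,\ 595-4713\sqrt3)$, $P_4=(1,0)$, $P_5=\tfrac{1}{200}(64+25\sqrt3,\ 75-136\sqrt3)$, $P_6=\tfrac{1}{200}(-36+25\sqrt3,\ 75-36\sqrt3)$, $P_7=\tfrac{1}{109900}(279568-117825\sqrt3,\ 264900-143557\sqrt3)$. Speeds (indexed by vertices $0,\dots,7$): $\zeta=(\tfrac{3}{13},-\tfrac38,-\tfrac37,\tfrac{12}{13},1,-1,1,0)$, $\zeta'=(\tfrac12,-1,\tfrac{6}{17},-\tfrac{7}{34},-\tfrac{33}{47},-1,\tfrac{19}{41},1)$. Free horizontal coordinates ($x$- or $y$-coordinate of the indicated vertex): in the square case $Q_0^x,Q_0^y,Q_1^x,Q_1^y,Q_2^y,Q_3^x,Q_4^x,Q_4^y,Q_5^x$; in the hexagonal case $P_0^x,P_0^y,P_1^x,P_1^y,P_2^x,P_2^y,P_3^x,P_3^y,P_4^x$. *)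

(* Defs.v *)
From mathcomp Require Import all_boot all_order all_algebra.
From mathcomp Require Import all_classical all_reals all_analysis.
From mathcomp Require Import complex.
Set Implicit Arguments.
Unset Strict Implicit.
Unset Printing Implicit Defensive.
Import Order.TTheory GRing.Theory Num.Theory.
Import numFieldNormedType.Exports.
Local Open Scope classical_set_scope.
Local Open Scope ring_scope.

Fixpoint Ck (R : realType) (V W : normedModType R) (k : nat) (U : set V)
    (f : V -> W) : Prop :=
  match k with
  | 0 => forall x, U x -> {for x, continuous f}
  | k'.+1 => (forall x, U x -> differentiable f x) /\
             (forall v : V, Ck k' U (fun x => 'D_v f x))
  end.

Definition smooth_on (R : realType) (V W : normedModType R) (U : set V)
    (f : V -> W) : Prop :=
  forall k, Ck k U f.

(* Slice charts: near each of its points, M is the preimage of R^d x {0} under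
   a smooth diffeomorphism phi (inverse psi) from an open set U of V onto an
   open set U' of R^d x R^e. The codimension e is forced by the dimension of V. *)
Definition smooth_submanifold (R : realType) (V : normedModType R) (d : nat)
    (M : set V) : Prop :=
  forall p, M p ->
  exists (e : nat) (U : set V) (U' : set ('rV[R]_d * 'rV[R]_e))
         (phi : V -> 'rV[R]_d * 'rV[R]_e) (psi : 'rV[R]_d * 'rV[R]_e -> V),
    [/\ open U /\ U p, open U',
        smooth_on U phi /\ smooth_on U' psi,
        (forall x, U x -> U' (phi x) /\ psi (phi x) = x) /\
        (forall y, U' y -> U (psi y) /\ phi (psi y) = y)
      & forall x, U x -> (M x <-> (phi x).2 = 0)].

Definition tangent_space (R : realType) (V : normedModType R) (M : set V)
    (p : V) : set V :=
  [set v | exists (e : R) (g : R -> V),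
     [/\ 0 < e, smooth_on [set t : R | -e < t < e] g,
         (forall t, -e < t < e -> M (g t)), g 0 = p & derive1 g 0 = v]].

(* f is only meaningful on M: it is smooth when it has local smooth extensions
   F, and its differential at p is the restriction of 'd F p to the tangent
   space. *)
Definition submersion_on (R : realType) (V W : normedModType R) (M : set V)
    (f : V -> W) : Prop :=
  forall p, M p ->
  exists (U : set V) (F : V -> W),
    [/\ open U, U p, smooth_on U F,
        (forall x, M x -> U x -> f x = F x)
      & forall w : W, exists2 v, tangent_space M p v & 'd F p v = w].

Variant torus_case := Square | Hexagonal.

Local Notation vtx n := (@Ordinal 8 n isT) (only parsing).
Local Notation tri a b c := (vtx a, vtx b, vtx c) (only parsing).

Definition faces (s : torus_case) : seq ('I_8 * 'I_8 * 'I_8) :=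
  match s with
  | Square =>
    [:: tri 3 5 6; tri 3 2 5; tri 3 6 4; tri 3 0 2;
        tri 3 4 1; tri 3 1 0; tri 5 0 6; tri 5 2 4;
        tri 5 4 7; tri 5 7 0; tri 6 7 4; tri 6 0 1;
        tri 6 1 7; tri 2 1 4; tri 2 0 7; tri 2 7 1]
  | Hexagonal =>
    [:: tri 0 1 2; tri 0 3 1; tri 0 2 4; tri 0 4 3;
        tri 1 5 2; tri 1 3 6; tri 1 4 5; tri 1 7 4;
        tri 1 6 7; tri 2 6 4; tri 2 5 7; tri 2 7 6;
        tri 3 4 7; tri 3 5 6; tri 3 7 5; tri 4 6 5]
  end.

(* A loop is given by its starting vertex and the vertices visited after it. *)
Definition loop1 (s : torus_case) : 'I_8 * seq 'I_8 :=
  match s with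
  | Square => (vtx 4, [:: vtx 2; vtx 3; vtx 4])
  | Hexagonal => (vtx 1, [:: vtx 4; vtx 0; vtx 1])
  end.

Definition loop2 (s : torus_case) : 'I_8 * seq 'I_8 :=
  match s with
  | Square => (vtx 5, [:: vtx 2; vtx 0; vtx 5])
  | Hexagonal => (vtx 1, [:: vtx 5; vtx 6; vtx 1])
  end.

(* The faces in all three cyclic rotations: (a, b, c) is the corner at a of
   the positively oriented face abc. *)
Definition corners (s : torus_case) : seq ('I_8 * 'I_8 * 'I_8) :=
  flatten [seq let: (a, b, c) := f in [:: (a, b, c); (b, c, a); (c, a, b)]
          | f <- faces s].

(* Symmetric, because each edge is traversed once in each direction by the
   face cycles. *)
Definition edge (s : torus_case) : rel 'I_8 :=
  fun a b => has (fun f => f.1 == (a, b)) (corners s).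

(* A configuration is an 8 x 3 matrix whose row v is the position of v. *)

Notation config R := 'M[R]_(8, 3).

Section Geometry.
Variable R : realType.
Implicit Types (s : torus_case) (q : config R).

Definition nondegenerate_faces s : set (config R) :=
  [set q | forall a b c, (a, b, c) \in faces s ->
     row_free (col_mx (row b q - row a q) (row c q - row a q))].

(* `| | on matrices is the sup norm, hence the explicit Euclidean norm. *)
Definition dot (u w : 'rV[R]_3) : R := \sum_(k < 3) u 0 k * w 0 k.
Definition enorm (u : 'rV[R]_3) : R := Num.sqrt (dot u u).

Definition angle (u w : 'rV[R]_3) : R := acos (dot u w / (enorm u * enorm w)).

Definition cone_angle s q (v : 'I_8) : R :=
  \sum_(f <- corners s | f.1.1 == v)
     angle (row f.1.2 q - row v q) (row f.2 q - row v q).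

Definition flat_locus s : set (config R) :=
  [set q | nondegenerate_faces s q /\ forall v, cone_angle s q v = 2 * pi].

(* The geometric realization of the triangulation, in barycentric coordinates;
   the piecewise linear extension of q is l |-> l *m q. *)
Definition realization s : set 'rV[R]_8 :=
  [set l : 'rV[R]_8 | [/\ forall v, 0 <= l 0 v, \sum_v l 0 v = 1
             & exists a b c, (a, b, c) \in faces s /\
                 forall v, l 0 v != 0 -> v \in [:: a; b; c]]].

Definition embedded s q : Prop :=
  {in realization s &, injective (fun l : 'rV[R]_8 => l *m q)}.

(* The vertices of the universal cover are the homotopy classes of edge paths
   starting at a base vertex, taken to be 0; a path is the sequence p of the
   vertices visited after 0, and it ends over last ord0 p. D gives the vertex
   values of a developing map: it is invariant under the elementary homotopies
   (backtracking along an edge, pushing across a face) and it maps each lifted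
   face to a positively oriented isometric copy of the face in the plane. *)
Definition developing s q (D : seq 'I_8 -> R[i]) : Prop :=
  [/\ (forall p r b, path (edge s) ord0 (p ++ r) -> edge s (last ord0 p) b ->
         D (p ++ [:: b, last ord0 p & r]) = D (p ++ r)),
      (forall p r b c, path (edge s) ord0 (p ++ c :: r) ->
         (last ord0 p, b, c) \in corners s ->
         D (p ++ [:: b, c & r]) = D (p ++ c :: r)),
      (forall p b, path (edge s) ord0 (rcons p b) ->
         `|D (rcons p b) - D p| = ((enorm (row b q - row (last ord0 p) q))%:C)%C)
    & (forall p b c, path (edge s) ord0 p ->
         (last ord0 p, b, c) \in corners s ->
         0 < complex.Im (((D (rcons p b) - D p)^*)%C * (D (rcons p c) - D p)))].

(* The deck transformation of the loop g, based at a vertex which is joined to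
   0 by an edge path w, is p |-> w g w^-1 p. *)
Definition acts_by_translation s (D : seq 'I_8 -> R[i]) (g : 'I_8 * seq 'I_8)
    (z : R[i]) : Prop :=
  forall w p, path (edge s) ord0 w -> last ord0 w = g.1 ->
    path (edge s) ord0 p ->
    D (w ++ g.2 ++ rev (belast ord0 w) ++ p) = D p + z.

Definition modulus s q : R[i] :=
  xget 0 [set z | exists D v1 v2,
    [/\ developing s q D, acts_by_translation s D (loop1 s) v1,
        acts_by_translation s D (loop2 s) v2 & z = v2 / v1]].

Definition plane (z : R[i]) : 'rV[R]_2 :=
  \row_j nth 0 [:: complex.Re z; complex.Im z] j.

Definition target s : R[i] :=
  match s with
  | Square => (0 +i* 1)%C
  | Hexagonal => (cos (pi / 3) +i* sin (pi / 3))%C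
  end.

(* Large literals carry an explicit %:R: they are then stored in decimal,
   whereas bare ring_scope literals are expanded to unary naturals. *)

Definition base_xy s : seq (R * R) :=
  let r3 : R := Num.sqrt 3 in
  match s with
  | Square =>
    [:: (0, 0);
        (73 / 60, 11 / 10);
        (1 / 2, 0);
        (- (15977%:R / 50320%:R), 42471%:R / 50320%:R);
        (1, 0);
        (35937%:R / 25160%:R, 27357%:R / 25160%:R);
        (0, 33 / 20);
        (1, 33 / 20)]
  | Hexagonal =>
    [:: (0, 0);
        ((896842303%:R + 729553300%:R * r3) / 8073677900%:R,
         (1029317275%:R + 568256878%:R * r3) / 8073677900%:R);
        ((- 2625%:R + 7310%:R * r3) / 47100%:R,
         (8925%:R - 24854%:R * r3) / 47100%:R);
        (3789%:R / 10525%:R, (595 - 4713%:R * r3) / 10525%:R);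
        (1, 0);
        ((64 + 25 * r3) / 200, (75 - 136 * r3) / 200);
        ((- 36 + 25 * r3) / 200, (75 - 36 * r3) / 200);
        ((279568%:R - 117825%:R * r3) / 109900%:R,
         (264900%:R - 143557%:R * r3) / 109900%:R)]
  end.

Definition base s : config R :=
  \matrix_(v < 8, k < 3)
    let xy := nth (0, 0) (base_xy s) v in nth 0 [:: xy.1; xy.2; 0] k.

Definition speed s (v : 'I_8) : R :=
  nth 0 match s with
        | Square =>
          [:: 3 / 13; - (3 / 8); - (3 / 7); 12 / 13; 1; -1; 1; 0]
        | Hexagonal =>
          [:: 1 / 2; -1; 6 / 17; - (7 / 34); - (33 / 47); -1; 19 / 41; 1]
        end v.

Local Notation coord v k := (vtx v, @Ordinal 3 k isT) (only parsing).

Definition free_coords s : 9.-tuple ('I_8 * 'I_3) :=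
  match s with
  | Square =>
    [tuple coord 0 0; coord 0 1; coord 1 0; coord 1 1; coord 2 1;
           coord 3 0; coord 4 0; coord 4 1; coord 5 0]
  | Hexagonal =>
    [tuple coord 0 0; coord 0 1; coord 1 0; coord 1 1; coord 2 0;
           coord 2 1; coord 3 0; coord 3 1; coord 4 0]
  end.

Definition base_free s : 'rV[R]_9 :=
  \row_(j < 9) base s (tnth (free_coords s) j).1 (tnth (free_coords s) j).2.

Definition lifted s (x : 'rV[R]_9) (t : R) : config R :=
  \matrix_(v < 8, k < 3)
    if k == ord_max (* the z-axis *) then t * speed s v
    else if (v, k) \in free_coords s
         then x 0 (inord (index (v, k) (free_coords s)))
         else base s v k.

End Geometry.

(* Main.v *)
(* A configuration q near the base is flat iff there are points P_v of the plane,
   a modulus tau and a scale mu > 0 such that |q_a - q_b|^2 = mu |P_b - P_a + m_ab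
   + n_ab tau|^2 on all 24 edges ab, where (m, n) are integral cocycles dual to
   the marking loops. In the less obvious direction, developing a flat q along a
   tree of faces gives edge vectors which close up around the vertices; the
   holonomies r1, r2 of the two loops are rotations close to 1 and, adding up all
   edge vectors, satisfy (1 - r1) V1 + (1 - r2) V2 = 0, so that r1 = r2 = 1.
   The implicit function theorem applies to these 24 polynomial equations with two
   choices of 24 unknowns: seven horizontal coordinates, P, mu and tau show that
   the flat locus is a graph over the other 17 coordinates; the nine free
   coordinates, P and mu show that the fibres of tau are graphs over the other 15
   coordinates, and yield both the curve q_t and curves along which tau has any
   prescribed speed. The Jacobian matrices at the base are inverted up to a small
   error by exact computations in Q(sqrt 3).
   Dividing the heights by t turns q_t into a perturbation of the base with
   heights zeta, which is embedded: two faces are separated by a linear form up to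
   a common vertex, or share an edge and span the space. *)
Require Import Defs.
From HB Require Import structures.
From Stdlib Require Import ZArith.
From mathcomp Require Import all_boot all_order all_algebra.
From mathcomp Require Import all_classical all_reals all_analysis.
From mathcomp Require Import complex ring lra zify ssrZ.
Set Implicit Arguments.
Unset Strict Implicit.
Unset Printing Implicit Defensive.
Import Order.TTheory GRing.Theory Num.Theory.
Import numFieldNormedType.Exports.
Local Open Scope classical_set_scope.
Local Open Scope ring_scope.

(** * Smooth maps *)

(** The eight cone angles always add up to 16 pi, the angle sum of sixteen triangles, so the angle
    equations are dependent and the implicit function theorem cannot be applied to them as they
    stand. One length equation per edge, with the planar positions as additional unknowns, gives a
    square system without this redundancy; it is also free of arccosines, so that its Jacobian
    matrix can be examined by exact arithmetic. No height is an unknown: at a planar base the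
    squared edge lengths are stationary in the heights. The price is that solutions and flat
    configurations have to be matched. Closing up around a vertex fixes the cone angle only modulo 2
    pi; strict inequalities on cross products, valid near the base, select 2 pi. Conversely, a flat
    configuration must produce a solution close to the base values, since only there is the solution
    unique; hence the continuity of the development at the base. Finally, the modulus refers to an
    arbitrary developing map, so its independence of that choice has to be established. *)

Section Differentiability.
Variables (R : realType) (V W : normedModType R).

Lemma differentiable_of_bound (f : V -> W) (x : V) (df : {linear V -> W}) :
  continuous df ->
  (forall e, 0 < e -> \forall h \near (0 : V),
     `|f (h + x) - f x - df h| <= e * `|h|) ->
  differentiable f x /\ 'd f x = df :> (V -> W).
Proof.
move=> dfc H.
have E : f \o shift x = cst (f x) + df +o_ 0 id.
  apply/eqaddoP => e e0; near=> h.
  rewrite /= !fctE opprD addrA.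
  by near: h; apply: H.
have D := diff_unique dfc E; split => //.
by apply/diff_locallyP; rewrite D.
Unshelve. all: by end_near. Qed.

Lemma differentiable_bound (f : V -> W) (x : V) : differentiable f x ->
  forall e, 0 < e -> \forall h \near (0 : V),
     `|f (h + x) - f x - 'd f x h| <= e * `|h|.
Proof.
move=> /diff_locally /eqaddoP H e e0; have := H e e0.
apply: filterS => h /=; rewrite !fctE.
by rewrite opprD addrA.
Qed.

Lemma shift_cvg (x : V) : h + x @[h --> 0] --> x.
Proof.
by rewrite -[X in _ --> X]add0r; apply: cvgD; [exact: cvg_id | exact: cvg_cst].
Qed.

Lemma near_eq_differentiable (f g : V -> W) (x : V) :
  (\forall y \near x, f y = g y) -> differentiable f x ->
  differentiable g x /\ 'd g x = 'd f x :> (V -> W).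
Proof.
move=> fg df; apply: differentiable_of_bound; first exact: diff_continuous.
move=> e e0; have H := differentiable_bound df e0.
have gx : f x = g x by apply: nbhs_singleton fg.
have fg0 : \forall h \near (0 : V), f (h + x) = g (h + x).
  by have := @shift_cvg x; move=> /(_ _ fg).
by apply: filterS2 H fg0 => h; rewrite gx => H <-.
Qed.

Lemma Ck_ext (U : set V) (k : nat) (f g : V -> W) : open U ->
  (forall x, U x -> f x = g x) -> Ck k U f -> Ck k U g.
Proof.
move=> oU; elim: k f g => [|k IH] f g fg /=.
  move=> cf x Ux; have := cf x Ux; rewrite /prop_for /continuous_at -(fg x Ux).
  apply: cvg_trans; apply: near_eq_cvg.
  by apply: filterS (open_nbhs_nbhs (conj oU Ux)) => y /fg.
have nfg x : U x -> \forall y \near x, f y = g y.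
  by move=> Ux; apply: filterS (open_nbhs_nbhs (conj oU Ux)) => y /fg.
move=> [df Df]; split=> [x Ux|v].
  by have [] := near_eq_differentiable (nfg x Ux) (df x Ux).
apply: IH (Df v) => x Ux.
have [dg dgE] := near_eq_differentiable (nfg x Ux) (df x Ux).
rewrite (deriveE v (df x Ux)) (deriveE v dg).
exact: (esym (congr1 (fun F : V -> W => F v) dgE)).
Qed.

Lemma smooth_ext (U : set V) (f g : V -> W) : open U ->
  (forall x, U x -> f x = g x) -> smooth_on U f -> smooth_on U g.
Proof. by move=> oU fg sf k; apply: Ck_ext (sf k). Qed.

(* Coinduction: a class of differentiable functions stable under directional
   derivatives consists of smooth functions. *)
Lemma smooth_coind (P : (V -> W) -> Prop) (U : set V) : open U ->
  (forall f, P f -> forall x, U x -> differentiable f x) ->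
  (forall f v, P f -> exists2 g, P g & forall x, U x -> 'D_v f x = g x) ->
  forall f, P f -> smooth_on U f.
Proof.
move=> oU dP DP f Pf k; elim: k f Pf => [|k IH] f Pf /=.
  by move=> x Ux; apply: differentiable_continuous; exact: dP.
split=> [|v]; first exact: dP.
have [g Pg gE] := DP f v Pf.
by apply: Ck_ext (IH g Pg) => // x Ux; rewrite gE.
Qed.

Lemma smooth_differentiable (U : set V) (f : V -> W) x :
  smooth_on U f -> U x -> differentiable f x.
Proof. by move=> /(_ 1%N)[+ _] Ux; apply. Qed.

Lemma smooth_derive (U : set V) (f : V -> W) v :
  smooth_on U f -> smooth_on U (fun x => 'D_v f x).
Proof. by move=> sf k; have [_] := sf k.+1; apply. Qed.

Lemma smooth_subset (U U' : set V) (f : V -> W) :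
  U' `<=` U -> smooth_on U f -> smooth_on U' f.
Proof.
move=> sU sf k; elim: k f sf => [|k IH] f sf /=.
  by move=> x /sU Ux; have := sf 0%N; apply.
split=> [x /sU Ux|v]; first exact: smooth_differentiable Ux.
exact/IH/smooth_derive.
Qed.

Lemma smooth_add (U : set V) (f g : V -> W) : open U ->
  smooth_on U f -> smooth_on U g -> smooth_on U (fun x => f x + g x).
Proof.
move=> oU sf sg; pose P (h : V -> W) := exists f g, [/\ smooth_on U f, smooth_on U g
  & h = f + g].
apply: (@smooth_coind P) => //; last by exists f, g.
  move=> _ [f1 [g1 [sf1 sg1 ->]]] x Ux.
  by apply: differentiableD; apply: smooth_differentiable Ux.
move=> _ v [f1 [g1 [sf1 sg1 ->]]].
exists (fun x => 'D_v f1 x + 'D_v g1 x).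
  exists (fun x => 'D_v f1 x), (fun x => 'D_v g1 x).
  by split=> //; exact: smooth_derive.
move=> x Ux; have df := smooth_differentiable sf1 Ux.
by have dg := smooth_differentiable sg1 Ux; rewrite deriveD //; exact: diff_derivable.
Qed.

Lemma smooth_cst (U : set V) (c : W) : open U -> smooth_on U (fun _ : V => c).
Proof.
move=> oU; apply: (@smooth_coind (fun h => exists c, h = cst c)) => //; last by exists c.
  by move=> _ [d ->] x _; exact: differentiable_cst.
by move=> _ v [d ->]; exists (cst 0); [exists 0|move=> x _; rewrite derive_cst].
Qed.

Lemma smooth_linear (U : set V) (f : {linear V -> W}) : open U ->
  continuous f -> smooth_on U f.
Proof.
move=> oU cf.
apply: (@smooth_coind (fun h => h = f \/ exists c, h = cst c)) => //; last by left.
  move=> _ [->|[d ->]] x _; first exact: linear_differentiable.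
  exact: differentiable_cst.
move=> _ v [->|[d ->]].
  exists (cst (f v)); first by right; exists (f v).
  by move=> x _; rewrite deriveE ?diff_lin //; exact: linear_differentiable.
by exists (cst 0); [right; exists 0|move=> x _; rewrite derive_cst].
Qed.

End Differentiability.

Section Algebra.
Variables (R : realType) (V : normedModType R) (U : set V).
Variable G : (V -> R) -> Prop.

(** Rational expressions in the generators [G], with denominators that do not vanish on [U]. Only
    the generators have to be differentiated by hand: the sum, product and quotient rules keep all
    derivatives inside [alg], as [smooth_coind] requires. *)
Inductive alg : (V -> R) -> Prop :=
| alg_gen f : G f -> alg f
| alg_cst c : alg (cst c)
| alg_add f g : alg f -> alg g -> alg (fun x => f x + g x)
| alg_mul f g : alg f -> alg g -> alg (fun x => f x * g x)
| alg_inv f : alg f -> (forall x, U x -> f x != 0) -> alg (fun x => (f x)^-1).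

Lemma alg_opp f : alg f -> alg (fun x => - f x).
Proof.
move=> af; have -> : (fun x => - f x) = (fun x => cst (-1) x * f x).
  by apply/funext => x; rewrite /= mulN1r.
by apply: alg_mul => //; exact: alg_cst.
Qed.

Lemma alg_sum I (r : seq I) (P : pred I) (F : I -> V -> R) :
  (forall i, P i -> alg (F i)) -> alg (fun x => \sum_(i <- r | P i) F i x).
Proof.
move=> aF; elim: r => [|i r IH].
  have -> : (fun x => \sum_(i <- [::] | P i) F i x) = cst 0.
    by apply/funext => x; rewrite big_nil.
  exact: alg_cst.
case Pi : (P i); last first.
  have -> // : (fun x => \sum_(i <- i :: r | P i) F i x) =
               (fun x => \sum_(i <- r | P i) F i x).
  by apply/funext => x; rewrite big_cons Pi.
have -> : (fun x => \sum_(i <- i :: r | P i) F i x) =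
          (fun x => F i x + \sum_(i <- r | P i) F i x).
  by apply/funext => x; rewrite big_cons Pi.
by apply: alg_add => //; exact: aF.
Qed.

Lemma alg_prod I (r : seq I) (P : pred I) (F : I -> V -> R) :
  (forall i, P i -> alg (F i)) -> alg (fun x => \prod_(i <- r | P i) F i x).
Proof.
move=> aF; elim: r => [|i r IH].
  have -> : (fun x => \prod_(i <- [::] | P i) F i x) = cst 1.
    by apply/funext => x; rewrite big_nil.
  exact: alg_cst.
case Pi : (P i); last first.
  have -> // : (fun x => \prod_(i <- i :: r | P i) F i x) =
               (fun x => \prod_(i <- r | P i) F i x).
  by apply/funext => x; rewrite big_cons Pi.
have -> : (fun x => \prod_(i <- i :: r | P i) F i x) =
          (fun x => F i x * \prod_(i <- r | P i) F i x).
  by apply/funext => x; rewrite big_cons Pi.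
by apply: alg_mul => //; exact: aF.
Qed.

Lemma alg_det n (M : V -> 'M[R]_n) : (forall i j, alg (fun x => M x i j)) ->
  alg (fun x => \det (M x)).
Proof.
move=> aM; rewrite /determinant; apply: alg_sum => s _.
by apply: alg_mul; [exact: alg_cst | apply: alg_prod => i _].
Qed.

Lemma alg_invmx n (M : V -> 'M[R]_n) : (forall i j, alg (fun x => M x i j)) ->
  (forall x, U x -> M x \in unitmx) ->
  forall i j, exists2 f, alg f & forall x, U x -> invmx (M x) i j = f x.
Proof.
move=> aM uM i j.
exists (fun x => (\det (M x))^-1 * cofactor (M x) j i); last first.
  by move=> x Ux; rewrite /invmx uM // !mxE.
apply: alg_mul.
  apply: alg_inv; first exact: alg_det.
  by move=> x /uM; rewrite unitmxE unitfE.
rewrite /cofactor; apply: alg_mul; first exact: alg_cst.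
apply: alg_det => k l.
have -> : (fun x => row' j (col' i (M x)) k l) = (fun x => M x (lift j k) (lift i l)).
  by apply/funext => x; rewrite !mxE.
exact: aM.
Qed.

Hypothesis oU : open U.
Hypothesis dG : forall f, G f -> forall x, U x -> differentiable f x.
Hypothesis DG : forall f v, G f ->
  exists2 g, alg g & forall x, U x -> 'D_v f x = g x.

Lemma alg_differentiable f : alg f -> forall x, U x -> differentiable f x.
Proof.
elim=> {f} [f /dG //|c x _|f g _ df _ dg x Ux|f g _ df _ dg x Ux|f _ df f0 x Ux].
- exact: differentiable_cst.
- by apply: differentiableD; [exact: df | exact: dg].
- by apply: differentiableM; [exact: df | exact: dg].
- by apply: differentiableV; [exact: df | exact: f0].
Qed.

Lemma alg_smooth f : alg f -> smooth_on U f.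
Proof.
move: f; apply: smooth_coind => //; first exact: alg_differentiable.
move=> f v; elim=> {f} [f /DG //|c|f g af [f' af' fE] ag [g' ag' gE]
  |f g af [f' af' fE] ag [g' ag' gE]|f af [f' af' fE] f0].
- by exists (cst 0); [exact: alg_cst | move=> x _; rewrite derive_cst].
- exists (fun x => f' x + g' x); first exact: alg_add.
  move=> x Ux; rewrite -fE // -gE // -deriveD //; apply: diff_derivable;
    exact: alg_differentiable.
- exists (fun x => f x * g' x + g x * f' x).
    by apply: alg_add; apply: alg_mul.
  move=> x Ux; rewrite -fE // -gE // -[RHS]/(f x *: _ + g x *: _).
  rewrite -deriveM //; apply: diff_derivable;
    exact: alg_differentiable.
- exists (fun x => - (((f x)^-1 * (f x)^-1) * f' x)).
    by apply/alg_opp/alg_mul => //; apply: alg_mul; apply: alg_inv.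
  move=> x Ux; rewrite -fE // deriveV ?f0 //; last first.
    by apply: diff_derivable; exact: alg_differentiable.
  by rewrite -exprVn expr2 scaleNr.
Qed.

End Algebra.

Section Composition.
Variables (R : realType).
Implicit Types V W Z : normedModType R.

(** The derivative of [h (L x + c)] along v is the derivative of h along [L v], taken at the same
    affine image of x. So composites with a fixed affine map form a class stable under directional
    derivatives, and coinduction applies. *)
Lemma smooth_precomp V W Z (O : set W) (U : set V) (L : {linear V -> W}) (c : W)
    (h : W -> Z) : open U -> continuous L -> (forall x, U x -> O (L x + c)) ->
  smooth_on O h -> smooth_on U (fun x => h (L x + c)).
Proof.
move=> oU cL UO sh.
have dL x : differentiable (fun x => L x + c) x.
  apply: differentiableD; [exact: linear_differentiable | exact: differentiable_cst].
apply: (@smooth_coind _ _ _ (fun f => exists2 h, smooth_on O h & f = fun x => h (L x + c)))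
  => //; last by exists h.
  move=> _ [k sk ->] x /UO Ox.
  exact: differentiable_comp (dL x) (smooth_differentiable sk Ox).
move=> _ v [k sk ->]; exists (fun x => 'D_(L v) k (L x + c)).
  by exists (fun x => 'D_(L v) k x) => //; exact: smooth_derive.
move=> x /UO Ox; have dk := smooth_differentiable sk Ox.
rewrite !deriveE //; last exact: (differentiable_comp (dL x) dk).
rewrite (diff_comp (dL x) dk) /=; congr ('d k _ _).
rewrite (@diffD _ _ _ (L : V -> W) (cst c)); last exact: differentiable_cst.
  rewrite diff_cst -[LHS]/('d L x v + 0) addr0.
  by rewrite diff_lin.
exact: linear_differentiable.
Qed.

Lemma smooth_postcomp V W Z (U : set V) (L : {linear W -> Z}) (h : V -> W) :
  open U -> continuous L -> smooth_on U h -> smooth_on U (fun x => L (h x)).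
Proof.
move=> oU cL sh.
have dL x : differentiable L x by exact: linear_differentiable.
apply: (@smooth_coind _ _ _ (fun f => exists2 h, smooth_on U h & f = fun x => L (h x)))
  => //; last by exists h.
  by move=> _ [k sk ->] x Ux; apply: differentiable_comp => //; exact: smooth_differentiable Ux.
move=> _ v [k sk ->]; exists (fun x => L ('D_v k x)).
  by exists (fun x => 'D_v k x) => //; exact: smooth_derive.
move=> x Ux; have dk := smooth_differentiable sk Ux.
rewrite !deriveE //; last exact: (differentiable_comp dk (dL _)).
by rewrite (diff_comp dk (dL _)) /= diff_lin.
Qed.

Lemma smooth_pair V W Z (U : set V) (f : V -> W) (g : V -> Z) : open U ->
  smooth_on U f -> smooth_on U g -> smooth_on U (fun x => (f x, g x)).
Proof.
move=> oU sf sg; pose P (h : V -> W * Z) := exists f g, [/\ smooth_on U f,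
  smooth_on U g & h = fun x => (f x, g x)].
apply: (@smooth_coind _ _ _ P) => //; last by exists f, g.
  move=> _ [f1 [g1 [sf1 sg1 ->]]] x Ux.
  by apply: differentiable_pair; apply: smooth_differentiable Ux.
move=> _ v [f1 [g1 [sf1 sg1 ->]]].
exists (fun x => ('D_v f1 x, 'D_v g1 x)).
  exists (fun x => 'D_v f1 x), (fun x => 'D_v g1 x).
  by split=> //; exact: smooth_derive.
move=> x Ux; have df := smooth_differentiable sf1 Ux.
have dg := smooth_differentiable sg1 Ux; rewrite !deriveE //.
  by rewrite diff_pair.
exact: differentiable_pair.
Qed.

Lemma differentiable_mx V m n (f : V -> 'M[R]_(m, n)) x :
  (forall i j, differentiable (fun x => f x i j) x) -> differentiable f x.
Proof.
move=> df.
have -> : f = \sum_(i < m) \sum_(j < n) (fun y => f y i j *: delta_mx i j).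
  apply/funext => y; rewrite [LHS]matrix_sum_delta fct_sumE.
  by apply: eq_bigr => i _; rewrite fct_sumE.
by apply: differentiable_sum => i; apply: differentiable_sum => j;
  exact: differentiableZl.
Qed.

Lemma smooth_mx V m n (U : set V) (f : V -> 'M[R]_(m, n)) : open U ->
  (forall i j, smooth_on U (fun x => f x i j)) -> smooth_on U f.
Proof.
move=> oU sf; pose P (h : V -> 'M[R]_(m, n)) := forall i j, smooth_on U (fun x => h x i j).
have dP h : P h -> forall x, U x -> differentiable h x.
  by move=> Ph x Ux; apply: differentiable_mx => i j;
    exact: smooth_differentiable (Ph i j) Ux.
apply: (@smooth_coind _ _ _ P) => // h v Ph.
exists (fun x => \matrix_(i, j) 'D_v (fun x => h x i j) x).
  move=> i j; apply: smooth_ext (smooth_derive v (Ph i j)) => // x Ux.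
  by rewrite !mxE.
by move=> x Ux; rewrite derive_mx //; apply/diff_derivable/dP.
Qed.

Lemma smooth_entry V m n (U : set V) (f : V -> 'M[R]_(m, n)) i j : open U ->
  smooth_on U f -> smooth_on U (fun x => f x i j).
Proof.
move=> oU sf; pose P (h : V -> R) := exists2 f : V -> 'M[R]_(m, n),
  smooth_on U f & h = fun x => f x i j.
apply: (@smooth_coind _ _ _ P) => //; last by exists f.
  move=> _ [h sh ->] x Ux.
  apply: (@differentiable_comp _ _ _ _ h (fun M : 'M[R]_(m, n) => M i j)).
    exact: smooth_differentiable Ux.
  exact: differentiable_coord.
move=> _ v [h sh ->]; exists (fun x => ('D_v h x) i j).
  by exists (fun x => 'D_v h x) => //; exact: smooth_derive.
move=> x Ux; rewrite derive_mx ?mxE //.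
by apply/diff_derivable; exact: smooth_differentiable Ux.
Qed.

End Composition.

(** * The implicit function theorem *)

HB.instance Definition _ (R : realType) m n := Complete.on 'M[R]_(m, n).

Section RowNorm.
Variable R : realType.

Lemma normr_mx_entry m n (A : 'M[R]_(m, n)) i j : `|A i j| <= `|A|.
Proof.
rewrite [leRHS]/Num.Def.normr /= mx_normrE.
exact: (le_bigmax 0 (fun ij : 'I_m * 'I_n => `|A ij.1 ij.2|) (i, j)).
Qed.

Lemma normr_mx_le m n (A : 'M[R]_(m, n)) c : 0 <= c ->
  (forall i j, `|A i j| <= c) -> `|A| <= c.
Proof.
move=> c0 H; rewrite [leLHS]/Num.Def.normr /= mx_normrE.
by apply: bigmax_le => // -[i j] _.
Qed.

(** In the sup norm, right multiplication by B has operator norm the largest column sum of absolute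
    values. This is why the numerical certificates bound column sums. *)
Lemma normr_mulmx_le m n (v : 'rV[R]_m) (B : 'M[R]_(m, n)) c : 0 <= c ->
  (forall k, \sum_i `|B i k| <= c) -> `|v *m B| <= c * `|v|.
Proof.
move=> c0 H; apply: normr_mx_le => [|i k]; first by rewrite mulr_ge0.
rewrite mxE (le_trans (ler_norm_sum _ _ _)) //.
apply: (@le_trans _ _ (\sum_j `|v| * `|B j k|)).
  apply: ler_sum => j _; rewrite normrM ler_wpM2r //.
  by rewrite (ord1 i) normr_mx_entry.
by rewrite -mulr_sumr mulrC ler_wpM2r.
Qed.

(** A row v with [v *m B = 0] satisfies v = v (1 - B), hence |v| <= c |v| with c < 1. *)
Lemma unitmx_near1 n (B : 'M[R]_n) c : 0 <= c < 1 ->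
  (forall k, \sum_i `|(1%:M - B) i k| <= c) -> B \in unitmx.
Proof.
move=> /andP[c0 c1] H; rewrite -row_free_unit -kermx_eq0.
apply/rowV0P => v /sub_kermxP vB.
have E : v = v *m (1%:M - B) by rewrite mulmxBr mulmx1 vB subr0.
have : `|v| <= c * `|v| by rewrite {1}E; exact: normr_mulmx_le.
rewrite -subr_ge0 -{2}(mul1r `|v|) -mulrBl => H1.
have [->//|/eqP v0] := pselect (v = 0).
have := H1; rewrite pmulr_lge0 ?normr_gt0 // subr_ge0 => /(lt_le_trans c1).
by rewrite ltxx.
Qed.

End RowNorm.

Lemma cvg_bigsum (R : realType) (T : Type) (F : set_system T) (I : Type)
    (r : seq I) (f : I -> T -> R) (l : I -> R) : Filter F ->
  (forall i, f i x @[x --> F] --> l i) ->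
  \sum_(i <- r) f i x @[x --> F] --> \sum_(i <- r) l i.
Proof.
move=> FF fl; elim: r => [|i r IH].
  rewrite big_nil (_ : (fun x => _) = cst 0); first exact: cvg_cst.
  by apply/funext => x; rewrite big_nil.
rewrite big_cons (_ : (fun x => _) = fun x => f i x + \sum_(j <- r) f j x).
  exact: cvgD.
by apply/funext => x; rewrite big_cons.
Qed.

Lemma cvg_mulmx_entry (R : realType) (T : Type) (F : set_system T) m n p
    (f : T -> 'M[R]_(m, n)) (l : 'M[R]_(m, n)) (B : 'M[R]_(n, p)) i k : Filter F ->
  (forall i j, f x i j @[x --> F] --> l i j) ->
  (f x *m B) i k @[x --> F] --> (l *m B) i k.
Proof.
move=> FF fl; rewrite mxE (_ : (fun x => _) = fun x => \sum_j f x i j * B j k).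
  by apply: cvg_bigsum => j; apply: cvgM; [exact: fl|exact: cvg_cst].
by apply/funext => x; rewrite mxE.
Qed.

Lemma cvg_mx (R : realType) (T : Type) (F : set_system T) m n
    (f : T -> 'M[R]_(m, n)) (l : 'M[R]_(m, n)) : Filter F ->
  (forall i j, f x i j @[x --> F] --> l i j) -> f x @[x --> F] --> l.
Proof.
move=> FF fl; apply/cvgrPdist_le => e e0.
have : \forall x \near F, forall i j, `|l i j - f x i j| <= e.
  apply: (@filter_forall T 'I_m (fun i x => forall j, `|l i j - f x i j| <= e)) => i.
  apply: (@filter_forall T 'I_n (fun j x => `|l i j - f x i j| <= e)) => j.
  by have /cvgrPdist_le := fl i j; apply.
apply: filterS => x H; apply: normr_mx_le => [|i j]; first exact: ltW.
by rewrite !mxE.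
Qed.

Lemma mulmxr_continuous (R : realType) m n p (B : 'M[R]_(n, p)) :
  continuous (fun A : 'M[R]_(m, n) => A *m B).
Proof.
move=> A; apply: (@cvg_mx R _ (nbhs A)) => i k.
by apply: (@cvg_mulmx_entry R _ (nbhs A) m n p id) => ? ?; exact: coord_continuous.
Qed.

Lemma mulmx_bounded (R : realType) n p (B : 'M[R]_(n, p)) :
  exists2 K, 0 < K & forall v : 'rV_n, `|v *m B| <= K * `|v|.
Proof.
exists (1 + \sum_k \sum_i `|B i k|) => [|v].
  by rewrite ltr_wpDr // sumr_ge0 // => k _; apply: sumr_ge0.
apply: normr_mulmx_le => [|k].
  by rewrite addr_ge0 // sumr_ge0 // => k _; apply: sumr_ge0.
rewrite (bigD1 k) //= addrCA lerDl addr_ge0 // sumr_ge0 // => i _.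
exact: sumr_ge0.
Qed.

(** * Polynomial expressions and their divided differences *)

Section Polynomials.
Variable R : realType.

(** Expressions are kept as syntax so that the same equation can be evaluated over the reals and,
    for the certificates, in Q(sqrt 3). *)
Inductive pexpr := PVar of nat | PC of int | PAdd of pexpr & pexpr
  | PMul of pexpr & pexpr.

Fixpoint peval (e : nat -> R) (t : pexpr) : R := match t with
  | PVar k => e k
  | PC c => c%:~R
  | PAdd a b => peval e a + peval e b
  | PMul a b => peval e a * peval e b
  end.

Variables (m n : nat) (sel : nat -> 'I_m + 'I_n).

(** [sel] splits the numbered variables into parameters ([inl]) and unknowns ([inr]), so that one
    system of equations serves for several choices of unknowns. *)
Definition env (y : 'rV[R]_m) (x : 'rV[R]_n) (k : nat) : R :=
  match sel k with inl j => y 0 j | inr i => x 0 i end.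

(** A divided difference. In a product one factor is evaluated at each of the two points, which
    makes the increment formula [slopeP] exact rather than first-order; on the diagonal it is the
    partial derivative. *)
Fixpoint slope (c : 'I_m + 'I_n) (e1 e2 : nat -> R) (t : pexpr) : R :=
  match t with
  | PVar k => (sel k == c)%:R
  | PC _ => 0
  | PAdd a b => slope c e1 e2 a + slope c e1 e2 b
  | PMul a b => peval e1 a * slope c e1 e2 b + slope c e1 e2 a * peval e2 b
  end.

Lemma slopeP y x y' x' t :
  peval (env y x) t - peval (env y' x') t =
  \sum_j (y - y') 0 j * slope (inl j) (env y x) (env y' x') t +
  \sum_i (x - x') 0 i * slope (inr i) (env y x) (env y' x') t.
Proof.
elim: t => [k|c|a IHa b IHb|a IHa b IHb] /=.
- rewrite /env; case Ek : (sel k) => [j0|i0].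
    rewrite [X in _ = _ + X]big1 => [|i _]; last by rewrite mulr0.
    rewrite (bigD1 j0) //= eqxx mulr1 big1 ?addr0 ?mxE // => j jj0.
    by rewrite (_ : inl _ == inl _ = false) ?mulr0 // (inj_eq (@inl_inj _ _)) eq_sym; apply/negbTE.
  rewrite [X in _ = X + _]big1 => [|i _]; last by rewrite mulr0.
  rewrite (bigD1 i0) //= eqxx mulr1 big1 ?addr0 ?add0r ?mxE // => j jj0.
  by rewrite (_ : inr _ == inr _ = false) ?mulr0 // (inj_eq (@inr_inj _ _)) eq_sym; apply/negbTE.
- by rewrite subrr !big1 ?addr0 // => i _; rewrite mulr0.
- rewrite opprD addrACA IHa IHb addrACA; congr (_ + _); rewrite -big_split;
  by apply: eq_bigr => i _; rewrite mulrDr.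
- have -> (p q r s : R) : p * q - r * s = p * (q - s) + (p - r) * s.
    by rewrite mulrBr mulrBl addrA subrK.
  rewrite IHa IHb mulrDr mulrDl addrACA; congr (_ + _);
  rewrite mulr_sumr mulr_suml -big_split; apply: eq_bigr => i _ /=;
  by ring.
Qed.

Local Notation Z := (('rV[R]_m * 'rV[R]_n) * ('rV[R]_m * 'rV[R]_n))%type.

Lemma env_continuous k : continuous (fun p : 'rV[R]_m * 'rV[R]_n => env p.1 p.2 k).
Proof.
move=> p; rewrite /env; case: (sel k) => i.
  by apply: (@continuous_comp _ _ _ fst (fun y : 'rV[R]_m => y 0 i)); [exact: cvg_fst|exact: coord_continuous].
by apply: (@continuous_comp _ _ _ snd (fun y : 'rV[R]_n => y 0 i)); [exact: cvg_snd|exact: coord_continuous].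
Qed.

Lemma peval_continuous t :
  continuous (fun p : 'rV[R]_m * 'rV[R]_n => peval (env p.1 p.2) t).
Proof.
elim: t => [k|c|a IHa b IHb|a IHa b IHb] p /=.
- exact: env_continuous.
- exact: cvg_cst.
- by apply: cvgD; [exact: IHa|exact: IHb].
- by apply: cvgM; [exact: IHa|exact: IHb].
Qed.

Lemma slope_continuous c t :
  continuous (fun p : Z => slope c (env p.1.1 p.1.2) (env p.2.1 p.2.2) t).
Proof.
elim: t => [k|d|a IHa b IHb|a IHa b IHb] p /=.
- exact: cvg_cst.
- exact: cvg_cst.
- by apply: cvgD; [exact: IHa|exact: IHb].
- apply: cvgD; apply: cvgM; try solve [exact: IHa | exact: IHb].
    by apply: (@continuous_comp _ _ _ fst (fun p : 'rV[R]_m * 'rV[R]_n => peval (env p.1 p.2) a));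
      [exact: cvg_fst|exact: peval_continuous].
  by apply: (@continuous_comp _ _ _ snd (fun p : 'rV[R]_m * 'rV[R]_n => peval (env p.1 p.2) b));
      [exact: cvg_snd|exact: peval_continuous].
Qed.

End Polynomials.

Section ImplicitFunction.
Variables (R : realType) (m n : nat) (sel : nat -> 'I_m + 'I_n).
Variables (G : 'I_n -> pexpr) (y0 : 'rV[R]_m) (x0 : 'rV[R]_n) (A : 'M[R]_n).
Local Notation Z := (('rV[R]_m * 'rV[R]_n) * ('rV[R]_m * 'rV[R]_n))%type.
Let p0 : Z := ((y0, x0), (y0, x0)).

Let Gv y x : 'rV[R]_n := \row_k peval (env sel y x) (G k).
Let Sy (p : Z) : 'M[R]_(m, n) := \matrix_(j, k)
  slope sel (inl j) (env sel p.1.1 p.1.2) (env sel p.2.1 p.2.2) (G k).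
Definition slope_mx (p : Z) : 'M[R]_n := \matrix_(i, k)
  slope sel (inr i) (env sel p.1.1 p.1.2) (env sel p.2.1 p.2.2) (G k).
Let Sx := slope_mx.

Hypothesis G0 : forall k, peval (env sel y0 x0) (G k) = 0.
Hypothesis HA : forall k, \sum_i `|(1%:M - Sx p0 *m A) i k| < 1 / 2.

Let GvP y x y' x' : Gv y x - Gv y' x' =
  (y - y') *m Sy ((y, x), (y', x')) + (x - x') *m Sx ((y, x), (y', x')).
Proof.
apply/rowP => k; rewrite !mxE slopeP.
by congr (_ + _); apply: eq_bigr => i _; rewrite !mxE.
Qed.

Let Sx_cvg p i k : Sx q i k @[q --> p] --> Sx p i k.
Proof.
rewrite [X in _ --> X]mxE (_ : (fun q => _) = fun q : Z =>
  slope sel (inr i) (env sel q.1.1 q.1.2) (env sel q.2.1 q.2.2) (G k)).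
  exact: slope_continuous.
by apply/funext => q; rewrite mxE.
Qed.

Let Sy_cvg p j k : Sy q j k @[q --> p] --> Sy p j k.
Proof.
rewrite [X in _ --> X]mxE (_ : (fun q => _) = fun q : Z =>
  slope sel (inl j) (env sel q.1.1 q.1.2) (env sel q.2.1 q.2.2) (G k)).
  exact: slope_continuous.
by apply/funext => q; rewrite mxE.
Qed.

(** The summand 1 makes [C] positive and strictly larger than every column sum at [p0], so that the
    bound persists near [p0]. *)
Let C : R := 1 + \sum_k \sum_j `|(Sy p0 *m A) j k|.

Let C0 : 0 < C.
Proof.
rewrite /C ltr_wpDr // sumr_ge0 // => k _.
by apply: sumr_ge0.
Qed.

Let near_p0 : \forall p \near p0,
  (forall k, \sum_i `|(1%:M - Sx p *m A) i k| <= 1 / 2) /\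
  (forall k, \sum_j `|(Sy p *m A) j k| <= C).
Proof.
have FF : Filter (nbhs p0) by exact: nbhs_filter.
have H1 : \forall p \near p0, forall k, \sum_i `|(1%:M - Sx p *m A) i k| <= 1 / 2.
  apply: (@filter_forall Z 'I_n (fun k p => \sum_i `|(1%:M - Sx p *m A) i k| <= 1 / 2) (nbhs p0) FF) => k.
  have : \sum_i `|(1%:M - Sx p *m A) i k| @[p --> p0] -->
         \sum_i `|(1%:M - Sx p0 *m A) i k|.
    apply: cvg_bigsum => i; apply: cvg_norm.
    rewrite [X in _ --> X]mxE [X in _ --> _ + X]mxE.
    rewrite (_ : (fun p => _) = fun p => (1%:M : 'M[R]_n) i k - (Sx p *m A) i k).
      apply: cvgB; first exact: cvg_cst.
      by apply: cvg_mulmx_entry => // *; exact: Sx_cvg.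
    by apply/funext => p; rewrite mxE [X in _ + X]mxE.
  move=> /cvgr_lt /(_ _ (HA k)) H.
  by apply: filterS H => p /ltW.
have H2 : \forall p \near p0, forall k, \sum_j `|(Sy p *m A) j k| <= C.
  apply: (@filter_forall Z 'I_n (fun k p => \sum_j `|(Sy p *m A) j k| <= C) (nbhs p0) FF) => k.
  have : \sum_j `|(Sy p *m A) j k| @[p --> p0] --> \sum_j `|(Sy p0 *m A) j k|.
    apply: cvg_bigsum => i; apply: cvg_norm.
    by apply: cvg_mulmx_entry => // *; exact: Sy_cvg.
  move=> /cvgr_lt /(_ C) H; suff /H : \sum_j `|(Sy p0 *m A) j k| < C.
    by move=> K; apply: filterS K => p /ltW.
  rewrite /C (bigD1 k) //= addrCA ltrDl ltr_wpDr // sumr_ge0 // => i _.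
  by apply: sumr_ge0.
by near=> p; split; near: p.
Unshelve. all: by end_near. Qed.

(** [A] is only an approximate inverse of the Jacobian matrix: an error below 1/2 in operator norm
    already makes the simplified Newton step a contraction of ratio 1/2. Keeping [X] inside a
    prescribed neighbourhood makes further inequalities available on the solutions. *)
Lemma implicit_function (N : set 'rV[R]_n) : nbhs x0 N ->
  exists (Y : set 'rV[R]_m) (X : set 'rV[R]_n) (g : 'rV[R]_m -> 'rV[R]_n),
    [/\ open Y /\ Y y0, [/\ open X, X x0 & X `<=` N],
        forall y, Y y -> X (g y),
        forall y x, Y y -> X x ->
          ((forall k, peval (env sel y x) (G k) = 0) <-> x = g y)
      & smooth_on Y g].
Proof.
move=> /nbhs_ballP[rN /= rN0 NN].
have /nbhs_ballP[r1 /= r10 near1] := near_p0.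
pose r := Num.min rN r1.
have r0 : 0 < r by rewrite lt_min rN0.
have rr1 : r <= r1 by rewrite ge_min lexx orbT.
have rrN : r <= rN by rewrite ge_min lexx.
have {}near1 y x y' x' : `|y0 - y| < r -> `|x0 - x| < r -> `|y0 - y'| < r ->
    `|x0 - x'| < r ->
  let p := ((y, x), (y', x')) in
  (forall k, \sum_i `|(1%:M - Sx p *m A) i k| <= 1 / 2) /\
  (forall k, \sum_j `|(Sy p *m A) j k| <= C).
  move=> h1 h2 h3 h4; apply: near1.
  by split; split; rewrite /= -ball_normE /=; apply: lt_le_trans rr1.
(* The fixed points of this simplified Newton step are the zeros of Gv y. *)
pose T y x := x - Gv y x *m A.
have r20 : 0 < r / 2 by rewrite divr_gt0.
have r2r : r / 2 < r by rewrite ltr_pdivrMr // ltr_pMr // ltr1n.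
have Tctr y x x' : `|y0 - y| < r -> `|x0 - x| < r -> `|x0 - x'| < r ->
    `|T y x - T y x'| <= 1 / 2 * `|x - x'|.
  move=> h1 h2 h3; have [H _] := near1 _ _ _ _ h1 h2 h1 h3.
  have -> : T y x - T y x' = (x - x') *m (1%:M - Sx ((y, x), (y, x')) *m A).
    rewrite mulmxBr mulmx1 mulmxA -[(x - x') *m Sx _]add0r.
    rewrite -{1}(mul0mx _ (Sy ((y, x), (y, x')))) -(subrr y) -GvP.
    by rewrite mulmxBl /T !opprD addrACA.
  by apply: normr_mulmx_le.
have h00 : `|y0 - y0| < r by rewrite subrr normr0.
have h0x : `|x0 - x0| < r by rewrite subrr normr0.
(* Invertibility of [A] is what allows one to pass from a fixed point of [T y] back to a zero of
   [Gv y]. *)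
have uA : A \in unitmx.
  have [H _] := near1 _ _ _ _ h00 h0x h00 h0x.
  have : Sx p0 *m A \in unitmx.
    by apply: unitmx_near1 H; lra.
  by rewrite unitmx_mul => /andP[].
(* With this radius [T y] moves [x0] by less than r / 4, and the contraction adds at most half of r
   / 2: the closed ball of radius r / 2 is mapped into its interior. *)
pose r' := Num.min r (r / (4 * C)).
have r'0 : 0 < r' by rewrite lt_min r0 divr_gt0 // mulr_gt0.
have Yr y : `|y0 - y| < r' -> `|y0 - y| < r by rewrite lt_min => /andP[].
have T0 y : `|y0 - y| < r' -> `|x0 - T y x0| < r / 4.
  move=> hy; have hr := Yr _ hy.
  have -> : x0 - T y x0 = (y - y0) *m (Sy ((y, x0), (y0, x0)) *m A).
    rewrite /T opprB addrCA subrr addr0 mulmxA -[in RHS](addr0 (_ *m Sy _)).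
    rewrite -{1}(mul0mx _ (Sx ((y, x0), (y0, x0)))) -(subrr x0) -GvP.
    rewrite (_ : Gv y0 x0 = 0) ?subr0 //.
    by apply/rowP => k; rewrite !mxE.
  have [_ H] := near1 _ _ _ _ hr h0x h00 h0x.
  apply: le_lt_trans (normr_mulmx_le _ (ltW C0) H) _.
  move: hy; rewrite lt_min => /andP[_].
  rewrite ltr_pdivlMr ?mulr_gt0 // distrC => hy.
  by rewrite ltr_pdivlMr //; lra.
have Tx y x : `|y0 - y| < r' -> `|x0 - x| <= r / 2 -> `|x0 - T y x| < r / 2.
  move=> hy hx.
  have hx' : `|x0 - x| < r by exact: le_lt_trans r2r.
  have -> : x0 - T y x = (x0 - T y x0) + (T y x0 - T y x) by rewrite addrA subrK.
  apply: le_lt_trans (ler_normD _ _) _.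
  have h1 := T0 _ hy; have h2 := Tctr _ _ _ (Yr _ hy) h0x hx'.
  by lra.
pose Y := ball y0 r'; pose X := ball x0 (r / 2).
have YE y : Y y = (`|y0 - y| < r') :> Prop by rewrite /Y -ball_normE.
have XE x : X x = (`|x0 - x| < r / 2) :> Prop by rewrite /X -ball_normE.
have Xr x : X x -> `|x0 - x| < r by rewrite XE => h; exact: lt_trans r2r.
have fix_ y : exists x, Y y -> X x /\ x = T y x.
  have [hy|hy] := pselect (Y y); last by exists x0.
  rewrite YE in hy.
  (* The fixed point is sought in the closed ball, which is complete; the strict inequality of [Tx]
     then places it in the open ball [X]. *)
  pose Xc := closed_ball x0 (r / 2).
  have XcE x : Xc x = (`|x0 - x| <= r / 2) :> Prop by rewrite /Xc closed_ballE.
  have homT : {homo T y : x / Xc x >-> Xc x}.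
    by move=> x; rewrite !XcE => hx; apply/ltW/Tx.
  have [f fE] := Pfun homT.
  have [|||x hx xE] := @banach_fixed_point R _ Xc f.
  - exists ((1 / 2)%:nng); split => /=; first by lra.
    move=> [a b] /= [ha hb]; rewrite !XcE in ha hb.
    by rewrite -fE; apply: Tctr (Yr _ hy) _ _; apply: le_lt_trans r2r.
  - exact: closed_ball_closed.
  - by exists x0; rewrite XcE subrr normr0 ltW.
  exists x => _; rewrite XE; rewrite -fE in xE.
  by split=> //; rewrite XcE in hx; rewrite xE; apply: Tx.
have /choice[g gP] := fix_.
have gX y : Y y -> X (g y) by move=> /gP[].
have gT y : Y y -> g y = T y (g y) by move=> /gP[].
have Yr' y : Y y -> `|y0 - y| < r by rewrite YE => /Yr.
have G0E y x : (forall k, peval (env sel y x) (G k) = 0) <-> Gv y x = 0.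
  split=> [H|H k]; first by apply/rowP => k; rewrite !mxE.
  by have := congr1 (fun M : 'rV_n => M 0 k) H; rewrite !mxE.
have gG y x : Y y -> X x ->
    ((forall k, peval (env sel y x) (G k) = 0) <-> x = g y).
  move=> hy hx; rewrite G0E; split=> [E|->].
    have xT : x = T y x by rewrite /T E mul0mx subr0.
    have := Tctr _ _ _ (Yr' _ hy) (Xr _ hx) (Xr _ (gX _ hy)).
    rewrite -xT -gT // => H.
    apply/subr0_eq/normr0_eq0/le_anti; rewrite normr_ge0 andbT.
    by lra.
  have /eqP := gT _ hy; rewrite /T -subr_eq0 opprB addrCA subrr addr0.
  by move=> /eqP E; apply: (can_inj (mulmxK uA)); rewrite E mul0mx.
have Gg y : Y y -> Gv y (g y) = 0 by move=> hy; apply/G0E/gG => //; exact: gX.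
have Pg y y' : Y y -> Y y' -> let p := ((y', g y'), (y, g y)) in
   (y' - y) *m Sy p + (g y' - g y) *m Sx p = 0.
  by move=> hy hy'; rewrite /= -GvP !Gg // subrr.
(* Two zeros of the system are related by the exact identity [Pg]. Absorbing the contracted half of
   the left-hand side gives this Lipschitz bound, from which the continuity of g follows. *)
have gLip y y' : Y y -> Y y' -> `|g y' - g y| <= 2 * C * `|y' - y|.
  move=> hy hy'; have E := Pg _ _ hy hy'.
  have [H1 H2] := near1 _ _ _ _ (Yr' _ hy') (Xr _ (gX _ hy')) (Yr' _ hy) (Xr _ (gX _ hy)).
  set p := (_, _) in E H1 H2.
  have E2 : g y' - g y = (g y' - g y) *m (1%:M - Sx p *m A) - (y' - y) *m (Sy p *m A).
    rewrite mulmxBr mulmx1 !mulmxA -addrA -opprD -mulmxDl [X in X *m A]addrC E.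
    by rewrite mul0mx subr0.
  have : `|g y' - g y| <= 1 / 2 * `|g y' - g y| + C * `|y' - y|.
    rewrite {1}E2; apply: le_trans (ler_normB _ _) _; apply: lerD.
      exact: normr_mulmx_le.
    exact: normr_mulmx_le (ltW C0) _.
  by lra.
have oY : open Y by exact: ball_open.
have uSx y : Y y -> Sx ((y, g y), (y, g y)) \in unitmx.
  move=> hy.
  have [H _] := near1 _ _ _ _ (Yr' _ hy) (Xr _ (gX _ hy)) (Yr' _ hy) (Xr _ (gX _ hy)).
  have : Sx ((y, g y), (y, g y)) *m A \in unitmx.
    by apply: unitmx_near1 H; lra.
  by rewrite unitmx_mul => /andP[].
pose D y := - (Sy ((y, g y), (y, g y)) *m invmx (Sx ((y, g y), (y, g y)))).
have dg y : Y y -> differentiable g y /\ 'd g y = mulmxr (D y) :> ('rV_m -> 'rV_n).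
  move=> hy; pose q : Z := ((y, g y), (y, g y)).
  have F0 : Filter (nbhs (0 : 'rV[R]_m)) by exact: nbhs_filter.
  pose p (h : 'rV[R]_m) : Z := ((h + y, g (h + y)), (y, g y)).
  have hY : \forall h \near (0 : 'rV[R]_m), Y (h + y).
    have : (fun h : 'rV[R]_m => h + y) @ (0 : 'rV[R]_m) --> y.
      exact: shift_cvg.
    by move=> /(_ _ (open_nbhs_nbhs (conj oY hy))).
  have cg : g (h + y) @[h --> (0 : 'rV[R]_m)] --> g y.
    apply/cvgrPdist_lt => e e0.
    have e1 : 0 < e / (2 * C) by rewrite divr_gt0 // mulr_gt0.
    have hs : \forall h \near (0 : 'rV[R]_m), `|h| < e / (2 * C).
      by apply/nbhs_ballP; exists (e / (2 * C)) => // h; rewrite -ball_normE /= sub0r normrN.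
    apply: (@filterS2 _ (nbhs (0 : 'rV[R]_m)) F0 _ _ _ _ hY hs) => h {}hY {}hs.
    rewrite distrC; apply: le_lt_trans (gLip _ _ hy hY) _.
    by rewrite addrK mulrC -ltr_pdivlMr // mulr_gt0.
  have cp : p h @[h --> (0 : 'rV[R]_m)] --> q.
    have c1 : (fun h : 'rV[R]_m => h + y) @ (0 : 'rV[R]_m) --> y.
      exact: shift_cvg.
    exact: cvg_pair (cvg_pair c1 cg) (cvg_cst _).
  have near_sum k l (S : Z -> 'M[R]_(k, l)) : (forall i j, S z i j @[z --> q] --> S q i j) ->
    forall e, 0 < e -> \forall h \near (0 : 'rV[R]_m),
      forall j, \sum_i `|(S (p h) - S q) i j| <= e.
    move=> cS e e0.
    apply: (@filter_forall _ 'I_l (fun j h => \sum_i `|(S (p h) - S q) i j| <= e)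
      (nbhs (0 : 'rV[R]_m)) F0) => j.
    have : \sum_i `|(S (p h) - S q) i j| @[h --> (0 : 'rV[R]_m)] --> \sum_(i < k) (0 : R).
      apply: cvg_bigsum => i; rewrite -(@normr0 R R); apply: cvg_norm.
      rewrite -[X in _ --> X](subrr (S q i j)) (_ : (fun h => _) =
        fun h => S (p h) i j - S q i j); last by apply/funext => h; rewrite !mxE.
      apply: cvgB; last exact: cvg_cst.
      exact: cvg_comp cp (cS i j).
    rewrite big1 // => /cvgr_lt /(_ _ e0) H.
    by apply: (@filterS _ (nbhs (0 : 'rV[R]_m)) F0 _ _ _ H) => h /ltW.
  apply: differentiable_of_bound; first exact: mulmxr_continuous.
  move=> e e0.
  have [K K0 HK] := mulmx_bounded (invmx (Sx q)).
  (* Chosen so that K (1 + 2 C) d = e, where 2 C is the Lipschitz constant of g. *)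
  pose d := e / (K * (1 + 2 * C)).
  have C2 : 0 < 1 + 2 * C by rewrite addr_gt0 // mulr_gt0.
  have d0 : 0 < d by rewrite divr_gt0 // mulr_gt0.
  have n1 := near_sum _ _ Sy (@Sy_cvg q) _ d0.
  have n2 := near_sum _ _ Sx (@Sx_cvg q) _ d0.
  near=> h.
  have hYh : Y (h + y) by near: h.
  have := Pg _ _ hy hYh; rewrite -/(p h) addrK => E.
  (* By [Pg] the linear parts cancel; what remains involves only the variation of the slopes between
     [p h] and [q], which tends to 0 with h. *)
  have -> : g (h + y) - g y - mulmxr (D y) h = - ((h *m (Sy (p h) - Sy q) +
      (g (h + y) - g y) *m (Sx (p h) - Sx q)) *m invmx (Sx q)).
    rewrite !mulmxBr addrACA E add0r -opprD mulNmx opprK mulmxDl.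
    rewrite mulmxK; last exact: uSx.
    by rewrite /D /= mulmxN opprK mulmxA addrC.
  rewrite normrN; apply: le_trans (HK _) _.
  have b1 : `|h *m (Sy (p h) - Sy q)| <= d * `|h|.
    by apply: normr_mulmx_le; [exact: ltW | near: h].
  have b2 : `|(g (h + y) - g y) *m (Sx (p h) - Sx q)| <= d * (2 * C * `|h|).
    apply: (@le_trans _ _ (d * `|g (h + y) - g y|)).
      by apply: normr_mulmx_le; [exact: ltW | near: h].
    by rewrite ler_pM2l //; apply: le_trans (gLip _ _ hy hYh) _; rewrite addrK.
  apply: (@le_trans _ _ (K * (d * `|h| + d * (2 * C * `|h|)))).
    rewrite ler_pM2l //; apply: le_trans (ler_normD _ _) _; exact: lerD.
  have -> : K * (d * `|h| + d * (2 * C * `|h|)) = (K * (1 + 2 * C) * d) * `|h| by ring.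
  by rewrite /d [_ * (e / _)]mulrCA divff ?mulr1 // mulf_neq0 ?gt_eqF.
exists Y, X, g; split => //.
- by split=> //; rewrite YE subrr normr0.
- split; [exact: ball_open | by rewrite XE subrr normr0 | move=> x; rewrite XE => hx].
  by apply: NN; rewrite -ball_normE /=; apply: lt_le_trans rrN; exact: lt_trans r2r.
(* The entries of y, g y and of the inverse Jacobian matrix generate an algebra
   which is stable under directional derivatives. *)
pose Gen (f : 'rV[R]_m -> R) := (exists j, f = fun y => y 0 j) \/
  (exists i, f = fun y => g y 0 i).
have aenv k : alg Y Gen (fun y => env sel y (g y) k).
  rewrite /env; case: (sel k) => i; apply: alg_gen; [left|right]; by exists i.
have aev t : alg Y Gen (fun y => peval (env sel y (g y)) t).
  by elim: t => [k|c|a IHa b IHb|a IHa b IHb] /=; [exact: aenv|exact: alg_cst|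
    exact: alg_add|exact: alg_mul].
have aslope c t : alg Y Gen (fun y => slope sel c (env sel y (g y)) (env sel y (g y)) t).
  elim: t => [k|b|a IHa b IHb|a IHa b IHb] /=; [exact: alg_cst|exact: alg_cst|
    exact: alg_add|].
  by apply: alg_add; apply: alg_mul.
have aSx i k : alg Y Gen (fun y => Sx ((y, g y), (y, g y)) i k).
  rewrite (_ : (fun y => _) = fun y => slope sel (inr i) (env sel y (g y)) (env sel y (g y)) (G k));
   first exact: aslope.
  by apply/funext => y; rewrite mxE.
have aSy j k : alg Y Gen (fun y => Sy ((y, g y), (y, g y)) j k).
  rewrite (_ : (fun y => _) = fun y => slope sel (inl j) (env sel y (g y)) (env sel y (g y)) (G k));
   first exact: aslope.
  by apply/funext => y; rewrite mxE.
have dGen f : Gen f -> forall y, Y y -> differentiable f y.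
  move=> [[j ->]|[i ->]] y hy; first exact: differentiable_coord.
  apply: (@differentiable_comp _ _ _ _ g (fun M : 'rV[R]_n => M 0 i)).
    by have [] := dg _ hy.
  exact: differentiable_coord.
have DGen f v : Gen f -> exists2 f', alg Y Gen f' & forall y, Y y -> 'D_v f y = f' y.
  move=> [[j ->]|[i ->]].
    exists (cst (v 0 j)); first exact: alg_cst.
    move=> y _; have := congr1 (fun M : 'rV_m => M 0 j) (derive_id y v).
    by rewrite derive_mx ?mxE //; exact: derivable_id.
  have /choice[F FP] : forall k, exists f, alg Y Gen f /\
      forall y, Y y -> invmx (Sx ((y, g y), (y, g y))) k i = f y.
    by move=> k; have [F aF FE] := alg_invmx aSx uSx k i; exists F.
  exists (fun y => \sum_k - (\sum_j v 0 j * Sy ((y, g y), (y, g y)) j k) * F k y).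
    apply: alg_sum => k _; apply: alg_mul; last by have [] := FP k.
    apply/alg_opp/alg_sum => j _; apply: alg_mul => //; exact: alg_cst.
  move=> y hy; have [dgy dgE] := dg _ hy.
  have := congr1 (fun M : 'rV_n => M 0 i) (derive_mx (diff_derivable (v := v) dgy)).
  rewrite mxE => <-; rewrite deriveE // dgE /= /D mulmxN mulmxA mxE mxE -sumrN.
  apply: eq_bigr => k _; have [_ FE] := FP k.
  by rewrite FE // mxE mulNr.
apply: smooth_mx => // i j; rewrite (ord1 i).
by apply: alg_smooth dGen DGen _ _ => //; apply: alg_gen; right; exists j.
Unshelve. all: by end_near. Qed.
End ImplicitFunction.

(** * Arithmetic in Q(sqrt 3) *)

(* (a, b, d) stands for (a + b sqrt 3) / d. *)
Definition qs3 : Type := (Z * Z * positive)%type.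

(** Cancelling the common factor keeps the integers small in the long computations. *)
Definition s3red (x : qs3) : qs3 := let: (a, b, d) := x in
  let g := Z.gcd a (Z.gcd b (Zpos d)) in
  (Z.div a g, Z.div b g, Z.to_pos (Z.div (Zpos d) g)).
Definition s3zero (x : qs3) : bool := let: (a, b, _) := x in Z.eqb a 0 && Z.eqb b 0.
Definition s3add (x y : qs3) : qs3 :=
  if s3zero x then y else if s3zero y then x else
  let: (a, b, d) := x in let: (a', b', d') := y in
  s3red (Z.add (Z.mul a (Zpos d')) (Z.mul a' (Zpos d)),
        Z.add (Z.mul b (Zpos d')) (Z.mul b' (Zpos d)), Pos.mul d d').
Definition s3mul (x y : qs3) : qs3 :=
  if s3zero x || s3zero y then (Z0, Z0, xH) else
  let: (a, b, d) := x in let: (a', b', d') := y in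
  s3red (Z.add (Z.mul a a') (Z.mul 3 (Z.mul b b')),
        Z.add (Z.mul a b') (Z.mul a' b), Pos.mul d d').
Definition s3opp (x : qs3) : qs3 := let: (a, b, d) := x in (Z.opp a, Z.opp b, d).
Definition s3sub x y := s3add x (s3opp y).
Definition s3int (z : Z) : qs3 := (z, Z0, xH).
Definition s3ofint (n : int) : qs3 := s3int (Z_of_int n).
Definition s3half : qs3 := (Zpos xH, Z0, xO xH).
(** When a and b have opposite signs, the sign of a + b sqrt 3 is found by comparing a^2 with 3
    b^2. *)
Definition s3pos (x : qs3) : bool := let: (a, b, _) := x in
  if Z.leb 0 a then
    if Z.leb 0 b then Z.ltb 0 a || Z.ltb 0 b
    else Z.ltb (Z.mul 3 (Z.mul b b)) (Z.mul a a)
  else Z.ltb 0 b && Z.ltb (Z.mul a a) (Z.mul 3 (Z.mul b b)).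
Definition s3lt x y := s3pos (s3sub y x).
Definition s3eq (x y : qs3) : bool :=
  let: (a, b, d) := x in let: (a', b', d') := y in
  Z.eqb (Z.mul a (Zpos d')) (Z.mul a' (Zpos d)) &&
  Z.eqb (Z.mul b (Zpos d')) (Z.mul b' (Zpos d)).
(* The last branch is never reached but is an upper bound whose correctness
   does not require the completeness of the sign test. *)
Definition s3abs (x : qs3) := if s3pos x then x else if s3pos (s3opp x) then s3opp x
  else if s3eq x (s3int 0) then s3int 0 else s3add (s3mul x x) (s3int 1).
Definition s3sum n (f : nat -> qs3) := foldr (fun i s => s3add (f i) s) (s3int 0) (iota 0 n).

Section Interpretation.
Variable R : realType.

Definition ZR (z : Z) : R := (int_of_Z z)%:~R.

Lemma ZRD x y : ZR (Z.add x y) = ZR x + ZR y.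
Proof. by rewrite /ZR -rmorphD; congr (_%:~R); exact: (rmorphD int_of_Z). Qed.
Lemma ZRM x y : ZR (Z.mul x y) = ZR x * ZR y.
Proof. by rewrite /ZR -rmorphM; congr (_%:~R); exact: (rmorphM int_of_Z). Qed.
Lemma ZRN x : ZR (Z.opp x) = - ZR x.
Proof. by rewrite /ZR -rmorphN; congr (_%:~R); exact: (rmorphN int_of_Z). Qed.
Lemma ZR_lt x y : (ZR x < ZR y) = Z.ltb x y.
Proof. by rewrite /ZR ltr_int; lia. Qed.
Lemma ZR_le x y : (ZR x <= ZR y) = Z.leb x y.
Proof. by rewrite /ZR ler_int; lia. Qed.
Lemma ZR_pos d : 0 < ZR (Zpos d).
Proof. by rewrite -[0]/(ZR 0) ZR_lt. Qed.

Definition KR (x : qs3) : R := let: (a, b, d) := x in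
  (ZR a + ZR b * Num.sqrt 3) / ZR (Zpos d).

Let s3 : Num.sqrt 3 * Num.sqrt 3 = 3 :> R.
Proof. by rewrite -expr2 sqr_sqrtr. Qed.

Lemma s3redP x : KR (s3red x) = KR x.
Proof.
case: x => [[a b] d]; rewrite /s3red.
set g := Z.gcd a _.
have ga : Z.divide g a by exact: Z.gcd_divide_l.
have gb : Z.divide g b by exact: Z.divide_trans (Z.gcd_divide_r _ _) (Z.gcd_divide_l _ _).
have gd : Z.divide g (Zpos d) by exact: Z.divide_trans (Z.gcd_divide_r _ _) (Z.gcd_divide_r _ _).
have g0 : Z.lt 0 g.
  have : Z.le 0 g by exact: Z.gcd_nonneg.
  case: gd => k Ek; have : g <> Z0 by move=> g0; rewrite g0 Z.mul_0_r in Ek.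
  by lia.
have gE c : Z.divide g c -> ZR c = ZR (Z.div c g) * ZR g.
  move=> [k ->]; rewrite Z.div_mul ?ZRM //; lia.
have dp : Zpos (Z.to_pos (Z.div (Zpos d) g)) = Z.div (Zpos d) g.
  apply: Z2Pos.id; case: gd => k Ek; rewrite Ek Z.div_mul; last by lia.
  have : Z.lt 0 (Z.mul k g) by rewrite -Ek; lia.
  by nia.
rewrite /KR dp (gE _ ga) (gE _ gb) (gE _ gd).
have h1 : ZR g != 0 by rewrite gt_eqF // -[0]/(ZR 0) ZR_lt; lia.
have h2 : ZR (Z.div (Zpos d) g) != 0.
  by have := ZR_pos d; rewrite (gE _ gd) => /lt0r_neq0; rewrite mulf_eq0 => /norP[].
by field; rewrite h1 h2.
Qed.

Lemma s3zeroP x : s3zero x -> KR x = 0.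
Proof.
by case: x => [[a b] d] /andP[/Z.eqb_eq -> /Z.eqb_eq ->]; rewrite /KR /= mul0r addr0 mul0r.
Qed.

Lemma s3addP x y : KR (s3add x y) = KR x + KR y.
Proof.
rewrite /s3add; case: ifP => [/s3zeroP ->|_]; first by rewrite add0r.
case: ifP => [/s3zeroP ->|_]; first by rewrite addr0.
case: x y => [[a b] d] [[a' b'] d']; rewrite s3redP /KR.
rewrite !ZRD -[Zpos (d * d')]/(Z.mul (Zpos d) (Zpos d')) !ZRM.
have := ZR_pos d; have := ZR_pos d' => /lt0r_neq0 h1 /lt0r_neq0 h2.
by field; rewrite h1 h2.
Qed.

Lemma s3mulP x y : KR (s3mul x y) = KR x * KR y.
Proof.
rewrite /s3mul; case: ifP => [/orP[] /s3zeroP ->|_]; rewrite ?mul0r ?mulr0.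
- by rewrite /KR /= mul0r addr0 mul0r.
- by rewrite /KR /= mul0r addr0 mul0r.
case: x y => [[a b] d] [[a' b'] d']; rewrite s3redP /KR.
rewrite !ZRD -[Zpos (d * d')]/(Z.mul (Zpos d) (Zpos d')) !ZRM.
have -> : ZR 3 = Num.sqrt 3 * Num.sqrt 3 by rewrite s3.
have := ZR_pos d; have := ZR_pos d' => /lt0r_neq0 h1 /lt0r_neq0 h2.
by field; rewrite h1 h2.
Qed.

Lemma s3oppP x : KR (s3opp x) = - KR x.
Proof. by case: x => [[a b] d]; rewrite /KR /= !ZRN mulNr -opprD mulNr. Qed.

Lemma s3subP x y : KR (s3sub x y) = KR x - KR y.
Proof. by rewrite s3addP s3oppP. Qed.

Lemma s3intP z : KR (s3int z) = ZR z.
Proof. by rewrite /KR /= mul0r addr0 divr1. Qed.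

Lemma s3ofintP n : KR (s3ofint n) = n%:~R.
Proof. by rewrite s3intP /ZR Z_of_intK. Qed.

Lemma s3posP x : s3pos x -> 0 < KR x.
Proof.
case: x => [[a b] d]; rewrite /s3pos /KR => H.
rewrite divr_gt0 ?ZR_pos //.
have s0 : 0 < Num.sqrt 3 :> R by rewrite sqrtr_gt0.
move: H; rewrite -!ZR_lt -!ZR_le !ZRM -[ZR 0]/(0 : R) -[ZR 3]/(3 : R).
have [a0|a0] := leP 0 (ZR a).
  have [b0|b0] := leP 0 (ZR b).
    move=> /orP[h|h]; first by rewrite ltr_pwDl // mulr_ge0 // ltW.
    by rewrite ltr_wpDl // mulr_gt0.
  move=> H; rewrite -[X in 0 < _ + X]opprK subr_gt0 -mulNr.
  rewrite -(@ltr_pXn2r _ 2) ?nnegrE //; last by rewrite mulr_ge0 ?oppr_ge0 ?(ltW b0) ?(ltW s0).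
  by rewrite exprMn sqrrN sqr_sqrtr // !expr2 mulrC.
move=> /andP[b0 H]; rewrite -[X in 0 < X + _]opprK addrC subr_gt0.
rewrite -(@ltr_pXn2r _ 2) ?nnegrE ?oppr_ge0 ?(ltW a0) ?mulr_ge0 ?(ltW b0) ?(ltW s0) //.
by rewrite exprMn sqrrN sqr_sqrtr // !expr2 mulrC [ltRHS]mulrC.
Qed.

Lemma s3ltP x y : s3lt x y -> KR x < KR y.
Proof. by move=> /s3posP; rewrite s3subP subr_gt0. Qed.

Lemma s3eqP x y : s3eq x y -> KR x = KR y.
Proof.
case: x y => [[a b] d] [[a' b'] d'] /andP[/Z.eqb_spec h1 /Z.eqb_spec h2] /=.
have := ZR_pos d; have := ZR_pos d' => /lt0r_neq0 d0 /lt0r_neq0 d1.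
apply/eqP; rewrite eqr_div // !mulrDl ![_ * Num.sqrt 3 * _]mulrAC -!ZRM.
by rewrite h1 h2.
Qed.

Lemma s3absP x : `|KR x| <= KR (s3abs x).
Proof.
rewrite /s3abs; case: ifP => [/s3posP h|_]; first by rewrite gtr0_norm.
case: ifP => [/s3posP h|_].
  by rewrite -normrN -s3oppP gtr0_norm.
case: ifP => [h|_]; first by rewrite (s3eqP h) (s3intP 0) normr0.
rewrite s3addP s3mulP s3intP -[ZR 1]/(1 : R) -expr2 -real_normK ?num_real //.
by nra.
Qed.

Lemma s3sumP n f : KR (s3sum n f) = \sum_(i < n) KR (f i).
Proof.
rewrite -(big_mkord xpredT (fun i => KR (f i))) /index_iota subn0 /s3sum.
elim: (iota 0 n) => [|i s IH]; first by rewrite big_nil (s3intP 0).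
by rewrite big_cons -IH -s3addP.
Qed.

End Interpretation.

Arguments KR : simpl never.
Arguments s3add : simpl never.
Arguments s3mul : simpl never.
Arguments s3int : simpl never.
Arguments s3ofint : simpl never.

(** * Certified evaluation of equations and Jacobian matrices *)

Fixpoint s3eval (e : nat -> qs3) (t : pexpr) : qs3 := match t with
  | PVar k => e k
  | PC c => s3ofint c
  | PAdd a b => s3add (s3eval e a) (s3eval e b)
  | PMul a b => s3mul (s3eval e a) (s3eval e b)
  end.

(** The zero tests skip the evaluation of a cofactor whenever its partner has zero derivative, which
    is the frequent case because each equation involves few of the variables. *)
Fixpoint s3deriv (e : nat -> qs3) (j : nat) (t : pexpr) : qs3 := match t with
  | PVar k => s3int (if k == j then 1 else 0)
  | PC c => s3int 0
  | PAdd a b => s3add (s3deriv e j a) (s3deriv e j b)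
  | PMul a b =>
    let da := s3deriv e j a in let db := s3deriv e j b in
    s3add (if s3zero db then s3int 0 else s3mul (s3eval e a) db)
          (if s3zero da then s3int 0 else s3mul da (s3eval e b))
  end.

Fixpoint vars_in (s : seq nat) (t : pexpr) : bool := match t with
  | PVar k => k \in s
  | PC c => true
  | PAdd a b => vars_in s a && vars_in s b
  | PMul a b => vars_in s a && vars_in s b
  end.

Section Selection.
Variables (R : realType) (m n : nat) (Y U : seq nat).

(** Dimensions are successors because [inord] is used. A variable in neither list is sent to a
    default parameter, which is why the lemmas ask for membership in [Y ++ U]. *)
Definition sel_of (k : nat) : 'I_m.+1 + 'I_n.+1 :=
  if k \in U then inr (inord (index k U)) else inl (inord (index k Y)).

Definition row_of p (s : seq nat) (e : nat -> R) : 'rV[R]_p := \row_j e (nth 0%N s j).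

Hypotheses (sY : size Y = m.+1) (sU : size U = n.+1) (uU : uniq U).

Lemma env_row_of (e : nat -> R) k : k \in Y ++ U ->
  env sel_of (row_of _ Y e) (row_of _ U e) k = e k.
Proof.
rewrite mem_cat /env /sel_of; case: ifP => kU /=.
  by move=> _; rewrite mxE inordK ?nth_index // -sU index_mem.
by rewrite orbF => kY; rewrite mxE inordK ?nth_index // -sY index_mem.
Qed.

Lemma sel_of_eq k (i : 'I_n.+1) : (sel_of k == inr i) = (k == nth 0%N U i).
Proof.
rewrite /sel_of; case: ifP => kU; last first.
  by symmetry; apply/negbTE/eqP => kE; move: kU; rewrite kE mem_nth // sU.
rewrite (inj_eq (@inr_inj _ _)) -val_eqE /= inordK; last by rewrite -sU index_mem.
by rewrite -{2}(nth_index 0%N kU) nth_uniq ?index_mem ?sU.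
Qed.

Lemma peval_s3eval (f : nat -> R) (e : nat -> qs3) t :
  (forall k, k \in Y ++ U -> f k = KR R (e k)) -> vars_in (Y ++ U) t ->
  peval f t = KR R (s3eval e t).
Proof.
move=> fe; elim: t => [k|c|a IHa b IHb|a IHa b IHb] //=.
- exact: fe.
- by rewrite s3ofintP.
- by move=> /andP[ha hb]; rewrite s3addP IHa ?IHb.
- by move=> /andP[ha hb]; rewrite s3mulP IHa ?IHb.
Qed.

Lemma slope_s3deriv (f : nat -> R) (e : nat -> qs3) t (i : 'I_n.+1) :
  (forall k, k \in Y ++ U -> f k = KR R (e k)) -> vars_in (Y ++ U) t ->
  slope sel_of (inr i) f f t = KR R (s3deriv e (nth 0%N U i) t).
Proof.
move=> fe; elim: t => [k|c|a IHa b IHb|a IHa b IHb].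
- by move=> _; rewrite /= sel_of_eq s3intP; case: eqP.
- by move=> _; rewrite s3intP.
- by move=> /= /andP[ha hb]; rewrite s3addP IHa ?IHb.
- move=> /= /andP[ha hb]; rewrite s3addP IHa ?IHb //; congr (_ + _).
    case: ifP => [/s3zeroP|_]; last by rewrite s3mulP (peval_s3eval fe ha).
    by move=> ->; rewrite mulr0 s3intP.
  case: ifP => [/s3zeroP|_]; last by rewrite s3mulP (peval_s3eval fe hb).
  by move=> ->; rewrite mul0r s3intP.
Qed.

Variables (G : seq pexpr) (e : nat -> qs3) (A : seq (seq qs3)).

Definition lookup2 (M : seq (seq qs3)) i j := nth (s3int 0) (nth [::] M i) j.

Definition scale : Z := 10000000.
(** 17320508 is the integer part of [scale] times sqrt 3. The accuracy of the rounding is tested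
    entry by entry by [round_ok]. *)
Definition s3round (x : qs3) : Z :=
  let: (a, b, d) := x in Z.div (Z.add (Z.mul a scale) (Z.mul b 17320508)) (Zpos d).
Definition round_ok (x : qs3) : bool :=
  s3lt (s3abs (s3sub (s3mul (s3int scale) x) (s3int (s3round x)))) (s3int 2).

(* A is an approximate inverse of the Jacobian matrix S of G. For efficiency the
   products use S', which is scale * S up to an error of 2. *)
Definition ift_check : bool :=
  let S := [seq [seq s3deriv e u t | t <- G] | u <- U] in
  let S' := [seq [seq s3int (s3round x) | x <- r] | r <- S] in
  [&& size Y == m.+1, size U == n.+1, uniq U, size G == n.+1,
      all (vars_in (Y ++ U)) G, all (fun t => s3eq (s3eval e t) (s3int 0)) G,
      all (all round_ok) S &
      all (fun k =>
        let err := s3mul (s3int 2) (s3sum n.+1 (fun j => s3abs (lookup2 A j k))) in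
        s3lt (s3sum n.+1 (fun i => s3add err (s3abs (s3sub
               (s3int (if i == k then scale else 0))
               (s3sum n.+1 (fun j => s3mul (lookup2 S' i j) (lookup2 A j k)))))))
           (s3mul (s3int scale) s3half)) (iota 0 n.+1)].

End Selection.

Lemma implicit_function_num (R : realType) m n (Y U : seq nat) (G : seq pexpr)
    (e : nat -> qs3) (A : seq (seq qs3)) :
  ift_check m n Y U G e A ->
  let f k : R := KR R (e k) in
  let sel := sel_of m n Y U in
  forall N : set 'rV[R]_n.+1, nbhs (row_of _ U f) N ->
  exists (Y' : set 'rV[R]_m.+1) (X : set 'rV[R]_n.+1) (g : 'rV[R]_m.+1 -> 'rV[R]_n.+1),
    [/\ open Y' /\ Y' (row_of _ Y f), [/\ open X, X (row_of _ U f) & X `<=` N],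
        forall y, Y' y -> X (g y),
        forall y x, Y' y -> X x ->
          ((forall i, (i < size G)%N -> peval (env sel y x) (nth (PC 0) G i) = 0)
             <-> x = g y)
      & smooth_on Y' g].
Proof.
move=> /and5P[/eqP sY /eqP sU uU /eqP sG /and4P[/all_nthP vG /all_nthP zG /all_nthP rS /allP HA]] f sel N hN.
have fE k : k \in Y ++ U -> env sel (row_of _ Y f) (row_of _ U f) k = KR R (e k).
  by move=> hk; rewrite env_row_of.
pose Gk (k : 'I_n.+1) := nth (PC 0) G k.
have vGk k : vars_in (Y ++ U) (Gk k) by apply: vG; rewrite sG.
have zGk k : s3eq (s3eval e (Gk k)) (s3int 0) by apply: (zG (PC 0)); rewrite sG.
have [k||Y' [X [g [hY hX gX gG sg]]]] := @implicit_function R _ _ sel Gk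
  (row_of _ Y f) (row_of _ U f) (\matrix_(i, j) KR R (lookup2 A i j)) _ _ N hN.
- by rewrite (peval_s3eval fE (vGk k)) (s3eqP _ (zGk k)) s3intP.
- move=> k; have := HA k; rewrite mem_iota add0n ltn_ord => /(_ isT) /s3ltP - /(_ R).
  have -> : KR R (s3mul (s3int scale) s3half) = ZR R scale * (1 / 2).
    by rewrite s3mulP s3intP /KR /s3half mul0r addr0.
  have sc0 : 0 < ZR R scale by exact: ZR_pos.
  rewrite -(ltr_pM2l sc0 (\sum_i _)); apply: le_lt_trans.
  rewrite s3sumP mulr_sumr; apply: ler_sum => i _.
  rewrite s3addP s3mulP s3intP s3sumP.
  pose S i j := slope sel (inr i) (env sel (row_of _ Y f) (row_of _ U f))
    (env sel (row_of _ Y f) (row_of _ U f)) (Gk j).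
  pose S' i (j : 'I_n.+1) := ZR R (s3round (s3deriv e (nth 0%N U i) (Gk j))).
  have SE i' j : S i' j = KR R (s3deriv e (nth 0%N U i') (Gk j)).
    by rewrite -(@slope_s3deriv R m n Y U sU uU _ _ _ _ fE (vGk j)).
  have rnd i' j : `|ZR R scale * S i' j - S' i' j| <= 2.
    have := rS [::] i'; rewrite size_map sU => /(_ (ltn_ord i')).
    rewrite (nth_map 0%N) ?sU // => /(all_nthP (s3int 0)) /(_ j).
    rewrite size_map sG (nth_map (PC 0)) ?sG // => /(_ (ltn_ord j)) /s3ltP - /(_ R) h.
    have <- : KR R (s3int 2) = 2 by rewrite s3intP.
    apply: ltW; apply: le_lt_trans h; apply: le_trans (s3absP _ _).
    by rewrite s3subP s3mulP !s3intP SE.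
  rewrite -[X in X * `|_|](gtr0_norm sc0) -normrM.
  (* The error splits into the contribution of rounding the Jacobian matrix, at most 2 per entry,
     and the residual computed with the rounded matrix. *)
  have -> : ZR R scale * ((1%:M : 'M[R]_n.+1) - slope_mx sel Gk
      ((row_of _ Y f, row_of _ U f), (row_of _ Y f, row_of _ U f)) *m
      \matrix_(i, j) KR R (lookup2 A i j)) i k =
    - \sum_j (ZR R scale * S i j - S' i j) * KR R (lookup2 A j k) +
    (ZR R scale * (i == k)%:R - \sum_j S' i j * KR R (lookup2 A j k)).
    have -> : \sum_j (ZR R scale * S i j - S' i j) * KR R (lookup2 A j k) =
        ZR R scale * \sum_j S i j * KR R (lookup2 A j k) - \sum_j S' i j * KR R (lookup2 A j k).
      by rewrite mulr_sumr -sumrB; apply: eq_bigr => j _; rewrite mulrBl mulrA.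
    rewrite !mxE mulrBr opprB [RHS]addrC addrA subrK; congr (_ - _ * _).
    by apply: eq_bigr => j _; rewrite !mxE.
  apply: le_trans (ler_normD _ _) _; apply: lerD.
    rewrite normrN mulr_sumr; apply: le_trans (ler_norm_sum _ _ _) _; apply: ler_sum => j _.
    by rewrite normrM; apply: ler_pM; rewrite ?normr_ge0 ?s3absP ?rnd.
  apply: le_trans (s3absP _ _); rewrite s3subP s3intP s3sumP.
  rewrite le_eqVlt; apply/orP; left; apply/eqP; congr `|_ - _|.
    by rewrite -val_eqE /=; case: eqP => _; rewrite ?mulr1 ?mulr0.
  apply: eq_bigr => j _; rewrite s3mulP; congr (_ * _).
  rewrite /lookup2 (nth_map [::]) ?size_map ?sU // (nth_map 0%N) ?sU //.
  rewrite (nth_map (s3int 0)) ?size_map ?sG // (nth_map (PC 0)) ?sG //.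
  by rewrite s3intP.
exists Y', X, g; split => // y x hy hx; rewrite -gG //; split.
  by move=> H k; apply: H; rewrite sG.
by move=> H i; rewrite sG => hi; exact: (H (Ordinal hi)).
Qed.

Lemma ift_check_zero (R : realType) m n Y U G e A : ift_check m n Y U G e A ->
  all (fun t => peval (fun k => KR R (e k)) t == 0) G.
Proof.
move=> /and5P[_ _ _ _ /and4P[/all_nthP vG /all_nthP zG _ _]].
apply/(all_nthP (PC 0)) => i hi.
rewrite (@peval_s3eval R Y U _ e) ?vG //.
by rewrite (s3eqP _ (zG (PC 0) i hi)) s3intP.
Qed.

Local Open Scope complex_scope.

(** * Plane geometry *)

Section PathSum.
Variables (V : zmodType) (T : Type) (f : T -> T -> V).

Fixpoint path_sum (x : T) (s : seq T) : V :=
  if s is y :: s' then f x y + path_sum y s' else 0.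

Lemma path_sum_cat x s1 s2 :
  path_sum x (s1 ++ s2) = path_sum x s1 + path_sum (last x s1) s2.
Proof. by elim: s1 x => [|y s1 IH] x /=; rewrite ?add0r // IH addrA. Qed.

Lemma path_sum_rcons x s y : path_sum x (rcons s y) = path_sum x s + f (last x s) y.
Proof. by rewrite -cats1 path_sum_cat /= addr0. Qed.

Lemma last_rev_belast (x : T) s : last (last x s) (rev (belast x s)) = x.
Proof. by elim: s x => [|y s IH] x //=; rewrite rev_cons last_rcons. Qed.

Lemma path_sum_rev (e : rel T) x s : (forall a b, e a b -> f b a = - f a b) ->
  path e x s -> path_sum (last x s) (rev (belast x s)) = - path_sum x s.
Proof.
move=> anti; elim: s x => [|y s IH] x /=; first by rewrite oppr0.
move=> /andP[exy es]; rewrite rev_cons path_sum_rcons IH // last_rev_belast.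
by rewrite anti // opprD addrC.
Qed.

Lemma path_sum_zip x s z :
  \sum_(p <- zip (x :: s) (rcons s z)) f p.1 p.2 = path_sum x (rcons s z).
Proof.
elim: s x => [|y s IH] x /=; first by rewrite big_cons big_nil.
by rewrite big_cons IH.
Qed.

End PathSum.

Section Plane.
Variable R : realType.
Local Notation C := R[i].
Implicit Types (z w : C).

Definition nrm2 z : R := complex.Re z ^+ 2 + complex.Im z ^+ 2.
Definition cross z w : R :=
  complex.Re z * complex.Im w - complex.Im z * complex.Re w.
Definition cis t : C := cos t +i* sin t.

Lemma nrm2_ge0 z : 0 <= nrm2 z.
Proof. by rewrite /nrm2 addr_ge0 // sqr_ge0. Qed.

Lemma nrm2M z w : nrm2 (z * w) = nrm2 z * nrm2 w.
Proof. by case: z w => [a b] [c d]; rewrite /nrm2 /=; ring. Qed.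

Lemma nrm2N z : nrm2 (- z) = nrm2 z.
Proof. by case: z => a b; rewrite /nrm2 /= !sqrrN. Qed.

Lemma nrm2_eq0 z : (nrm2 z == 0) = (z == 0).
Proof.
by case: z => a b; rewrite /nrm2 /= paddr_eq0 ?sqr_ge0 // !sqrf_eq0 eq_complex.
Qed.

Lemma nrm2_gt0 z : (0 < nrm2 z) = (z != 0).
Proof. by rewrite lt_def nrm2_ge0 andbT nrm2_eq0. Qed.

Lemma nrm2_cis (t : R) : nrm2 (cis t) = 1.
Proof. by rewrite /nrm2 /= cos2Dsin2. Qed.

Lemma normc_nrm2 z : `|z| = (Num.sqrt (nrm2 z))%:C.
Proof. by case: z => a b; rewrite normc_def. Qed.

Lemma cross_conj z w : complex.Im (z^* * w) = cross z w.
Proof. by case: z w => [a b] [c d]; rewrite /cross /=; ring. Qed.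

Lemma crossMl z w (u : C) : cross (z * w) (z * u) = nrm2 z * cross w u.
Proof. by case: z w u => [a b] [c d] [e f]; rewrite /cross /nrm2 /=; ring. Qed.

Lemma cross_neq0 z w : 0 < cross z w -> z != 0 /\ w != 0.
Proof.
move=> h; split; apply/eqP => E; move: h; rewrite E /cross /=.
  by rewrite !mul0r subr0 ltxx.
by rewrite !mulr0 subr0 ltxx.
Qed.

Lemma cisD (a b : R) : cis (a + b) = cis a * cis b.
Proof.
apply/eqP; rewrite eq_complex /= cosD sinD eqxx /=.
by apply/eqP; ring.
Qed.

Lemma cis_sum (I : Type) (r : seq I) (P : pred I) (f : I -> R) :
  cis (\sum_(i <- r | P i) f i) = \prod_(i <- r | P i) cis (f i).
Proof.
apply: (big_morph cis cisD); apply/eqP.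
by rewrite eq_complex /= cos0 sin0 !eqxx.
Qed.

Lemma cis_2pi : cis (2 * pi) = 1.
Proof.
apply/eqP; rewrite eq_complex /= mulr_natl cos2pi sin2pi !eqxx //.
Qed.

(** The range fits a sum of three angles from the open interval (0, pi): it contains no multiple of
    2 pi other than 2 pi itself. *)
Lemma cis_eq1 (t : R) : 0 < t < 3 * pi -> cis t = 1 -> t = 2 * pi.
Proof.
move=> /andP[t0 t3] /eqP; rewrite eq_complex /= => /andP[/eqP ct _].
have p0 := pi_gt0 R.
have [h|h|//] := ltgtP t (2 * pi).
  have [h2|h2] := leP t pi.
    have : t = 0.
      by apply: (@cos_inj R); rewrite ?in_itv /= ?ct ?cos0 //; lra.
    by lra.
  have : 2 * pi - t = 0.
    apply: (@cos_inj R); rewrite ?in_itv /= ?cos0; [lra|lra|].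
    by rewrite cosB mulr_natl cos2pi sin2pi mul1r mul0r addr0 ct.
  by lra.
have : t - 2 * pi = 0.
  apply: (@cos_inj R); rewrite ?in_itv /= ?cos0; [lra|lra|].
  by rewrite cosB mulr_natl cos2pi sin2pi mulr1 mulr0 addr0 ct.
by lra.
Qed.

(* w is obtained from z by a rotation of angle t and a positive scaling. *)
Definition rot z w (t : R) : Prop :=
  0 < t < pi /\ exists2 r, 0 < r & w = r%:C * cis t * z.

(** The sum of two angles below pi could exceed pi; then its sine would be nonpositive, against the
    sign of the cross product of z and x. *)
Lemma rotD z w (x : C) (a b : R) : z != 0 -> rot z w a -> rot w x b -> 0 < cross z x ->
  rot z x (a + b).
Proof.
move=> z0 [/andP[a0 ap] [r r0 wE]] [/andP[b0 bp] [r' r'0 xE]] h.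
have xE' : x = (r' * r)%:C * cis (a + b) * z.
  by rewrite xE wE cisD rmorphM /=; ring.
split; last by exists (r' * r) => //; rewrite mulr_gt0.
rewrite addr_gt0 //= ltNge; apply/negP => hp.
have : sin (a + b) <= 0.
  rewrite -[a + b](subrK pi) sinDpi oppr_le0 sin_ge0_pi //.
  by lra.
move: h; rewrite xE' mulrC -{1}(mulr1 z) crossMl.
rewrite pmulr_rgt0 ?nrm2_gt0 // /cross /=.
have -> : 1 * (r' * r * sin (a + b) + 0 * cos (a + b)) - 0 * (r' * r * cos (a + b) - 0 * sin (a + b)) = (r' * r) * sin (a + b) by ring.
by rewrite pmulr_rgt0 ?mulr_gt0 // => h1 h2; lra.
Qed.

Lemma rot3 z w (x : C) (a b c : R) : z != 0 -> rot z w a -> rot w x b -> rot x z c ->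
  a + b + c = 2 * pi.
Proof.
move=> z0 [/andP[a0 ap] [r r0 wE]] [/andP[b0 bp] [r' r'0 xE]] [/andP[c0 cp] [r'' r''0 zE]].
have E : 1 = (r'' * r' * r)%:C * cis (a + b + c) :> C.
  apply: (mulfI z0); rewrite mulr1 {1}zE xE wE !cisD !rmorphM /=; ring.
have E2 : (r'' * r' * r) ^+ 2 = 1.
  have := congr1 nrm2 E; rewrite nrm2M nrm2_cis mulr1 /nrm2 /=.
  by rewrite expr0n /= expr1n !addr0.
have rr : r'' * r' * r = 1.
  have h : 0 < r'' * r' * r by rewrite !mulr_gt0.
  by apply/eqP; rewrite -(@eqrXn2 _ 2) // ?ltW // E2 expr1n.
apply: cis_eq1; first by lra.
by rewrite E rr mul1r.
Qed.

Section Fan.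
Variables (T : eqType) (w : T -> C) (ang : T -> T -> R).

Definition rots : T -> T -> Prop := fun x y => rot (w x) (w y) (ang x y).

Fixpoint rpath (x : T) (s : seq T) : Prop :=
  if s is y :: s' then rots x y /\ rpath y s' else True.

Lemma rpath_cat x s1 s2 : rpath x (s1 ++ s2) <-> rpath x s1 /\ rpath (last x s1) s2.
Proof.
elim: s1 x => [|y s1 IH] x /=; first by split=> // -[].
by rewrite IH; tauto.
Qed.

Lemma rot_fanl x0 x s t : w x0 != 0 -> rot (w x0) (w x) t -> rpath x s ->
  {in s, forall y, 0 < cross (w x0) (w y)} ->
  rot (w x0) (w (last x s)) (t + path_sum ang x s).
Proof.
move=> w0; elim: s x t => [|y s IH] x t rx /=; first by rewrite addr0.
move=> [rxy rs] cs; rewrite addrA; apply: IH => //.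
  by apply: rotD rx rxy _ => //; apply: cs; rewrite mem_head.
by move=> z zs; apply: cs; rewrite in_cons zs orbT.
Qed.

Lemma rot_fanr x0 x s t : rot (w (last x s)) (w x0) t -> rpath x s ->
  {in x :: s, forall y, 0 < cross (w y) (w x0)} ->
  rot (w x) (w x0) (path_sum ang x s + t).
Proof.
elim: s x => [|y s IH] x /= rt; first by rewrite add0r.
move=> [rxy rs] cs; rewrite -addrA.
have cx : 0 < cross (w x) (w x0) by apply: cs; rewrite mem_head.
apply: (rotD (cross_neq0 cx).1 rxy) => //; apply: IH => //.
by move=> z zs; apply: cs; rewrite in_cons zs orbT.
Qed.

(** The cycle is cut into three rotations: from x0 to the last vector of the first half, from there
    to the first vector of the second half, and back to x0. Each is less than a half-turn, so [rot3]
    applies and the angles add up to one full turn. *)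
Lemma fan_sum x0 a A b B : rpath x0 (a :: A ++ b :: B ++ [:: x0]) ->
  {in a :: A, forall y, 0 < cross (w x0) (w y)} ->
  {in b :: B, forall y, 0 < cross (w y) (w x0)} ->
  path_sum ang x0 (a :: A ++ b :: B ++ [:: x0]) = 2 * pi.
Proof.
rewrite -cat_cons => /rpath_cat[[r0a rA] /= [rab /rpath_cat[rB [rb0 _]]]] cA cB.
have ca : 0 < cross (w x0) (w a) by apply: cA; rewrite mem_head.
have w0 := (cross_neq0 ca).1.
have h1 : rot (w x0) (w (last a A)) (ang x0 a + path_sum ang a A).
  apply: rot_fanl => // z zs; apply: cA; by rewrite in_cons zs orbT.
have h2 : rot (w b) (w x0) (path_sum ang b B + ang (last b B) x0) by exact: rot_fanr.
have := rot3 w0 h1 rab h2 => <-.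
by rewrite path_sum_cat /= path_sum_cat /= addr0 !addrA.
Qed.

End Fan.

Section Turn.
Implicit Types (p q : 'rV[R]_3).

Lemma dotNN p : dot (- p) (- p) = dot p p.
Proof. by apply: eq_bigr => i _; rewrite !mxE mulrNN. Qed.

Lemma dotBB p q : dot (q - p) (q - p) = dot p p + dot q q - 2 * dot p q.
Proof.
rewrite /dot mulr_sumr -!big_split -sumrB /=; apply: eq_bigr => i _.
by rewrite !mxE; ring.
Qed.

Lemma dot_ge0 p : 0 <= dot p p.
Proof. by apply: sumr_ge0 => i _; rewrite -expr2 sqr_ge0. Qed.

Definition gram p q : R := dot p p * dot q q - dot p q ^+ 2.

(** The apex q of the triangle 0, p, q, drawn counterclockwise in the plane with p placed at 1. *)
Definition turn p q : C := (dot p q / dot p p) +i* (Num.sqrt (gram p q) / dot p p).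

Lemma gram_gt0_dot p q : 0 < gram p q -> 0 < dot p p /\ 0 < dot q q.
Proof.
move=> h; have p0 := dot_ge0 p; have q0 := dot_ge0 q.
have : 0 < dot p p * dot q q by move: h; rewrite /gram; nra.
move=> h2; split; rewrite lt_def ?p0 ?q0 andbT; apply/eqP => E; move: h2;
by rewrite E ?mul0r ?mulr0 ltxx.
Qed.

(** Side-side-side congruence up to the scale L: the three lengths give the scalar product, hence
    the square of the cross product, and the orientation gives its sign. *)
Lemma turn_unique z w p q L : 0 < L -> nrm2 z = L * dot p p -> nrm2 w = L * dot q q ->
  nrm2 (w - z) = L * dot (q - p) (q - p) -> 0 < cross z w ->
  w = z * turn p q /\ 0 < gram p q.
Proof.
move=> L0 hz hw hwz cr.
have [z0 _] := cross_neq0 cr.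
have cd : complex.Re z * complex.Re w + complex.Im z * complex.Im w = L * dot p q.
  move: hz hw hwz; rewrite dotBB; case: (z) (w) => [a b] [c d] /=.
  by rewrite /nrm2 /= => h1 h2 h3; lra.
have p0 : 0 < dot p p.
  by have := nrm2_gt0 z; rewrite z0 hz pmulr_rgt0.
have cr2 : cross z w ^+ 2 = L ^+ 2 * gram p q.
  have -> : L ^+ 2 * gram p q = (L * dot p p) * (L * dot q q) - (L * dot p q) ^+ 2.
    by rewrite /gram; ring.
  by rewrite -hz -hw -cd /cross /nrm2; ring.
have g0 : 0 < gram p q.
  have : 0 < cross z w ^+ 2 by rewrite exprn_gt0.
  by rewrite cr2 pmulr_rgt0 // exprn_gt0.
have crE : cross z w = L * Num.sqrt (gram p q).
  apply/eqP; rewrite -(@eqrXn2 _ 2) ?(ltW cr) ?mulr_ge0 ?(ltW L0) ?sqrtr_ge0 //.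
  by rewrite cr2 exprMn sqr_sqrtr // ltW.
split => //.
have n0 : L * dot p p != 0 by rewrite gt_eqF // mulr_gt0.
have E1 : dot p q / dot p p = (L * dot p q) / (L * dot p p).
  by rewrite -mulf_div divff ?mul1r // gt_eqF.
have E2 : Num.sqrt (gram p q) / dot p p = (L * Num.sqrt (gram p q)) / (L * dot p p).
  by rewrite -mulf_div divff ?mul1r // gt_eqF.
rewrite /turn E1 E2 -cd -crE -hz.
have zz : nrm2 z != 0 by rewrite hz.
apply/eqP; rewrite eq_complex; move: zz; rewrite /cross /nrm2.
case: (z) (w) => [a b] [c d] /= zz.
by apply/andP; split; apply/eqP; field.
Qed.

Lemma turn_dev z p q L : 0 < gram p q -> 0 < L -> nrm2 z = L * dot p p ->
  let w := z * turn p q in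
  [/\ nrm2 w = L * dot q q, nrm2 (w - z) = L * dot (q - p) (q - p) & 0 < cross z w].
Proof.
move=> g0 L0 hz w; have [p0 q0] := gram_gt0_dot g0.
have nt : nrm2 (turn p q) = dot q q / dot p p.
  rewrite /nrm2 /turn /= !exprMn sqr_sqrtr ?ltW // -mulrDl /gram.
  by field; rewrite gt_eqF.
have nw : nrm2 w = L * dot q q.
  by rewrite /w nrm2M hz nt; field; rewrite gt_eqF.
split => //.
  have -> : w - z = z * (turn p q - 1) by rewrite /w; ring.
  rewrite nrm2M hz dotBB.
  have -> : nrm2 (turn p q - 1) = nrm2 (turn p q) + 1 - 2 * (dot p q / dot p p).
    by rewrite /nrm2 /turn /=; ring.
  by rewrite nt; field; rewrite gt_eqF.
rewrite /w -{1}(mulr1 z) crossMl hz mulr_gt0 ?mulr_gt0 //.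
by rewrite /cross /turn /= mul1r mul0r subr0 divr_gt0 // sqrtr_gt0.
Qed.

(** This connects the algebraic [turn] with the arccosine in the cone angles. A positive [gram] is
    the strict Cauchy-Schwarz inequality, which keeps the angle away from 0 and pi. *)
Lemma turn_cis p q : 0 < gram p q ->
  turn p q = (enorm q / enorm p)%:C * cis (angle p q) /\ 0 < angle p q < pi.
Proof.
move=> g0; have [p0 q0] := gram_gt0_dot g0.
have ep : 0 < enorm p by rewrite sqrtr_gt0.
have eq : 0 < enorm q by rewrite sqrtr_gt0.
have ep2 : enorm p ^+ 2 = dot p p by rewrite sqr_sqrtr // ltW.
have eq2 : enorm q ^+ 2 = dot q q by rewrite sqr_sqrtr // ltW.
set c := dot p q / (enorm p * enorm q).
have c2 : 1 - c ^+ 2 = gram p q / (enorm p * enorm q) ^+ 2.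
  rewrite /gram /c -ep2 -eq2; field; by rewrite !gt_eqF.
have cl : c ^+ 2 < 1.
  by rewrite -subr_gt0 c2 divr_gt0 // exprn_gt0 // mulr_gt0.
have c1 : -1 < c < 1 by apply/andP; split; nra.
have c1' : -1 <= c <= 1 by case/andP: c1 => /ltW -> /ltW ->.
have sE : Num.sqrt (1 - c ^+ 2) = Num.sqrt (gram p q) / (enorm p * enorm q).
  rewrite c2 sqrtrM ?ltW // sqrtrV ?exprn_ge0 ?mulr_ge0 ?ltW // sqrtr_sqr ger0_norm //.
  by rewrite mulr_ge0 // ltW.
have acE : angle p q = acos c by [].
split; last first.
  rewrite acE acos_gt0 ?acos_ltpi //.
    by case/andP: c1 => -> /ltW ->.
  by case/andP: c1 => /ltW -> ->.
apply/eqP; rewrite eq_complex acE /= acosK ?in_itv //= sin_acos // sE /c -ep2.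
by apply/andP; split; apply/eqP; field; rewrite !gt_eqF.
Qed.

Lemma rot_turn z w p q L : 0 < L -> nrm2 z = L * dot p p -> nrm2 w = L * dot q q ->
  nrm2 (w - z) = L * dot (q - p) (q - p) -> 0 < cross z w ->
  rot z w (angle p q).
Proof.
move=> L0 hz hw hwz cr; have [wE g0] := turn_unique L0 hz hw hwz cr.
have [tE ab] := turn_cis g0; split => //.
have [p0 q0] := gram_gt0_dot g0.
exists (enorm q / enorm p); first by rewrite divr_gt0 // sqrtr_gt0.
by rewrite wE tE mulrC.
Qed.

End Turn.

(* Cayley transform: 1 - r = i b (1 + r) with b real, and the relation between
   the vectors (1 + r1) V1 and (1 + r2) V2, which are not parallel, gives b = 0. *)
Lemma holonomy_trivial (r1 r2 V1 V2 : C) : nrm2 r1 = 1 -> nrm2 r2 = 1 ->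
  (1 - r1) * V1 + (1 - r2) * V2 = 0 ->
  0 < cross ((1 + r1) * V1) ((1 + r2) * V2) -> r1 = 1 /\ r2 = 1.
Proof.
move=> n1 n2 E cr; have [z1 z2] := cross_neq0 cr.
have u1 : 1 + r1 != 0 by apply/eqP => e; move: z1; rewrite e mul0r eqxx.
have u2 : 1 + r2 != 0 by apply/eqP => e; move: z2; rewrite e mul0r eqxx.
have cayley (r : C) : nrm2 r = 1 -> 1 + r != 0 ->
    exists b : R, 1 - r = (0 +i* b) * (1 + r) /\ (b = 0 -> r = 1).
  move=> n u; exists (- 2 * complex.Im r / nrm2 (1 + r)).
  have : nrm2 (1 + r) != 0 by rewrite nrm2_eq0.
  have E1 : 1 - r = (0 +i* (- 2 * complex.Im r / nrm2 (1 + r))) * (1 + r).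
    have : nrm2 (1 + r) != 0 by rewrite nrm2_eq0.
    move: n; case: (r) => a b; rewrite /nrm2 /=; set N := _ + (0 + b) ^+ 2 => n h.
    have NE : N = 2 + 2 * a.
      by have -> : N = (a ^+ 2 + b ^+ 2) + 1 + 2 * a; [rewrite /N; ring | rewrite n; ring].
    have : (- 2 * b / N) * N = - 2 * b by rewrite divfK.
    move: (_ / N) => k kN.
    apply/eqP; rewrite eq_complex /=; apply/andP; split; apply/eqP.
      apply: (mulIf h).
      have -> : (0 * (1 + a) - k * (0 + b)) * N = - (k * N) * b by ring.
      rewrite kN NE (_ : - (- 2 * b) * b = 2 * b ^+ 2); last by ring.
      have -> : b ^+ 2 = 1 - a ^+ 2 by rewrite -n; ring.
      by ring.
    apply: (mulIf h).
    have -> : (0 * (0 + b) + k * (1 + a)) * N = (k * N) * (1 + a) by ring.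
    by rewrite kN NE; ring.
  move=> h; split => // b0; move: E1; rewrite b0 => E1.
  by apply/esym/subr0_eq; rewrite E1 mul0r.
have [b1 [e1 h1]] := cayley _ n1 u1; have [b2 [e2 h2]] := cayley _ n2 u2.
move: E; rewrite e1 e2 -!mulrA => E.
have b20 : b2 = 0.
  have : b2 * cross ((1 + r1) * V1) ((1 + r2) * V2) = 0.
    move: E; move: (_ * V1) (_ * V2) => [a b] [c d].
    rewrite /cross /= => /eqP; rewrite eq_complex /= => /andP[/eqP h /eqP k].
    by have := congr2 (fun u v => - a * u - b * v) h k; rewrite /= !mulr0 subr0 => <-; ring.
  by move=> /eqP; rewrite mulf_eq0 (gt_eqF cr) orbF => /eqP.
split; [apply: h1 | exact: h2].
move: E; rewrite b20 => /eqP; rewrite [X in _ + X](_ : _ = 0); last exact: mul0r.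
rewrite addr0 mulf_eq0 (negbTE z1) orbF eq_complex /= => /andP[_ /eqP].
by [].
Qed.

End Plane.

(** * Flat forms on the triangulations *)

Definition o0 : 'I_8 := @Ordinal 8 0 isT.
Definition o1 : 'I_8 := @Ordinal 8 1 isT.
Definition o2 : 'I_8 := @Ordinal 8 2 isT.
Definition o3 : 'I_8 := @Ordinal 8 3 isT.
Definition o4 : 'I_8 := @Ordinal 8 4 isT.
Definition o5 : 'I_8 := @Ordinal 8 5 isT.
Definition o6 : 'I_8 := @Ordinal 8 6 isT.
Definition o7 : 'I_8 := @Ordinal 8 7 isT.
(* The entry (x, A, B) for v says that x :: A ++ B is the link of v and that, seen
   from v, A (resp. B) lies less than a half-turn after (resp. before) x. *)
Definition fan_data (s : torus_case) : seq ('I_8 * seq 'I_8 * seq 'I_8) :=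
  match s with
  | Square => [:: (o2, [:: o3; o1], [:: o6; o5; o7]);
     (o3, [:: o4; o2], [:: o7; o6; o0]);
     (o5, [:: o3; o0], [:: o7; o1; o4]);
     (o5, [:: o6; o4], [:: o1; o0; o2]);
     (o3, [:: o6; o7; o5], [:: o2; o1]);
     (o6, [:: o3; o2; o4], [:: o7; o0]);
     (o3, [:: o5; o0], [:: o1; o7; o4]);
     (o5, [:: o4; o6], [:: o1; o2; o0])]
  | Hexagonal => [:: (o1, [:: o2], [:: o4; o3]);
     (o2, [:: o0; o3; o6], [:: o7; o4; o5]);
     (o0, [:: o1; o5], [:: o7; o6; o4]);
     (o1, [:: o0; o4; o7], [:: o5; o6]);
     (o0, [:: o2; o6; o5], [:: o1; o7; o3]);
     (o2, [:: o1; o4; o6], [:: o3; o7]);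
     (o1, [:: o3; o5; o4], [:: o2; o7]);
     (o4, [:: o1], [:: o6; o2; o5; o3])]
  end.

(** Paths of a spanning tree rooted at 0 whose edges have zero winding, so that integrating the
    one-form along them gives the positions P_v without any multiple of the periods. *)
Definition pathto_data (s : torus_case) : seq (seq 'I_8) :=
  match s with
  | Square => [:: [::]; [:: o1]; [:: o2]; [:: o3]; [:: o1; o4]; [:: o5]; [:: o6]; [:: o7]]
  | Hexagonal => [:: [::]; [:: o1]; [:: o2]; [:: o3]; [:: o4]; [:: o1; o5]; [:: o1; o6];
     [:: o1; o7]]
  end.

Definition dev_root (s : torus_case) : 'I_8 * 'I_8 * 'I_8 :=
  match s with
  | Square => (o4, o2, o1)
  | Hexagonal => (o1, o4, o5)
  end.

Definition dev_order (s : torus_case) : seq ('I_8 * 'I_8 * 'I_8) :=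
  match s with
  | Square => [:: (o1, o2, o7); (o4, o1, o3); (o7, o2, o0); (o1, o7, o6); (o3, o1, o0);
     (o7, o0, o5); (o6, o7, o4); (o1, o6, o0); (o3, o0, o2); (o7, o5, o4); (o6, o4, o3);
     (o0, o6, o5); (o4, o5, o2); (o6, o3, o5); (o5, o3, o2)]
  | Hexagonal => [:: (o5, o4, o6); (o6, o4, o2); (o2, o4, o0); (o6, o2, o7); (o2, o0, o1);
     (o7, o2, o5); (o6, o7, o1); (o2, o1, o5); (o7, o5, o3); (o1, o7, o4); (o3, o5, o6);
     (o7, o3, o4); (o3, o6, o1); (o4, o3, o0); (o3, o1, o0)]
  end.

(** Outside the fifteen tree edges of [dev_order] there remain nine edges: the six sides of the two
    cuts and these three dangling ones, listed as (v, u) in an order such that, when its turn comes,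
    vu is the only edge at v not yet treated. *)
Definition leaf_edges (s : torus_case) : seq ('I_8 * 'I_8) :=
  match s with
  | Square => [:: (o1, o0); (o6, o5); (o7, o4)]
  | Hexagonal => [:: (o2, o5); (o3, o0); (o7, o4)]
  end.

(** The cuts are the marking loops, written as cyclic triples starting at the vertex common to both
    loops. Four cut edges meet at that vertex, so only the relations at the other two vertices are
    exploited. *)
Definition cut1 (s : torus_case) : 'I_8 * 'I_8 * 'I_8 :=
  match s with
  | Square => (o2, o3, o4)
  | Hexagonal => (o1, o4, o0)
  end.

Definition cut2 (s : torus_case) : 'I_8 * 'I_8 * 'I_8 :=
  match s with
  | Square => (o2, o0, o5)
  | Hexagonal => (o1, o5, o6)
  end.

(* For (a, b, c) the values of a one-form at ab and bc determine that at ca. *)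
Definition closure_steps (s : torus_case) : seq ('I_8 * 'I_8 * 'I_8) :=
  match s with
  | Square => [:: (o3, o0, o2); (o1, o0, o3); (o5, o0, o6); (o7, o0, o5); (o6, o0, o1);
     (o2, o0, o7); (o2, o0, o5); (o3, o2, o5); (o4, o1, o3); (o2, o3, o4); (o3, o5, o6);
     (o4, o3, o6); (o5, o2, o4); (o7, o5, o4); (o7, o4, o6); (o7, o6, o1); (o1, o4, o2)]
  | Hexagonal => [:: (o2, o0, o1); (o1, o0, o3); (o4, o0, o2); (o3, o0, o4); (o2, o1, o5);
     (o6, o1, o3); (o7, o1, o6); (o4, o0, o1); (o6, o1, o5); (o5, o1, o4); (o4, o1, o7);
     (o3, o4, o7); (o5, o6, o3); (o5, o3, o7); (o6, o5, o4); (o6, o4, o2); (o2, o5, o7)]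
  end.

Definition winding_data (s : torus_case) : seq ('I_8 * 'I_8 * (int * int)) :=
  match s with
  | Square => [:: (o1, o2, (1, 0)); (o1, o7, (1, 0)); (o2, o4, (-1, 0)); (o2, o5, (0, -1));
     (o3, o5, (0, -1)); (o3, o6, (0, -1)); (o4, o5, (1, -1)); (o4, o6, (0, -1));
     (o4, o7, (1, -1)); (o6, o7, (1, 0))]%Z
  | Hexagonal => [:: (o1, o4, (1, 0)); (o2, o6, (-1, 1)); (o2, o7, (-1, 1)); (o3, o5, (0, -1));
     (o3, o7, (-1, 0)); (o4, o5, (-1, 0)); (o4, o6, (-1, 1)); (o4, o7, (-1, 0));
     (o5, o6, (0, 1)); (o5, o7, (-1, 1))]%Z
  end.

Definition vertices : seq 'I_8 := [:: o0; o1; o2; o3; o4; o5; o6; o7].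
Definition edges s : seq ('I_8 * 'I_8) :=
  [seq e : 'I_8 * 'I_8 <- [seq (a, b) | a <- vertices, b <- vertices]
  | (e.1 < e.2)%N && edge s e.1 e.2].

Lemma mem_vertices v : v \in vertices.
Proof. by case: v => -[|[|[|[|[|[|[|[|//]]]]]]]] i; rewrite !inE -!val_eqE. Qed.

Definition fan s (v : 'I_8) := nth (o0, [::], [::]) (fan_data s) v.
Definition link s v : seq 'I_8 := let: (x, A, B) := fan s v in x :: A ++ B.
Definition pathto s (v : 'I_8) : seq 'I_8 := nth [::] (pathto_data s) v.

Definition comb_check s : bool :=
  [&& all (fun f => (f.1.2, f.2, f.1.1) \in corners s) (corners s),
      all (fun f => edge s f.1.2 f.1.1) (corners s),
      all (fun v => perm_eq [seq (f.1.2, f.2) | f <- corners s & f.1.1 == v]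
                      (zip (link s v) (rcons (behead (link s v)) (head o0 (link s v)))))
          vertices,
      all (fun v => all (fun n => edge s v n == (n \in link s v)) vertices) vertices,
      all (fun v => cycle (fun x y => (v, x, y) \in corners s) (link s v)) vertices &
      all (fun v => path (edge s) o0 (pathto s v) && (last o0 (pathto s v) == v)) vertices
      && all (fun v => let: (_, A, B) := fan s v in (A != [::]) && (B != [::])) vertices].

Lemma comb_checkP s : comb_check s.
Proof. by case: s; vm_compute. Qed.

Section Combinatorics.
Variable s : torus_case.

Lemma corner_rot a b c : (a, b, c) \in corners s -> (b, c, a) \in corners s.
Proof. by have /andP[/allP H _] := comb_checkP s => /H. Qed.

Lemma corner_edge a b c : (a, b, c) \in corners s -> edge s a b.
Proof. by move=> h; apply/hasP; exists (a, b, c). Qed.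

Lemma edge_sym a b : edge s a b -> edge s b a.
Proof.
have /and3P[_ /allP H _] := comb_checkP s.
by move=> /hasP[[[x y] c] /H h /eqP[<- <-]].
Qed.

Lemma edge_corner a b : edge s a b -> exists c, (a, b, c) \in corners s.
Proof. by move=> /hasP[[[x y] c] h /eqP[<- <-]]; exists c. Qed.

Lemma link_perm v : perm_eq [seq (f.1.2, f.2) | f <- corners s & f.1.1 == v]
  (zip (link s v) (rcons (behead (link s v)) (head o0 (link s v)))).
Proof.
have /and4P[_ _ /allP H _] := comb_checkP s.
by apply: H; exact: mem_vertices.
Qed.

Lemma edge_link v n : edge s v n = (n \in link s v).
Proof.
have /and5P[_ _ _ /allP H _] := comb_checkP s.
have /allP h := H v (mem_vertices v).
by apply/eqP/h/mem_vertices.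
Qed.

Lemma link_cycle v : cycle (fun x y => (v, x, y) \in corners s) (link s v).
Proof.
have /and5P[_ _ _ _ /andP[/allP H _]] := comb_checkP s.
by apply: H; exact: mem_vertices.
Qed.

Lemma pathtoP v : path (edge s) ord0 (pathto s v) /\ last ord0 (pathto s v) = v.
Proof.
have /and5P[_ _ _ _ /and3P[_ /allP H _]] := comb_checkP s.
have /andP[h /eqP k] := H v (mem_vertices v).
by have -> : ord0 = o0 by exact: val_inj.
Qed.

Lemma fan_nonempty v : let: (_, A, B) := fan s v in (A != [::]) && (B != [::]).
Proof.
have /and5P[_ _ _ _ /and3P[_ _ /allP H]] := comb_checkP s.
exact: H v (mem_vertices v).
Qed.

(** The corners at v join consecutive vertices of its link, which is a cycle: rotated so as to start
    at n0, it carries the property to every neighbour. *)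
Lemma corner_induction v (P : 'I_8 -> Prop) n0 :
  (forall b c, (v, b, c) \in corners s -> P b -> P c) ->
  edge s v n0 -> P n0 -> forall n, edge s v n -> P n.
Proof.
move=> step; rewrite edge_link => hn0 P0 n; rewrite edge_link => hn.
have [i L' LE] := rot_to hn0.
have cyc := link_cycle v; rewrite -(rot_cycle i) LE /= in cyc.
have : n \in n0 :: L' by rewrite -LE mem_rot.
move: cyc; rewrite rcons_path => /andP[pth _].
elim: (L') n0 P0 pth {hn0 LE} => [|y L IH] x Px /=.
  by move=> _; rewrite inE => /eqP ->.
move=> /andP[xy pL]; rewrite inE => /orP[/eqP -> //|].
exact: IH (step _ _ xy Px) pL.
Qed.

End Combinatorics.

Section FlatForm.
Variables (R : realType) (s : torus_case) (q : config R).
Local Notation C := R[i].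
Local Notation len2 a b := (dot (row b q - row a q) (row b q - row a q)).

(* A closed one-form on the edges inducing, up to the scaling factor L, the
   metric of q on every face. *)
Record flat_form (L : R) (e : 'I_8 -> 'I_8 -> C) : Prop := FlatForm {
  ff_pos : 0 < L;
  ff_anti : forall a b, edge s a b -> e b a = - e a b;
  ff_closed : forall a b c, (a, b, c) \in corners s -> e a b + e b c = e a c;
  ff_len : forall a b, edge s a b -> nrm2 (e a b) = L * len2 a b;
  ff_cross : forall a b c, (a, b, c) \in corners s -> 0 < cross (e a b) (e a c) }.

(** Pairing a linear relation between two sides with each of them yields a homogeneous 2 x 2 system
    whose determinant is [gram]. *)
Lemma gram_nondegenerate :
  (forall a b c, (a, b, c) \in corners s -> 0 < gram (row b q - row a q) (row c q - row a q)) ->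
  nondegenerate_faces s q.
Proof.
move=> gram_gt0 a b c h.
have hc : (a, b, c) \in corners s.
  by apply/flattenP; exists [:: (a, b, c); (b, c, a); (c, a, b)];
    rewrite ?mem_head //; apply/mapP; exists (a, b, c).
have g0 := gram_gt0 _ _ _ hc.
move: (row b q - row a q) (row c q - row a q) g0 => u w g0.
rewrite -kermx_eq0; apply/rowV0P => v /sub_kermxP.
rewrite -[v]hsubmxK mul_row_col.
rewrite [lsubmx v]mx11_scalar [rsubmx v]mx11_scalar !mul_scalar_mx.
move: (_ 0 0) (_ 0 0) => y x E.
have Eu : x * dot u u + y * dot u w = 0.
  have : dot u (x *: u + y *: w) = 0.
    by rewrite E /dot big1 // => k _; rewrite mxE mulr0.
  move=> <-; rewrite /dot !mulr_sumr -big_split /=; apply: eq_bigr => k _.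
  by rewrite !mxE; ring.
have Ew : x * dot u w + y * dot w w = 0.
  have : dot w (x *: u + y *: w) = 0.
    by rewrite E /dot big1 // => k _; rewrite mxE mulr0.
  move=> <-; rewrite /dot !mulr_sumr -big_split /=; apply: eq_bigr => k _.
  by rewrite !mxE; ring.
have xg : x * gram u w = 0.
  have -> : x * gram u w = (x * dot u u + y * dot u w) * dot w w
      - (x * dot u w + y * dot w w) * dot u w by rewrite /gram; ring.
  by rewrite Eu Ew !mul0r subrr.
have yg : y * gram u w = 0.
  have -> : y * gram u w = (x * dot u w + y * dot w w) * dot u u
     - (x * dot u u + y * dot u w) * dot u w by rewrite /gram; ring.
  by rewrite Eu Ew !mul0r subrr.
move: xg yg => /eqP; rewrite mulf_eq0 (gt_eqF g0) orbF => /eqP ->.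
move=> /eqP; rewrite mulf_eq0 (gt_eqF g0) orbF => /eqP ->.
by rewrite raddf0 row_mx0.
Qed.

Variables (L : R) (e : 'I_8 -> 'I_8 -> C).
Hypothesis He : flat_form L e.

Let L0 : 0 < L := ff_pos He.

Lemma corner_edges a b c : (a, b, c) \in corners s ->
  [/\ edge s a b, edge s b c & edge s a c].
Proof.
move=> h; have h2 := corner_rot h; have h3 := corner_rot h2.
by split; [exact: corner_edge h | exact: corner_edge h2 | exact/edge_sym/(corner_edge h3)].
Qed.

Lemma ff_turn a b c : (a, b, c) \in corners s ->
  [/\ e a c = e a b * turn (row b q - row a q) (row c q - row a q),
      0 < gram (row b q - row a q) (row c q - row a q) &
      rot (e a b) (e a c) (angle (row b q - row a q) (row c q - row a q))].
Proof.
move=> h; have [hab hbc hac] := corner_edges h.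
have l3 : nrm2 (e a c - e a b) = L * dot (row c q - row a q - (row b q - row a q))
     (row c q - row a q - (row b q - row a q)).
  have -> : e a c - e a b = e b c by rewrite -(ff_closed He h); ring.
  rewrite (ff_len He hbc); congr (_ * dot _ _); by rewrite opprB addrA subrK.
have cr := ff_cross He h.
have [tE g0] := turn_unique L0 (ff_len He hab) (ff_len He hac) l3 cr.
split=> //; exact: rot_turn L0 (ff_len He hab) (ff_len He hac) l3 cr.
Qed.

Lemma ff_nondegenerate : nondegenerate_faces s q.
Proof. by apply: gram_nondegenerate => a b c /ff_turn[]. Qed.

(** Closedness alone makes the angles around v add up to a multiple of 2 pi; the two half-plane
    conditions show that the link goes around v exactly once. *)
Lemma ff_cone_angle :
  (forall v x A B, fan s v = (x, A, B) ->
     {in A, forall y, 0 < cross (e v x) (e v y)} /\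
     {in B, forall y, 0 < cross (e v y) (e v x)}) ->
  forall v, cone_angle s q v = 2 * pi.
Proof.
move=> Hfan v; rewrite /cone_angle.
pose ang x y := angle (row x q - row v q) (row y q - row v q).
have -> : \sum_(f <- corners s | f.1.1 == v)
     angle (row f.1.2 q - row v q) (row f.2 q - row v q) =
   \sum_(p <- [seq (f.1.2, f.2) | f <- corners s & f.1.1 == v]) ang p.1 p.2.
  by rewrite big_map big_filter.
rewrite (perm_big _ (link_perm s v)) /=.
have cyc := link_cycle s v.
case E : (fan s v) => [[x A] B].
have := fan_nonempty s v; rewrite E => /andP[A0 B0].
have [cA cB] := Hfan _ _ _ _ E.
move: cyc; rewrite /link E /= path_sum_zip.
case: A A0 cA {E} => [//|a A] _ cA; case: B B0 cB => [//|b B] _ cB cyc.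
have -> : rcons ((a :: A) ++ b :: B) x = a :: A ++ b :: B ++ [:: x].
  by rewrite -cats1 /= -catA.
have rp : forall x' l, path (fun x y => (v, x, y) \in corners s) x' l ->
    rpath (e v) ang x' l.
  move=> x' l; elim: l x' => [//|y l IH] x' /= /andP[h p]; split; last exact: IH.
  by have [_ _] := ff_turn h.
apply: (fan_sum (w := e v)) => //.
by apply: rp; move: cyc; rewrite -cats1 /= -catA.
Qed.

Let r := (Num.sqrt L)^-1.
Let e1 a b : C := r%:C * e a b.
Let D (p : seq 'I_8) : C := path_sum e1 ord0 p.

Let r0 : 0 < r. Proof. by rewrite invr_gt0 sqrtr_gt0. Qed.

Let e1_anti a b : edge s a b -> e1 b a = - e1 a b.
Proof. by move=> h; rewrite /e1 (ff_anti He h) mulrN. Qed.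

Let e1_closed a b c : (a, b, c) \in corners s -> e1 a b + e1 b c = e1 a c.
Proof. by move=> h; rewrite /e1 -mulrDr (ff_closed He h). Qed.

Let nrm2C (x : R) : nrm2 (x%:C : C) = x ^+ 2.
Proof. by rewrite /nrm2 /= expr0n addr0. Qed.

Let e1_norm a b : edge s a b -> `|e1 a b| = (enorm (row b q - row a q))%:C.
Proof.
move=> h; rewrite normc_nrm2 nrm2M nrm2C (ff_len He h) /enorm /r.
by rewrite exprVn sqr_sqrtr ?mulKf ?gt_eqF // ltW.
Qed.

Let e1_cross a b c : (a, b, c) \in corners s -> 0 < cross (e1 a b) (e1 a c).
Proof.
by move=> h; rewrite crossMl nrm2C mulr_gt0 ?exprn_gt0 // (ff_cross He h).
Qed.

Lemma ff_developing : developing s q D.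
Proof.
split.
- move=> p t b _ hb; rewrite /D !path_sum_cat /= (e1_anti hb).
  by rewrite addNKr.
- move=> p t b c _ h; rewrite /D !path_sum_cat /=; congr (_ + _).
  by rewrite addrA (e1_closed h).
- move=> p b hp; rewrite /D path_sum_rcons addrC addKr.
  by apply: e1_norm; move: hp; rewrite rcons_path => /andP[].
- move=> p b c _ h; rewrite /D !path_sum_rcons ![path_sum _ _ _ + _]addrC !addrK.
  by rewrite cross_conj e1_cross.
Qed.

Lemma ff_acts (g : 'I_8 * seq 'I_8) : path (edge s) g.1 g.2 -> last g.1 g.2 = g.1 ->
  acts_by_translation s D g (r%:C * path_sum e g.1 g.2).
Proof.
move=> hg lg w p hw lw hp; rewrite /D !path_sum_cat lw lg.
have -> : path_sum e1 g.1 (rev (belast ord0 w)) = - path_sum e1 ord0 w.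
  by rewrite -lw (path_sum_rev (e := edge s)).
have -> : last g.1 (rev (belast ord0 w)) = ord0 by rewrite -lw last_rev_belast.
have -> : path_sum e1 g.1 g.2 = r%:C * path_sum e g.1 g.2.
  elim: (g.2) (g.1) => [|y l IH] x /=; first by rewrite mulr0.
  by rewrite IH mulrDr.
by rewrite addrCA addNKr addrC.
Qed.

(** Inside a face the development is rigid by [turn_unique], so the ratio to e is the same for all
    edges at one lifted vertex. Passing to the next vertex along an edge preserves it because that
    edge is seen from both ends. *)
Lemma developing_unique D' : developing s q D' ->
  exists2 u : C, u != 0 & forall p b, path (edge s) ord0 p -> edge s (last ord0 p) b ->
    D' (rcons p b) - D' p = u * e (last ord0 p) b.
Proof.
move=> [back push len orient].
have step p b c : path (edge s) ord0 p -> (last ord0 p, b, c) \in corners s ->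
    D' (rcons p c) - D' p = (D' (rcons p b) - D' p) *
      turn (row b q - row (last ord0 p) q) (row c q - row (last ord0 p) q).
  move=> hp hc; have [hab hbc hac] := corner_edges hc.
  have hpb : path (edge s) ord0 (rcons p b) by rewrite rcons_path hp.
  have hpc : path (edge s) ord0 (rcons p c) by rewrite rcons_path hp.
  have nrmE x y z : `|D' x - D' y| = (enorm (row z q - row (last ord0 y) q))%:C ->
    nrm2 (D' x - D' y) = 1 * dot (row z q - row (last ord0 y) q) (row z q - row (last ord0 y) q).
    rewrite normc_nrm2 mul1r => -[] /(congr1 (fun t => t ^+ 2)).
    by rewrite !sqr_sqrtr ?nrm2_ge0 ?dot_ge0.
  have [] // := @turn_unique R (D' (rcons p b) - D' p) (D' (rcons p c) - D' p)
    (row b q - row (last ord0 p) q) (row c q - row (last ord0 p) q) 1.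
  - by apply: nrmE; exact: len.
  - by apply: nrmE; exact: len.
  - have -> : D' (rcons p c) - D' p - (D' (rcons p b) - D' p) = D' (rcons p c) - D' (rcons p b).
      by rewrite opprB addrA subrK.
    have hpc' : path (edge s) ord0 (p ++ [:: c]) by rewrite cats1.
    have := push p [::] b c hpc' hc; rewrite cats1 => <-.
    rewrite -cat_rcons cats1 opprB addrA subrK.
    have -> : row c q - row b q = row c q - row (last ord0 (rcons p b)) q by rewrite last_rcons.
    by apply/nrmE/len; rewrite rcons_path hpb last_rcons.
  - by rewrite -cross_conj; exact: orient.
have all_from p n0 u : path (edge s) ord0 p -> edge s (last ord0 p) n0 ->
    D' (rcons p n0) - D' p = u * e (last ord0 p) n0 ->
    forall n, edge s (last ord0 p) n -> D' (rcons p n) - D' p = u * e (last ord0 p) n.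
  move=> hp hn0 E0; apply: corner_induction hn0 E0 => b c hc E.
  by have [-> _ _] := ff_turn hc; rewrite (step _ _ _ hp hc) E mulrA.
have [n0 hn0] : exists n, edge s ord0 n.
  by exists o1; case: (s).
have e0 a b : edge s a b -> e a b != 0.
  move=> /edge_corner[c hc]; exact: (cross_neq0 (ff_cross He hc)).1.
pose u := (D' [:: n0] - D' [::]) / e ord0 n0.
have u0 : u != 0.
  have [c hc] := edge_corner hn0.
  have := orient [::] n0 c isT hc; rewrite cross_conj => /cross_neq0[h _].
  by rewrite mulf_neq0 // invr_neq0 // e0.
exists u => // p; elim/last_ind: p => [|p b IH] n hp hn.
  apply: (all_from [::] n0) => //.
  by rewrite /= /u divfK // e0.
move: hp; rewrite rcons_path => /andP[hp hb].
(* The edge leading back to the previous vertex starts the induction around the new one. *)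
apply: (all_from (rcons p b) (last ord0 p)) => //.
- by rewrite rcons_path hp.
- by rewrite last_rcons; exact: edge_sym.
have hpp : path (edge s) ord0 (p ++ [::]) by rewrite cats0.
have := back p [::] b hpp hb; rewrite cats0 => E.
rewrite -!cats1 -catA /= E last_cat /= (ff_anti He hb) mulrN -(IH _ hp hb).
by rewrite cats1 opprB.
Qed.

(** Replacing the developing map multiplies both translations by one nonzero constant, which cancels
    in the quotient; so the value selected by [xget] is determined. *)
Lemma ff_modulus :
  modulus s q = path_sum e (loop2 s).1 (loop2 s).2 / path_sum e (loop1 s).1 (loop1 s).2.
Proof.

have l1P : path (edge s) (loop1 s).1 (loop1 s).2 /\ last (loop1 s).1 (loop1 s).2 = (loop1 s).1.
  by case: (s); vm_compute.
have l2P : path (edge s) (loop2 s).1 (loop2 s).2 /\ last (loop2 s).1 (loop2 s).2 = (loop2 s).1.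
  by case: (s); vm_compute.
have rC : (r%:C : C) != 0 by rewrite eq_complex /= eqxx andbT gt_eqF.
rewrite /modulus; set A := [set z | _]; set z := _ / _.
have Az : A z.
  exists D, (r%:C * path_sum e (loop1 s).1 (loop1 s).2),
    (r%:C * path_sum e (loop2 s).1 (loop2 s).2); split.
  - exact: ff_developing.
  - exact: ff_acts l1P.1 l1P.2.
  - exact: ff_acts l2P.1 l2P.2.
  - by rewrite -mulf_div divff // mul1r.
have Auniq y : A y -> y = z.
  move=> [D' [v1 [v2 [dD' a1 a2 ->]]]].
  have [u u0 uE] := developing_unique dD'.
  have sumE p l : path (edge s) ord0 p -> path (edge s) (last ord0 p) l ->
      D' (p ++ l) - D' p = u * path_sum e (last ord0 p) l.
    elim: l p => [|y' l IH] p hp /=; first by rewrite cats0 subrr mulr0.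
    move=> /andP[hy hl]; rewrite -cat_rcons mulrDr -(uE _ _ hp hy).
    have := IH (rcons p y'); rewrite last_rcons rcons_path hp => /(_ hy hl) <-.
    by rewrite [RHS]addrC addrA subrK.
  have vE g v : path (edge s) g.1 g.2 -> last g.1 g.2 = g.1 ->
      acts_by_translation s D' g v -> v = u * path_sum e g.1 g.2.
    move=> hg lg hv; have [hw lw] := pathtoP s g.1.
    have hwr : path (edge s) g.1 (rev (belast ord0 (pathto s g.1))).
      rewrite -{1}lw rev_path; apply: sub_path hw => a b; exact: edge_sym.
    have E1 := hv _ [::] hw lw isT.
    have hall : path (edge s) ord0 (pathto s g.1 ++ g.2 ++ rev (belast ord0 (pathto s g.1)) ++ [::]).
      by rewrite cats0 !cat_path hw lw hg lg hwr.
    have := sumE [::] _ isT hall; rewrite cat0s E1 addrC addKr => ->.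
    rewrite /= cats0 !path_sum_cat lw lg; congr (_ * _).
    rewrite -{3}lw (path_sum_rev (e := edge s)) //; last exact: ff_anti He.
    by rewrite addrCA subrr addr0.
  rewrite (vE _ _ l1P.1 l1P.2 a1) (vE _ _ l2P.1 l2P.2 a2).
  by rewrite -mulf_div divff // mul1r.
by apply: Auniq; apply: (@xgetPex _ 0 A); exists z.
Qed.

End FlatForm.

(** * Polynomial equations of the flat locus *)

Definition mk3 (a b : Z) (d : positive) : qs3 := (a, b, d).

(* The variables are the coordinates of the vertices (0 to 23, 3 v + k), the
   planar positions of the vertices 1 to 7 in a developing normalized by
   sending the vertex 0 to 0 and the first period to 1 (24 to 37), the square
   of the scale of the metric (38) and the modulus (39 and 40). *)
Definition base_num (s : torus_case) : seq qs3 :=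
  match s with
  | Square => [:: mk3 0 0 1; mk3 0 0 1; mk3 0 0 1; mk3 73 0 60; mk3 11 0 10; mk3 0 0 1; mk3 1 0 2;
   mk3 0 0 1; mk3 0 0 1; mk3 (-15977) 0 50320; mk3 42471 0 50320; mk3 0 0 1; mk3 1 0 1;
   mk3 0 0 1; mk3 0 0 1; mk3 35937 0 25160; mk3 27357 0 25160; mk3 0 0 1; mk3 0 0 1;
   mk3 33 0 20; mk3 0 0 1; mk3 1 0 1; mk3 33 0 20; mk3 0 0 1; mk3 1 0 2; mk3 1229 0 6534;
   mk3 (-5) 0 33; mk3 (-65) 0 1089; mk3 13 0 66; mk3 (-949) 0 4356; mk3 23 0 33;
   mk3 (-130) 0 1089; mk3 (-10) 0 33; mk3 1 0 2; mk3 13 0 66; mk3 1 0 2; mk3 (-1) 0 2;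
   mk3 829 0 2178; mk3 1185921 0 125800; mk3 0 0 1; mk3 1 0 1]
  | Hexagonal => [:: mk3 0 0 1; mk3 0 0 1; mk3 0 0 1; mk3 896842303 729553300 8073677900;
   mk3 1029317275 568256878 8073677900; mk3 0 0 1; mk3 (-525) 1462 9420;
   mk3 8925 (-24854) 47100; mk3 0 0 1; mk3 9 0 25; mk3 595 (-4713) 10525; mk3 0 0 1;
   mk3 1 0 1; mk3 0 0 1; mk3 0 0 1; mk3 64 25 200; mk3 75 (-136) 200; mk3 0 0 1;
   mk3 (-36) 25 200; mk3 75 (-36) 200; mk3 0 0 1; mk3 279568 (-117825) 109900;
   mk3 264900 (-143557) 109900; mk3 0 0 1; mk3 64945559 48546785 874219900;
   mk3 (-41446440) (-19148409) 874219900; mk3 0 0 1; mk3 (-525) 1462 5100;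
   mk3 (-61438) (-23565) 357850; mk3 29060 (-80121) 357850; mk3 (-1) 0 2; mk3 5 0 34;
   mk3 1463 (-255) 6800; mk3 (-955) 2437 6800; mk3 1463 (-255) 6800; mk3 45 (-963) 6800;
   mk3 19354 (-8665) 11900; mk3 (-4945) 2948 5950; mk3 578 0 157; mk3 1 0 2; mk3 0 1 2]
  end.

Definition c0 : 'I_3 := @Ordinal 3 0 isT.
Definition c1 : 'I_3 := @Ordinal 3 1 isT.
Definition c2 : 'I_3 := @Ordinal 3 2 isT.

Definition qvar (v : 'I_8) (k : 'I_3) : nat := 3 * v + k.
(* The free coordinates are solved for together with P, mu and, on the flat
   locus (1), tau; there two of the free coordinates become parameters. *)
Definition unknowns2 s : seq nat :=
  [seq qvar vk.1 vk.2 | vk <- free_coords s] ++ iota 24 15.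
Definition params2 s : seq nat := [seq k <- iota 0 24 | k \notin unknowns2 s] ++ [:: 39; 40]%N.
Definition unknowns1 s : seq nat :=
  [seq k <- unknowns2 s | k \notin match s with Square => [:: 0; 3] | Hexagonal => [:: 6; 7] end%N]
  ++ [:: 39; 40]%N.
Definition params1 s : seq nat := [seq k <- iota 0 24 | k \notin unknowns1 s].

Definition re_expr (v : 'I_8) : pexpr := if v == o0 then PC 0 else PVar (22 + 2 * v).
Definition im_expr (v : 'I_8) : pexpr := if v == o0 then PC 0 else PVar (23 + 2 * v).

(* Multiples of the two periods to be added to the edges crossing the cuts. *)
Definition winding s (a b : 'I_8) : int * int :=
  let find a b := [seq t.2 | t <- winding_data s & t.1 == (a, b)] in
  if find a b is w :: _ then w
  else if find b a is w :: _ then (- w.1, - w.2) else (0, 0).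

Definition psub a b := PAdd a (PMul (PC (-1)) b).
Definition edge_re s a b := PAdd (psub (re_expr b) (re_expr a))
  (PAdd (PC (winding s a b).1) (PMul (PC (winding s a b).2) (PVar 39))).
Definition edge_im s a b := PAdd (psub (im_expr b) (im_expr a))
  (PMul (PC (winding s a b).2) (PVar 40)).
Definition psqr a := PMul a a.
Definition len_expr s (ab : 'I_8 * 'I_8) : pexpr := let: (a, b) := ab in
  let d k := psqr (psub (PVar (qvar b k)) (PVar (qvar a k))) in
  psub (PAdd (PAdd (d c0) (d c1)) (d c2))
    (PMul (PVar 38) (PAdd (psqr (edge_re s a b)) (psqr (edge_im s a b)))).
Definition cross_expr s (t : 'I_8 * 'I_8 * 'I_8) : pexpr := let: (v, a, b) := t in
  psub (PMul (edge_re s v a) (edge_im s v b)) (PMul (edge_im s v a) (edge_re s v b)).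

(** The corners make every developed face positively oriented; the fan entries supply the half-plane
    conditions of [ff_cone_angle]. *)
Definition cross_list s : seq ('I_8 * 'I_8 * 'I_8) := corners s ++
  flatten [seq let: (x, A, B) := fan s v in
     [seq (v, x, y) | y <- A] ++ [seq (v, y, x) | y <- B] | v <- vertices].
Definition len_exprs s : seq pexpr := [seq len_expr s ab | ab <- edges s].
Definition pos_exprs s : seq pexpr :=
  PVar 38 :: PVar 40 :: [seq cross_expr s t | t <- cross_list s].

Definition addpz (x y : int * int) : int * int := (x.1 + y.1, x.2 + y.2).
Definition winding_sum s x p :=
  (path_sum (fun a b => (winding s a b).1) x p, path_sum (fun a b => (winding s a b).2) x p).

Definition winding_check s : bool :=
  [&& all (fun f => winding s f.1.2 f.1.1 == (- (winding s f.1.1 f.1.2).1, - (winding s f.1.1 f.1.2).2))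
        (corners s),
      all (fun f => addpz (winding s f.1.1 f.1.2) (winding s f.1.2 f.2) == winding s f.1.1 f.2)
        (corners s),
      winding_sum s (loop1 s).1 (loop1 s).2 == (1, 0),
      winding_sum s (loop2 s).1 (loop2 s).2 == (0, 1),
      (last (loop1 s).1 (loop1 s).2 == (loop1 s).1) && (last (loop2 s).1 (loop2 s).2 == (loop2 s).1) &
      all (fun f => ((f.1.1, f.1.2) \in edges s) || ((f.1.2, f.1.1) \in edges s)) (corners s)].

Lemma winding_checkP s : winding_check s.
Proof. by case: s; vm_compute. Qed.

Section Environment.
Variables (R : realType) (s : torus_case) (f : nat -> R).
Local Notation C := R[i].

Definition cfg : config R := \matrix_(v < 8, k < 3) f (qvar v k).
Definition form_of (a b : 'I_8) : C := peval f (edge_re s a b) +i* peval f (edge_im s a b).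
Definition pos_of (v : 'I_8) : C := peval f (re_expr v) +i* peval f (im_expr v).
Definition tau_of : C := f 39 +i* f 40.

Lemma form_ofE a b : form_of a b = pos_of b - pos_of a +
  (winding s a b).1%:~R + (winding s a b).2%:~R * tau_of.
Proof.
have intC (n : int) : (n%:~R : C) = (n%:~R : R)%:C by rewrite -[RHS]/(real_complex R _) rmorph_int.
rewrite /form_of /pos_of /tau_of !intC.
apply/eqP; rewrite eq_complex /=; apply/andP; split; apply/eqP; ring.
Qed.

Lemma form_of_anti a b : edge s a b -> form_of b a = - form_of a b.
Proof.
move=> /hasP[[[x y] c] h /eqP[<- <-]].
have /andP[/allP H _] := winding_checkP s.
have /eqP E := H _ h; rewrite !form_ofE E /= !rmorphN /=; ring.
Qed.

Lemma form_of_closed a b c : (a, b, c) \in corners s ->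
  form_of a b + form_of b c = form_of a c.
Proof.
have /and3P[_ /allP H _] := winding_checkP s.
move=> /H /eqP E; rewrite !form_ofE -E /addpz /= !rmorphD /=; ring.
Qed.

Lemma form_of_path x p : path_sum form_of x p = pos_of (last x p) - pos_of x +
  (winding_sum s x p).1%:~R + (winding_sum s x p).2%:~R * tau_of.
Proof.
elim: p x => [|y p IH] x /=; first by rewrite subrr mul0r !addr0.
by rewrite IH form_ofE /= !rmorphD /=; ring.
Qed.

Lemma form_of_loop1 : path_sum form_of (loop1 s).1 (loop1 s).2 = 1.
Proof.
have /and5P[_ _ /eqP E _ /andP[/andP[/eqP l _] _]] := winding_checkP s.
by rewrite form_of_path E l subrr /= mul0r addr0 add0r.
Qed.

Lemma form_of_loop2 : path_sum form_of (loop2 s).1 (loop2 s).2 = tau_of.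
Proof.
have /and5P[_ _ _ /eqP E /andP[/andP[_ /eqP l] _]] := winding_checkP s.
by rewrite form_of_path E l subrr /= mul1r !add0r.
Qed.

Lemma edge_edges a b : edge s a b -> ((a, b) \in edges s) || ((b, a) \in edges s).
Proof.
have /and5P[_ _ _ _ /andP[_ /allP H]] := winding_checkP s.
by move=> /hasP[[[x y] c] h /eqP[<- <-]]; exact: (H _ h).
Qed.

Lemma dot_cfg a b : dot (row b cfg - row a cfg) (row b cfg - row a cfg) =
  (f (qvar b c0) - f (qvar a c0)) ^+ 2 +
  (f (qvar b c1) - f (qvar a c1)) ^+ 2 +
  (f (qvar b c2) - f (qvar a c2)) ^+ 2.
Proof.
rewrite /dot !big_ord_recl big_ord0 addr0 !mxE addrA.
have -> : lift ord0 (ord0 : 'I_2) = c1 by exact: val_inj.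
have -> : lift ord0 (lift ord0 (ord0 : 'I_1)) = c2 by exact: val_inj.
have -> : (ord0 : 'I_3) = c0 by exact: val_inj.
by rewrite !expr2.
Qed.

Lemma len_exprP a b : peval f (len_expr s (a, b)) =
  dot (row b cfg - row a cfg) (row b cfg - row a cfg) - f 38 * nrm2 (form_of a b).
Proof. by rewrite dot_cfg /nrm2 /form_of /=; ring. Qed.

Lemma cross_exprP v a b : peval f (cross_expr s (v, a, b)) = cross (form_of v a) (form_of v b).
Proof. by rewrite /cross /form_of /=; ring. Qed.

Hypothesis pos : all (fun t => 0 < peval f t) (pos_exprs s).

Lemma pos_f38 : 0 < f 38. Proof. by move: pos => /= /and3P[]. Qed.
Lemma pos_f40 : 0 < f 40. Proof. by move: pos => /= /and3P[]. Qed.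

Lemma pos_cross v a b : (v, a, b) \in cross_list s -> 0 < cross (form_of v a) (form_of v b).
Proof.
move=> h; move: pos; rewrite /pos_exprs [all _ _]/= all_map.
by move=> /and3P[_ _ /allP /(_ _ h)]; rewrite -cross_exprP.
Qed.

Hypothesis eqs : all (fun t => peval f t == 0) (len_exprs s).

Lemma flat_form_of : flat_form s cfg (f 38)^-1 form_of.
Proof.
have p38 := pos_f38.
have len a b : (a, b) \in edges s ->
    nrm2 (form_of a b) = (f 38)^-1 * dot (row b cfg - row a cfg) (row b cfg - row a cfg).
  move=> h; move: eqs; rewrite all_map => /allP /(_ _ h) /=.
  rewrite -[X in X == 0]/(peval f (len_expr s (a, b))) len_exprP subr_eq0 => /eqP ->.
  by rewrite mulKf // gt_eqF.
split.
- by rewrite invr_gt0.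
- exact: form_of_anti.
- exact: form_of_closed.
- move=> a b h; have /orP[h2|h2] := edge_edges h; first exact: len.
  rewrite -nrm2N -form_of_anti // len //.
  by rewrite -[row b _ - _]opprB dotNN.
- by move=> a b c h; apply: pos_cross; rewrite mem_cat h.
Qed.

Lemma flat_of_env : flat_locus s cfg /\ modulus s cfg = tau_of.
Proof.
have H := flat_form_of; split; last first.
  by rewrite (ff_modulus H) form_of_loop1 form_of_loop2 divr1.
split; first exact: ff_nondegenerate H.
apply: (ff_cone_angle H) => v x A B E.
have inl t : t \in [seq (v, x, y) | y <- A] ++ [seq (v, y, x) | y <- B] -> t \in cross_list s.
  move=> h; rewrite mem_cat; apply/orP; right; apply/flattenP.
  exists ([seq (v, x, y) | y <- A] ++ [seq (v, y, x) | y <- B]) => //.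
  by apply/mapP; exists v; [exact: mem_vertices | rewrite E].
split=> y hy; apply/pos_cross/inl; rewrite mem_cat; apply/orP; [left|right];
by apply/mapP; exists y.
Qed.

End Environment.

Section Coordinates.
Variable R : realType.

Definition coord (q : config R) (k : nat) : R := q (inord (k %/ 3)) (inord (k %% 3)).

Lemma coord_qvar q v k : coord q (qvar v k) = q v k.
Proof.
rewrite /coord /qvar mulnC divnMDl // modnMDl divn_small ?modn_small // addn0.
by congr (q _ _); apply: val_inj; rewrite /= inordK.
Qed.

Lemma qvar_lt v k : (qvar v k < 24)%N.
Proof. by rewrite /qvar; case: v k => [v hv] [k hk] /=; lia. Qed.

Lemma qvarE k : (k < 24)%N -> k = qvar (inord (k %/ 3)) (inord (k %% 3)).
Proof. by move=> hk; rewrite /qvar !inordK; lia. Qed.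

Lemma coord_cfg f k : (k < 24)%N -> coord (cfg f) k = f k.
Proof. by move=> /qvarE {2}->; rewrite /coord mxE. Qed.

Lemma cfg_eq (f g : nat -> R) : (forall k, (k < 24)%N -> f k = g k) -> cfg f = cfg g.
Proof. by move=> fg; apply/matrixP => v k; rewrite !mxE fg // qvar_lt. Qed.

Lemma cfg_coord q : cfg (coord q) = q.
Proof. by apply/matrixP => v k; rewrite mxE coord_qvar. Qed.

End Coordinates.

(** * Certificates at the base *)

Definition base_s3 s (k : nat) : qs3 := nth (s3int 0) (base_num s) k.

Section ApproximateInverse.
Local Open Scope Z_scope.

(* The first component consists of the rows already used as pivots; the
   column in progress is the head of all rows. *)
Definition pivot_step (st : seq (seq Z) * seq (seq Z)) :=
  let: (dn, td) := st in
  let best := foldr (fun r p => if Z.abs (head 0 p) <? Z.abs (head 0 r) then r else p) [::] td in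
  let pivot := [seq Z.div (x * scale) (head 0 best) | x <- behead best] in
  let elim r := if head 0 r =? 0 then behead r else
    [seq if x.2 =? 0 then x.1 else x.1 - Z.div (head 0 r * x.2) scale
    | x <- zip (behead r) pivot] in
  (rcons (map elim dn) pivot, map elim (rem best td)).

(* Gauss-Jordan elimination in fixed-point arithmetic; nothing needs to be
   proved about it, because ift_check validates the result. *)
Definition approx_inverse (e : nat -> qs3) (U : seq nat) (G : seq pexpr) : seq (seq qs3) :=
  let n := size U in
  let rows := [seq [seq s3round (s3deriv e (nth 0%N U i) t) | t <- G] ++
                   [seq if j == i then scale else 0 | j <- iota 0 n] | i <- iota 0 n] in
  [seq [seq mk3 (Z.div z 10000) 0 1000 | z <- r] | r <- (iter n pivot_step ([::], rows)).1].

End ApproximateInverse.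

(** The dimensions 16 and 23 stand for 17 parameters and 24 unknowns, because [ift_check] counts
    with successors. *)
Lemma ift_check1 s : ift_check 16 23 (params1 s) (unknowns1 s) (len_exprs s)
  (base_s3 s) (approx_inverse (base_s3 s) (unknowns1 s) (len_exprs s)).
Proof. by case: s; vm_compute. Qed.

Lemma ift_check2 s : ift_check 16 23 (params2 s) (unknowns2 s) (len_exprs s)
  (base_s3 s) (approx_inverse (base_s3 s) (unknowns2 s) (len_exprs s)).
Proof. by case: s; vm_compute. Qed.

Lemma pos_exprs_check s :
  all (fun t => vars_in (iota 0 41) t && s3pos (s3eval (base_s3 s) t)) (pos_exprs s).
Proof. by case: s; vm_compute. Qed.

Section Base.
Variables (R : realType) (s : torus_case).

Definition base_env (k : nat) : R := KR R (base_s3 s k).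

Lemma s3pos_near (w : nat -> qs3) (l : seq pexpr) :
  all (fun t => vars_in (iota 0 41) t && s3pos (s3eval w t)) l ->
  exists2 d : R, 0 < d &
  forall f : nat -> R, (forall k, (k < 41)%N -> `|f k - KR R (w k)| < d) ->
  all (fun t => 0 < peval f t) l.
Proof.
pose b0 (k : nat) : R := KR R (w k).
have loc t : vars_in (iota 0 41) t -> s3pos (s3eval w t) ->
   exists2 d : R, 0 < d & forall f : nat -> R,
    (forall k, (k < 41)%N -> `|f k - b0 k| < d) -> 0 < peval f t.
  (* All 41 variables are declared parameters and the single unknown is a dummy, so that
     [peval_continuous] gives joint continuity in every variable. *)
  move=> vt pt; pose sel (k : nat) : 'I_41 + 'I_1 := inl (inord k).
  pose row (f : nat -> R) : 'rV[R]_41 := \row_j f j.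
  have envE f : forall k, (k < 41)%N -> env sel (row f) 0 k = f k.
    by move=> k hk; rewrite /env /= mxE inordK.
  have pe f : peval (env sel (row f) 0) t = peval f t.
    elim: (t) vt => [k h|//|a IHa b IHb h|a IHa b IHb h].
    - by apply: envE; have : k \in iota 0 41 := h; rewrite mem_iota.
    - by have /andP[ha hb] := h; rewrite /= IHa ?IHb.
    - by have /andP[ha hb] := h; rewrite /= IHa ?IHb.
  have pb : 0 < peval (env sel (row b0) 0) t.
    rewrite pe (@peval_s3eval R (iota 0 41) [::] _ w) ?cats0 //.
    by apply: s3posP.
  have := @peval_continuous R 41 1 sel t (row b0, 0).
  move=> /cvgr_gt /(_ _ pb) /nbhs_ballP[d /= d0 H].
  exists d => // f hf; rewrite -pe; apply: (H (row f, 0)).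
  split; last exact: ballxx.
  rewrite /= -ball_normE /=.
  have h1 : `|row b0 - row f| <= \big[Order.max/0]_(j < 41) `|b0 j - f j|.
    apply: normr_mx_le => [|i j].
      by apply: (big_ind (fun x => 0 <= x)) => // x y; rewrite le_max => -> _.
    by rewrite !mxE; exact: (le_bigmax 0 (fun j : 'I_41 => `|b0 j - f j|)).
  apply: le_lt_trans h1 _; apply: bigmax_lt => // j _.
  by rewrite distrC hf.
elim: l => [_|t l IH] /=.
  by exists 1 => // f _.
move=> /andP[/andP[vt pt] /IH[d1 d10 H1]]; have [d2 d20 H2] := loc t vt pt.
exists (Num.min d1 d2); first by rewrite lt_min d10.
move=> f hf; rewrite H2 ?H1 // => k hk; have := hf k hk; rewrite lt_min => /andP[] //.
Qed.

Lemma pos_exprs_near : exists2 d : R, 0 < d &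
  forall f : nat -> R, (forall k, (k < 41)%N -> `|f k - base_env k| < d) ->
  all (fun t => 0 < peval f t) (pos_exprs s).
Proof. exact: s3pos_near (pos_exprs_check s). Qed.

Lemma ZR_xO p : ZR R (Zpos (xO p)) = 2 * ZR R (Zpos p).
Proof. by rewrite -[Zpos (xO p)]/(Z.mul (Zpos 2) (Zpos p)) ZRM. Qed.
Lemma ZR_xI p : ZR R (Zpos (xI p)) = 2 * ZR R (Zpos p) + 1.
Proof. by rewrite -[Zpos (xI p)]/(Z.add (Z.mul (Zpos 2) (Zpos p)) (Zpos 1)) ZRD ZRM. Qed.
Lemma ZR_neg p : ZR R (Zneg p) = - ZR R (Zpos p).
Proof. by rewrite -[Zneg p]/(Z.opp (Zpos p)) ZRN. Qed.
Lemma ZR_1 : ZR R (Zpos xH) = 1. Proof. by []. Qed.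
Lemma ZR_0 : ZR R Z0 = 0. Proof. by []. Qed.
Definition ZRE := (ZR_neg, ZR_xO, ZR_xI, ZR_1, ZR_0).

End Base.

Section BaseValues.
Variables (R : realType).

(** With c the cosine, the triple angle formula and cos pi = -1 give (c + 1) (2 c - 1)^2 = 0, and c
    > 0 leaves c = 1/2. *)
Lemma cos_sin_pi3 : cos (pi / 3) = 1 / 2 :> R /\ sin (pi / 3) = Num.sqrt 3 / 2 :> R.
Proof.
have p0 := pi_gt0 R.
have c0 : 0 < cos (pi / 3 : R).
  by apply: cos_gt0_pihalf; apply/andP; split; lra.
have s0 : 0 < sin (pi / 3 : R).
  by apply: sin_gt0_pi; apply/andP; split; lra.
have cs := cos2Dsin2 (pi / 3 : R).
have E : cos (pi / 3 + pi / 3 + pi / 3 : R) = -1.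
  by rewrite -cospi; congr cos; field.
move: E; rewrite !cosD sinD.
move: (cos _) (sin _) c0 s0 cs => c d c0 s0 cs E.
have E2 : (c + 1) * (2 * c - 1) ^+ 2 = 0.
  have -> : (c + 1) * (2 * c - 1) ^+ 2 = 4 * c ^+ 3 - 3 * c + 1 by ring.
  have d2 : d ^+ 2 = 1 - c ^+ 2 by rewrite -cs; ring.
  have : (c * c - d * d) * c - (d * c + c * d) * d = c ^+ 3 - 3 * c * d ^+ 2 by ring.
  by rewrite E d2 => E3; have -> : 4 * c ^+ 3 - 3 * c = c ^+ 3 - 3 * c * (1 - c ^+ 2) by [ring]; rewrite -E3; ring.
have cE : c = 1 / 2.
  move/eqP: E2; rewrite mulf_eq0 sqrf_eq0 gt_eqF ?addr_gt0 //= => /eqP; lra.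
split => //.
apply/eqP; rewrite -(@eqrXn2 _ 2) ?ltW ?divr_gt0 ?sqrtr_gt0 //.
rewrite expr_div_n sqr_sqrtr //.
have -> : d ^+ 2 = 1 - c ^+ 2 by rewrite -cs; ring.
by rewrite cE; apply/eqP; field.
Qed.

Variable s : torus_case.

Lemma tau_base : tau_of (base_env R s) = target R s.
Proof.
rewrite /tau_of /base_env /base_s3; case: s => /=; last first.
  have [-> ->] := cos_sin_pi3.
  rewrite /mk3 /KR !ZRE; apply/eqP; rewrite eq_complex /=.
  by apply/andP; split; apply/eqP; field.
rewrite /mk3 /KR !ZRE; apply/eqP; rewrite eq_complex /=.
by apply/andP; split; apply/eqP; field.
Qed.

Let cons_pair (a b a' b' : R) l l' : a = a' -> b = b' -> l = l' ->
  (a, b) :: l = (a', b') :: l'.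
Proof. by move=> -> -> ->. Qed.

Lemma base_xyE : base_xy R s =
  [seq (base_env R s (3 * v)%N, base_env R s (3 * v + 1)%N) | v <- iota 0 8].
Proof.
case: s; lazy beta iota zeta delta [base_xy base_env base_s3 base_num map iota nth
  muln addn muln_rec addn_rec Nat.add Nat.mul mk3];
  repeat (refine (cons_pair _ _ _)); try exact: (erefl (@nil (R * R))).
all: rewrite /KR ?ZRE; field; exact: isT.
Qed.

Lemma cfg_base : cfg (base_env R s) = base R s.
Proof.
apply/matrixP => v k; rewrite !mxE base_xyE.
have base2 : forall w : 'I_8, base_env R s (3 * w + 2)%N = 0.
  move=> w; rewrite /base_env (_ : base_s3 s (3 * w + 2)%N = s3int 0) ?s3intP //.
  by have := mem_vertices w; rewrite !inE => /or4P[|||/or4P[|||/orP[]]] /eqP ->; case: s; vm_compute.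
rewrite (nth_map 0%N) ?size_iota ?ltn_ord // nth_iota ?ltn_ord // add0n.
by case: k => -[|[|[|//]]] ik; rewrite /qvar /= ?addn0 ?base2.
Qed.

End BaseValues.

(** * Developing a flat configuration *)

Local Notation hedge := ('I_8 * 'I_8)%type.
Local Notation face := ('I_8 * 'I_8 * 'I_8)%type.

Definition hedges (t : face) : seq hedge :=
  let: (a, b, c) := t in [:: (a, b); (b, c); (c, a)].

(* Every face of l is glued along its first edge to a face placed before. *)
Fixpoint dev_ok (placed : seq hedge) (l : seq face) : bool :=
  if l is (a, b, c) :: l' then
    [&& (b, a) \in placed, uniq (hedges (a, b, c)),
        ~~ has (mem placed) (hedges (a, b, c)) & dev_ok (hedges (a, b, c) ++ placed) l']
  else true.

Definition swap (h : hedge) : hedge := (h.2, h.1).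
Definition tree_edges s : seq hedge := [seq t.1 | t <- dev_order s].
Definition uncut_edges s := tree_edges s ++ leaf_edges s.
Definition either (known : seq hedge) (a b : 'I_8) := ((a, b) \in known) || ((b, a) \in known).

Fixpoint leaves_ok s (known : seq hedge) (l : seq hedge) : bool :=
  if l is (v, u) :: l' then
    [&& u \in link s v, all (fun n => (n == u) || either known v n) (link s v)
      & leaves_ok s ((v, u) :: known) l']
  else true.

(* At x the only edges crossed with holonomy are (p, x) and (x, n). *)
Definition cut_vertex_ok s (p x n : 'I_8) : bool :=
  [&& p \in link s x, n \in link s x, p != n &
      all (fun u => [|| u == p, u == n | either (uncut_edges s) x u]) (link s x)].
Definition cut_ok s (t : face) : bool :=
  let: (c, x, y) := t in cut_vertex_ok s c x y && cut_vertex_ok s x y c.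

Definition rotations (t : face) : seq face :=
  let: (a, b, c) := t in [:: (a, b, c); (b, c, a); (c, a, b)].
Definition cycles s := corners s ++ rotations (cut1 s) ++ rotations (cut2 s).
Fixpoint closure_ok s (known : seq hedge) (l : seq face) : bool :=
  if l is (a, b, c) :: l' then
    [&& either known a b, either known b c, (a, b, c) \in cycles s
      & closure_ok s ((c, a) :: known) l']
  else all (fun f => either known f.1.1 f.1.2) (corners s).
Definition path_edges s : seq hedge :=
  [seq (last o0 (belast o0 (pathto s v)), v) | v <- behead vertices].

Definition cut_sum (V : zmodType) (e : 'I_8 -> 'I_8 -> V) (t : face) : V :=
  let: (a, b, c) := t in e a b + e b c + e c a.

Definition dev_check s : bool :=
  [&& dev_ok (hedges (dev_root s)) (dev_order s),
      all (fun f => has (fun t => f \in rotations t) (dev_root s :: dev_order s)) (corners s),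
      all (fun t => t \in corners s) (dev_root s :: dev_order s),
      leaves_ok s (tree_edges s) (leaf_edges s),
      cut_ok s (cut1 s) && cut_ok s (cut2 s) &
  [&& perm_eq [seq f.1 | f <- corners s]
        ((hedges (cut1 s) ++ hedges (cut2 s) ++ uncut_edges s) ++
         [seq swap h | h <- hedges (cut1 s) ++ hedges (cut2 s) ++ uncut_edges s]),
      all (fun v => uniq (link s v)) vertices,
      closure_ok s (path_edges s) (closure_steps s),
      all (fun h => (pathto s h.2 == rcons (pathto s h.1) h.2)
                    && (winding s h.1 h.2 == (0, 0)) && edge s h.1 h.2) (path_edges s) &
      [&& cut_sum (fun a b => (winding s a b).1) (cut1 s) == 1,
          cut_sum (fun a b => (winding s a b).2) (cut1 s) == 0,
          cut_sum (fun a b => (winding s a b).1) (cut2 s) == 0,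
          cut_sum (fun a b => (winding s a b).2) (cut2 s) == 1,
          all (fun v => winding_sum s o0 (pathto s v) == (0, 0)) vertices &
          all (fun h => edge s h.1 h.2) (hedges (cut1 s) ++ hedges (cut2 s) ++ uncut_edges s)]]].

Lemma dev_checkP s : dev_check s.
Proof. by case: s; vm_compute. Qed.

Section Develop.
Variables (R : realType).
Local Notation C := R[i].
Implicit Types (q : config R) (E : 'I_8 -> 'I_8 -> C).

Definition turn_at q (t : face) : C := let: (a, b, c) := t in
  turn (row b q - row a q) (row c q - row a q).

Definition place q E (t : face) : 'I_8 -> 'I_8 -> C := let: (a, b, c) := t in
  let z := - E b a in let w := z * turn_at q t in
  fun x y => if (x, y) == (a, b) then z else if (x, y) == (b, c) then w - z
             else if (x, y) == (c, a) then - w else E x y.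

(** The initial value -1 gives the first edge of the root face the value 1, which fixes rotation and
    scale. *)
Definition develop s q := foldl (place q) (place q (fun _ _ => -1) (dev_root s)) (dev_order s).

Definition placed_at q E (t : face) : Prop := let: (a, b, c) := t in
  E b c = E a b * turn_at q t - E a b /\ E c a = - (E a b * turn_at q t).

Lemma place_new q E t : uniq (hedges t) -> placed_at q (place q E t) t /\
  place q E t t.1.1 t.1.2 = - E t.1.2 t.1.1.
Proof.
case: t => [[a b] c]; rewrite /hedges /= !inE !negb_or -!andbA => /and4P[h1 h2 h3 _].
split; last by rewrite eqxx.
rewrite /placed_at /= !eqxx [(b, c) == _]eq_sym (negbTE h1).
by rewrite [(c, a) == (a, b)]eq_sym (negbTE h2) [(c, a) == (b, c)]eq_sym (negbTE h3).
Qed.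

Lemma place_old q E t h : h \notin hedges t -> place q E t h.1 h.2 = E h.1 h.2.
Proof.
case: t h => [[a b] c] [x y]; rewrite !inE !negb_or => /and3P[h1 h2 h3] /=.
by rewrite (negbTE h1) (negbTE h2) (negbTE h3).
Qed.

Lemma foldl_place q l E placed : dev_ok placed l ->
  let F := foldl (place q) E l in
  (forall h, h \in placed -> F h.1 h.2 = E h.1 h.2) /\
  (forall t, t \in l -> placed_at q F t /\ F t.1.1 t.1.2 = - F t.1.2 t.1.1).
Proof.
elim: l E placed => [|[[a b] c] l IH] E placed //=.
move=> /and4P[hba un /norP[n1 /norP[n2 /norP[n3 _]]] ok].
have [IH1 IH2] := IH (place q E (a, b, c)) _ ok.
have old h : h \in placed -> h \notin hedges (a, b, c).
  move=> hp; rewrite !inE; apply/negP => /or3P[] /eqP E1; move: hp; rewrite E1.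
  - exact/negP.
  - exact/negP.
  - exact/negP.
split=> [h hp|t].
  have hp' : h \in hedges (a, b, c) ++ placed by rewrite mem_cat hp orbT.
  by rewrite (IH1 _ hp'); exact: place_old (old _ hp).
rewrite inE => /orP[/eqP ->|]; last exact: IH2.
have un' : uniq (hedges (a, b, c)) := un.
have [pa pz] := place_new q E un'.
have new h : h \in hedges (a, b, c) -> foldl (place q) (place q E (a, b, c)) l h.1 h.2
    = place q E (a, b, c) h.1 h.2.
  by move=> hh; apply: IH1; rewrite -[_ :: _]/(hedges (a, b, c) ++ placed) mem_cat hh.
have nab := new (a, b) (mem_head _ _).
have nbc : foldl (place q) (place q E (a, b, c)) l b c = place q E (a, b, c) b c.
  by apply: (new (b, c)); rewrite !inE eqxx orbT.
have nca : foldl (place q) (place q E (a, b, c)) l c a = place q E (a, b, c) c a.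
  by apply: (new (c, a)); rewrite !inE eqxx !orbT.
have nba : foldl (place q) (place q E (a, b, c)) l b a = E b a.
  have hp' : (b, a) \in hedges (a, b, c) ++ placed by rewrite mem_cat hba orbT.
  by rewrite [LHS](IH1 _ hp'); exact: (place_old q E (old _ hba)).
rewrite /= in nab; split; last by rewrite [LHS]nab nba; exact: pz.
by rewrite /placed_at nab nbc nca.
Qed.

Lemma dev_ok_ind (P : 'I_8 -> 'I_8 -> Prop) l placed : dev_ok placed l ->
  (forall h, h \in placed -> P h.1 h.2) ->
  (forall a b c, (a, b, c) \in l -> P b a -> [/\ P a b, P b c & P c a]) ->
  forall t, t \in l -> forall h, h \in hedges t -> P h.1 h.2.
Proof.
elim: l placed => [|[[a b] c] l IH] placed //= /and4P[hba _ _ ok] Pp step.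
have [pab pbc pca] := step _ _ _ (mem_head _ _) (Pp _ hba).
have new h : h \in hedges (a, b, c) -> P h.1 h.2.
  by rewrite !inE => /or3P[] /eqP ->.
move=> t; rewrite inE => /orP[/eqP -> //|].
apply: IH ok _ _ t => [h|x y z hl]; last by apply: step; rewrite inE hl orbT.
by rewrite -[_ :: _]/(hedges (a, b, c) ++ placed) mem_cat => /orP[/new//|/Pp].
Qed.

Section Fixed.
Variables (s : torus_case) (q : config R).
Let E := develop s q.

Lemma develop_placed t : t \in dev_root s :: dev_order s -> placed_at q E t.
Proof.
have /andP[ok _] := dev_checkP s.
have [H1 H2] := foldl_place q (place q (fun _ _ => -1) (dev_root s)) ok.
rewrite inE => /orP[/eqP ->|/H2[] //].
have un : uniq (hedges (dev_root s)) by case: (s); vm_compute.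
have [pa _] := place_new q (fun _ _ => -1) un.
move: pa H1; rewrite /E /develop; move: (foldl _ _ _) => F.
case: (dev_root s) => [[a b] c] [p1 p2] H1.
rewrite /placed_at (H1 (a, b) (mem_head _ _)) (H1 (b, c)) ?inE ?eqxx ?orbT //.
by rewrite (H1 (c, a)) ?inE ?eqxx ?orbT.
Qed.

Lemma develop_root : E (dev_root s).1.1 (dev_root s).1.2 = 1.
Proof.
have /andP[ok _] := dev_checkP s.
have [H1 H2] := foldl_place q (place q (fun _ _ => -1) (dev_root s)) ok.
have un : uniq (hedges (dev_root s)) by case: (s); vm_compute.
have [_ pa] := place_new q (fun _ _ => -1) un.
rewrite -[LHS]/(foldl (place q) (place q (fun _ _ => -1) (dev_root s)) (dev_order s) _ _).
rewrite (H1 ((dev_root s).1.1, (dev_root s).1.2)) /=; last first.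
  by case: (dev_root s) => [[a b] c]; rewrite mem_head.
by rewrite pa opprK.
Qed.

Lemma develop_tree h : h \in tree_edges s -> E h.1 h.2 = - E h.2 h.1.
Proof.
have /andP[ok _] := dev_checkP s.
have [_ H2] := foldl_place q (place q (fun _ _ => -1) (dev_root s)) ok.
by move=> /mapP[t /H2[_ H] ->].
Qed.

(** Every directed edge is a side of a placed face, and it is reached from the root edge by moving
    around faces and crossing tree edges. *)
Lemma develop_ind (P : 'I_8 -> 'I_8 -> Prop) :
  P (dev_root s).1.1 (dev_root s).1.2 ->
  (forall a b c, (a, b, c) \in dev_root s :: dev_order s ->
     P a b -> P b c /\ P c a) ->
  (forall a b, (a, b) \in tree_edges s -> P b a -> P a b) ->
  forall a b, edge s a b -> P a b.
Proof.
move=> P0 step flip; have /and3P[ok /allP cov _] := dev_checkP s.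
have Proot h : h \in hedges (dev_root s) -> P h.1 h.2.
  move: P0 step; case: (dev_root s) => [[a b] c] P0 /(_ a b c (mem_head _ _) P0)[p1 p2].
  by rewrite !inE => /or3P[] /eqP ->.
have all_h t : t \in dev_root s :: dev_order s -> forall h, h \in hedges t -> P h.1 h.2.
  rewrite inE => /orP[/eqP ->|]; first exact: Proot.
  move: t; apply: (dev_ok_ind ok Proot) => a b c hl Pba.
  have Pab : P a b by apply: flip Pba; apply/mapP; exists (a, b, c).
  by have [] := step a b c _ Pab; rewrite ?inE ?hl ?orbT.
move=> a b /hasP[[[x y] z] /cov /hasP[[[a' b'] c'] ht hr] /eqP[<- <-]].
by move: hr; rewrite !inE => /or3P[] /eqP[-> -> _];
  [apply: (all_h _ ht (a', b')) | apply: (all_h _ ht (b', c')) | apply: (all_h _ ht (c', a'))];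
  rewrite !inE eqxx ?orbT.
Qed.

End Fixed.

End Develop.

Section Flat.
Variables (R : realType) (s : torus_case) (q : config R).
Local Notation C := R[i].
Let E := develop s q.
Local Notation len2 a b := (dot (row b q - row a q) (row b q - row a q)).

Hypothesis gram_gt0 : forall a b c, (a, b, c) \in corners s ->
  0 < gram (row b q - row a q) (row c q - row a q).

Definition root_len : R := len2 (dev_root s).1.1 (dev_root s).1.2.

Let order_corner t : t \in dev_root s :: dev_order s -> t \in corners s.
Proof. by have /and4P[_ _ /allP H _] := dev_checkP s; exact: H. Qed.

Lemma root_len_gt0 : 0 < root_len.
Proof.
have := order_corner (mem_head _ _); rewrite /root_len.
by case: (dev_root s) => [[a b] c] /gram_gt0/gram_gt0_dot[].
Qed.

Let len2C a b : len2 a b = len2 b a.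
Proof. by rewrite -opprB dotNN. Qed.

Lemma develop_len a b : edge s a b -> nrm2 (E a b) = root_len^-1 * len2 a b.
Proof.
have L0 : 0 < root_len^-1 by rewrite invr_gt0 root_len_gt0.
move: a b; apply: develop_ind => [|a b c ht hab|a b h hba].
- rewrite /E develop_root -/root_len mulVf ?gt_eqF ?root_len_gt0 //.
  by rewrite /nrm2 /= expr0n expr1n addr0.
- have [ebc eca] := develop_placed q ht.
  have [n1 n2 _] := turn_dev (gram_gt0 (order_corner ht)) L0 hab.
  rewrite /E ebc eca; split; first by rewrite n2 opprB addrA subrK.
  by rewrite nrm2N n1 (len2C c a).
- by rewrite /E (develop_tree q h) nrm2N hba len2C.
Qed.

Lemma develop_corner a b c : (a, b, c) \in corners s ->
  E a b + E b c + E c a = 0 /\ 0 < cross (E a b) (- E c a).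
Proof.
have L0 : 0 < root_len^-1 by rewrite invr_gt0 root_len_gt0.
have rot3 x y z : E x y + E y z + E z x = 0 /\ 0 < cross (E x y) (- E z x) ->
    E y z + E z x + E x y = 0 /\ 0 < cross (E y z) (- E x y).
  move=> [h1 h2]; split; first by rewrite addrC addrA.
  have <- : cross (E x y) (- E z x) = cross (E y z) (- E x y); last exact: h2.
  have -> : E z x = - E x y - E y z by apply/subr0_eq; rewrite -h1; ring.
  by case: (E x y) (E y z) => [a1 b1] [c1 d1]; rewrite /cross /=; ring.
have base t : t \in dev_root s :: dev_order s -> let: (a, b, c) := t in
    E a b + E b c + E c a = 0 /\ 0 < cross (E a b) (- E c a).
  case: t => [[x y] z] ht; have [eyz ezx] := develop_placed q ht.
  rewrite /E eyz ezx opprK; split; first by ring.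
  have [hxy _ _] := corner_edges (order_corner ht).
  by have [_ _] := turn_dev (gram_gt0 (order_corner ht)) L0 (develop_len hxy).
have /and3P[_ /allP cov _] := dev_checkP s.
move=> /cov /hasP[[[x y] z] /base ht]; rewrite !inE => /or3P[] /eqP[-> -> ->] //.
  exact: rot3.
exact/rot3/rot3.
Qed.

Lemma develop_neq0 a b : edge s a b -> E a b != 0.
Proof.
by move=> /edge_corner[c /develop_corner[_ /cross_neq0[]]].
Qed.

Lemma develop_turn a b c : (a, b, c) \in corners s ->
  - E c a = E a b * turn (row b q - row a q) (row c q - row a q).
Proof.
move=> h; have [h0 cr] := develop_corner h; have [hab hbc hac] := corner_edges h.
have L0 : 0 < root_len^-1 by rewrite invr_gt0 root_len_gt0.
have [||] // := @turn_unique R (E a b) (- E c a) (row b q - row a q)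
  (row c q - row a q) root_len^-1 L0 (develop_len hab) _ _ cr.
  by rewrite nrm2N develop_len 1?len2C //; exact: edge_sym.
have -> : - E c a - E a b = E b c by apply/subr0_eq; rewrite -[RHS]oppr0 -h0; ring.
by rewrite develop_len // opprB addrA subrK.
Qed.

Let prod_snd (v : 'I_8) (g : 'I_8 -> C) :
  \prod_(f <- corners s | f.1.1 == v) g f.2 = \prod_(n <- link s v) g n.
Proof.
have -> : \prod_(f <- corners s | f.1.1 == v) g f.2 =
    \prod_(p <- [seq (f.1.2, f.2) | f <- corners s & f.1.1 == v]) g p.2.
  by rewrite big_map big_filter.
rewrite (perm_big _ (link_perm s v)) -(big_map snd xpredT) /=.
rewrite -/(unzip2 _) unzip2_zip ?size_rcons; last by rewrite /link; case: (fan s v) => [[]].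
rewrite /link; case: (fan s v) => [[x A] B] /=.
by apply: perm_big; rewrite -cats1 perm_catC.
Qed.

Let prod_fst (v : 'I_8) (g : 'I_8 -> C) :
  \prod_(f <- corners s | f.1.1 == v) g f.1.2 = \prod_(n <- link s v) g n.
Proof.
have -> : \prod_(f <- corners s | f.1.1 == v) g f.1.2 =
    \prod_(p <- [seq (f.1.2, f.2) | f <- corners s & f.1.1 == v]) g p.1.
  by rewrite big_map big_filter.
rewrite (perm_big _ (link_perm s v)) -(big_map fst xpredT) /=.
rewrite -/(unzip1 _) unzip1_zip ?size_rcons //.
by rewrite /link; case: (fan s v) => [[x A] B] /=.
Qed.

Hypothesis flat : forall v, cone_angle s q v = 2 * pi.

(** Within each corner the second side is the first times a turn. Around v the length ratios cancel
    and the angles add up to 2 pi, so the turns multiply to 1. Since [E v n] and [- E n v] may still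
    differ, only the products can be compared. *)
Lemma vertex_relation v :
  \prod_(n <- link s v) - E n v = \prod_(n <- link s v) E v n.
Proof.
rewrite -(prod_snd v (fun n => - E n v)) /=.
pose l n : C := (enorm (row n q - row v q))%:C.
have l0 n : edge s v n -> l n != 0.
  move=> /edge_corner[c /gram_gt0/gram_gt0_dot[h _]].
  by rewrite /l eq_complex /= eqxx andbT gt_eqF // sqrtr_gt0.
have -> : \prod_(f <- corners s | f.1.1 == v) - E f.2 v =
   \prod_(f <- corners s | f.1.1 == v) (E v f.1.2 * (l f.2 / l f.1.2 *
      cis (angle (row f.1.2 q - row v q) (row f.2 q - row v q)))).
  rewrite big_seq_cond [RHS]big_seq_cond.
  apply: eq_bigr => -[[a b] c] /= /andP[hf /eqP av]; subst a.
  rewrite (develop_turn hf); congr (_ * _).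
  by have [-> _] := turn_cis (gram_gt0 hf); rewrite rmorphM /= fmorphV.
rewrite big_split /= prod_fst [X in _ * X = _]big_split /= -cis_sum.
have -> : \sum_(f <- corners s | f.1.1 == v)
     angle (row f.1.2 q - row v q) (row f.2 q - row v q) = 2 * pi by exact: flat.
rewrite cis_2pi mulr1 big_split /= (prod_snd v l) (prod_fst v (fun n => (l n)^-1)).
rewrite -big_split /= [X in _ * X]big1_seq ?mulr1 // => n /andP[_ hn].
by rewrite divff // l0 // edge_link.
Qed.

(** Edges already known to be antisymmetric contribute equal nonzero factors to both sides of
    [vertex_relation] and cancel. *)
Lemma vertex_rest (v u : 'I_8) (P : pred 'I_8) : u \in link s v -> P u ->
  {in link s v, forall n, ~~ P n -> E n v = - E v n} ->
  \prod_(n <- link s v | P n) - E n v = \prod_(n <- link s v | P n) E v n.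
Proof.
move=> hu Pu known; have := vertex_relation v.
rewrite (bigID P) /= [X in _ = X](bigID P) /=.
have -> : \prod_(n <- link s v | ~~ P n) - E n v = \prod_(n <- link s v | ~~ P n) E v n.
  rewrite big_seq_cond [RHS]big_seq_cond; apply: eq_bigr => n /andP[hn Pn].
  by rewrite (known _ hn Pn) opprK.
apply: mulIf; rewrite prodf_seq_neq0; apply/allP => n hn; apply/implyP => _.
by apply: develop_neq0; rewrite edge_link.
Qed.

Let prod1 (r : seq 'I_8) (g : 'I_8 -> C) u : uniq r -> u \in r ->
  \prod_(n <- r | n == u) g n = g u.
Proof.
by move=> ur hu; rewrite -big_filter (@filter_pred1_uniq _ r u ur hu) big_seq1.
Qed.

Let known_sym (known : seq hedge) : (forall h, h \in known -> E h.2 h.1 = - E h.1 h.2) ->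
  forall a b, either known a b -> E b a = - E a b.
Proof.
move=> H a b /orP[/H //|/H /= ->]; by rewrite opprK.
Qed.

(** At the vertex v of a leaf edge (v, u) all other edges are known, so one factor is left on each
    side of the vertex relation. *)
Lemma uncut_antisym h : h \in uncut_edges s -> E h.2 h.1 = - E h.1 h.2.
Proof.
have /and5P[_ _ _ ok _] := dev_checkP s.
have /and5P[_ _ _ _ /andP[_ /and5P[_ /allP un _ _ _]]] := dev_checkP s.
rewrite /uncut_edges; move: h; suff main l known : leaves_ok s known l ->
    (forall h, h \in known -> E h.2 h.1 = - E h.1 h.2) ->
    forall h, h \in known ++ l -> E h.2 h.1 = - E h.1 h.2.
  apply: main ok _ => h /(develop_tree q).
  by rewrite -/E => ->; rewrite opprK.
elim: l known => [|[v u] l IH] known /=; first by rewrite cats0.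
move=> /and3P[hu /allP hk okl] K h.
have Kvu : E u v = - E v u.
  have := @vertex_rest v u (pred1 u) hu (eqxx u).
  rewrite !(prod1 _ (un v (mem_vertices v)) hu) => <- //; first by rewrite opprK.
  move=> n hn; rewrite /= => nu; apply: known_sym K _ _ _.
  by have := hk _ hn; rewrite (negbTE nu).
move=> hh; apply: (IH ((v, u) :: known)) => //.
  by move=> h'; rewrite inE => /orP[/eqP ->|/K].
by move: hh; rewrite !(mem_cat, inE) => /or3P[->|->|->]; rewrite ?orbT.
Qed.

Definition holonomy (t : face) : C := - E t.1.2 t.1.1 / E t.1.1 t.1.2.

(** At x, and then at y, two factors of the vertex relation survive, so the ratio by which
    antisymmetry fails on one cut edge is passed on to the next. It has absolute value 1 because
    both directions of an edge have the same length. *)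
Lemma cut_holonomy t : cut_ok s t -> let r := holonomy t in let: (c, x, y) := t in
  [/\ E x c = - (r * E c x), E y x = - (r * E x y), E c y = - (r * E y c) & nrm2 r = 1].
Proof.
have /and5P[_ _ _ _ /andP[_ /and5P[_ /allP un _ _ _]]] := dev_checkP s.
case: t => [[c x] y] /andP[hx hy] /=; rewrite /holonomy /=.
set r := - E x c / E c x.
have step p v n : cut_vertex_ok s p v n -> E v p = - (r * E p v) -> E n v = - (r * E v n).
  move=> /and4P[hp hn pn /allP H] Er.
  have ep : E p v != 0 by apply/develop_neq0/edge_sym; rewrite edge_link.
  have := @vertex_rest v p (pred2 p n) hp.
  rewrite /= eqxx => /(_ isT).
  have two (g : 'I_8 -> C) : \prod_(m <- link s v | (m == p) || (m == n)) g m = g p * g n.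
    have uv := un v (mem_vertices v).
    rewrite (bigID (pred1 p)) /= (eq_bigl (pred1 p)) => [|m] /=; last first.
      by case: (m == p); rewrite /= ?andbF.
    rewrite prod1 // (eq_bigl (pred1 n)) => [|m] /=; first by rewrite prod1.
    case: (m =P p) => [->|_] /=; last by rewrite andbT.
    by rewrite (negbTE pn).
  rewrite !two => K; have {K}Eq : - E p v * - E n v = E v p * E v n.
    apply: K => m hm; rewrite negb_or => /andP[m1 m2].
    apply: known_sym (uncut_antisym) _ _ _.
    by have := H _ hm; rewrite (negbTE m1) (negbTE m2).
  apply: (mulfI ep); have -> : E p v * E n v = - E p v * - E n v by ring.
  by rewrite Eq Er; ring.
have /and4P[hcx _ _ _] := hx.
have ecx : edge s c x by apply: edge_sym; rewrite edge_link.
have E1 : E x c = - (r * E c x).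
  by rewrite /r divfK ?opprK // develop_neq0.
have E2 := step _ _ _ hx E1; split => //.
  exact: step hy E2.
have /eqP := congr1 (@nrm2 R) E1.
rewrite nrm2N nrm2M (develop_len (edge_sym ecx)) (develop_len ecx) len2C.
rewrite -{1}[_ * len2 _ _]mul1r => /eqP /mulIf H; apply/esym/H.
by rewrite -develop_len // nrm2_eq0 develop_neq0.
Qed.

(* E sums to zero over the half-edges of each face, and the uncut edges cancel:
   what remains is (1 - r1) V1 + (1 - r2) V2 = 0, r1 and r2 being the holonomies. *)
Lemma develop_antisym :
  0 < cross ((1 + holonomy (cut1 s)) * cut_sum E (cut1 s))
            ((1 + holonomy (cut2 s)) * cut_sum E (cut2 s)) ->
  forall a b, edge s a b -> E b a = - E a b.
Proof.
move=> cr; have /and5P[_ _ _ _ /and3P[/andP[ok1 ok2] pm _]] := dev_checkP s.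
set hs := hedges (cut1 s) ++ hedges (cut2 s) ++ uncut_edges s in pm.
have hsP a b : edge s a b -> either hs a b.
  move=> /hasP[f hf /eqP fE]; have : (a, b) \in [seq f.1 | f <- corners s].
    by apply/mapP; exists f.
  rewrite (perm_mem pm) mem_cat => /orP[h|/mapP[[x y] h [-> ->]]];
  by rewrite /either h ?orbT.
have sum0 : \sum_(h <- [seq f.1 | f <- corners s]) E h.1 h.2 = 0.
  rewrite big_map /corners big_flatten big_map big_seq big1 // => -[[a b] c] hf.
  rewrite !big_cons big_nil /= addr0 addrA.
  apply: (develop_corner _).1; apply/flattenP.
  exists [:: (a, b, c); (b, c, a); (c, a, b)]; last by rewrite mem_head.
  by apply/mapP; exists (a, b, c).
move: sum0; rewrite (perm_big _ pm) big_cat /= big_map -big_split /= /hs big_cat /= [X in _ + X]big_cat /=.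
rewrite [X in _ + (_ + X)]big1_seq ?addr0; last first.
  by move=> h /andP[_ /uncut_antisym ->]; rewrite subrr.
have cutE t : cut_ok s t ->
    \sum_(h <- hedges t) (E h.1 h.2 + E h.2 h.1) = (1 - holonomy t) * cut_sum E t.
  move=> /cut_holonomy; case: t => [[c x] y] [e1 e2 e3 _].
  rewrite !big_cons big_nil /= e1 e2 e3; ring.
rewrite !cutE // => E0.
have n1 : nrm2 (holonomy (cut1 s)) = 1.
  by move: (cut_holonomy ok1); case: (cut1 s) => [[? ?] ?] [].
have n2 : nrm2 (holonomy (cut2 s)) = 1.
  by move: (cut_holonomy ok2); case: (cut2 s) => [[? ?] ?] [].
have [r1 r2] := holonomy_trivial n1 n2 E0 cr.
have cutK t : cut_ok s t -> holonomy t = 1 -> forall h, h \in hedges t -> E h.2 h.1 = - E h.1 h.2.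
  move=> /cut_holonomy + r; rewrite r; case: t {r} => [[c x] y] /=; rewrite !mul1r.
  by move=> [e1 e2 e3 _] h; rewrite !inE => /or3P[] /eqP ->.
move=> a b /hsP; apply: known_sym => h.
rewrite mem_cat => /orP[h1|]; first exact: cutK h1.
by rewrite mem_cat => /orP[h1|h1]; [exact: cutK h1 | exact: uncut_antisym].
Qed.

End Flat.

Section DevelopEnv.
Variables (R : realType) (s : torus_case).
Local Notation C := R[i].

Definition period1 (q : config R) : C := cut_sum (develop s q) (cut1 s).
Definition period2 (q : config R) : C := cut_sum (develop s q) (cut2 s).
Definition dev_pos (q : config R) (v : 'I_8) : C :=
  path_sum (develop s q) ord0 (pathto s v) / period1 q.

(** Division by [period1] makes the first period 1. As the development gives the root edge length 1,
    the factor restoring the squared lengths of q is [nrm2 (period1 q) * root_len s q]. *)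
Definition dev_env (q : config R) (k : nat) : R :=
  if (k < 24)%N then coord q k
  else if (k < 38)%N then
    let z := dev_pos q (inord ((k - 22) %/ 2)) in
    if odd k then complex.Im z else complex.Re z
  else nth 0 [:: nrm2 (period1 q) * root_len s q;
               complex.Re (period2 q / period1 q); complex.Im (period2 q / period1 q)]
         (k - 38).

Lemma cfg_dev_env q : cfg (dev_env q) = q.
Proof. by rewrite -[RHS]cfg_coord; apply: cfg_eq => k hk; rewrite /dev_env hk. Qed.

Lemma pos_of_dev_env q v : pos_of (dev_env q) v = dev_pos q v.
Proof.
rewrite /pos_of /re_expr /im_expr; case: eqP => [->|hv].
  rewrite /dev_pos (_ : pathto s o0 = [::]); last by case: (s).
  by rewrite /= mul0r.
have v0 : (0 < v)%N by rewrite lt0n; apply/eqP => e; apply: hv; apply: val_inj.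
have E1 : dev_env q (22 + 2 * v)%N = complex.Re (dev_pos q v).
  rewrite /dev_env; have := ltn_ord v => hv8.
  rewrite (_ : (22 + 2 * v < 24)%N = false); last by lia.
  rewrite (_ : (22 + 2 * v < 38)%N = true); last by lia.
  rewrite (_ : odd (22 + 2 * v) = false); last by lia.
  by rewrite addKn mulKn // inord_val.
have E2 : dev_env q (23 + 2 * v)%N = complex.Im (dev_pos q v).
  rewrite /dev_env; have := ltn_ord v => hv8.
  rewrite (_ : (23 + 2 * v < 24)%N = false); last by lia.
  rewrite (_ : (23 + 2 * v < 38)%N = true); last by lia.
  rewrite (_ : odd (23 + 2 * v) = true); last by lia.
  rewrite (_ : ((23 + 2 * v - 22) %/ 2)%N = v); last by lia.
  by rewrite inord_val.
by apply/eqP; rewrite eq_complex /= E1 E2 !eqxx.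
Qed.

Lemma tau_of_dev_env q : tau_of (dev_env q) = period2 q / period1 q.
Proof. by rewrite /tau_of /dev_env /=; case: (_ / _). Qed.

Section Flat.
Variable q : config R.
Let E := develop s q.
Hypothesis gram_gt0 : forall a b c, (a, b, c) \in corners s ->
  0 < gram (row b q - row a q) (row c q - row a q).
Hypothesis anti : forall a b, edge s a b -> E b a = - E a b.
Hypothesis V10 : period1 q != 0.

Let d (a b : 'I_8) : C := E a b / period1 q - form_of s (dev_env q) a b.

Let d_anti a b : edge s a b -> d b a = - d a b.
Proof. by move=> h; rewrite /d anti // form_of_anti //; ring. Qed.

(** The difference [d] of the two forms is closed and antisymmetric, vanishes on the spanning tree
    and sums to zero along both cuts; [closure_steps] then derives its vanishing edge by edge. *)
Lemma form_of_dev_env a b : edge s a b ->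
  form_of s (dev_env q) a b = E a b / period1 q.
Proof.
move=> hab; apply/eqP; rewrite eq_sym -subr_eq0; apply/eqP; rewrite -/(d a b).
have /and5P[_ _ _ _ /andP[_ /and5P[_ _ cl /allP pe /and5P[/eqP c1 /eqP c2 /eqP c3 /eqP c4 /andP[_ /allP he]]]]] := dev_checkP s.
have known0 h : h \in path_edges s -> edge s h.1 h.2 /\ d h.1 h.2 = 0.
  move=> /pe /andP[/andP[/eqP hp /eqP hw] he']; split => //.
  rewrite /d form_ofE hw /= mul0r !addr0 !pos_of_dev_env /dev_pos hp path_sum_rcons.
  by have [_ ->] := pathtoP s h.1; rewrite -/E mulrDl; ring.
have rotsum (e : 'I_8 -> 'I_8 -> C) t a' b' c' : cut_sum e t = 0 ->
    (a', b', c') \in rotations t -> e a' b' + e b' c' + e c' a' = 0.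
  case: t => [[x y] z] /= h; rewrite !inE => /or3P[] /eqP[-> -> ->]; rewrite -h; ring.
have cut_edges t : t \in [:: cut1 s; cut2 s] -> forall a' b' c',
    (a', b', c') \in rotations t -> [/\ edge s a' b', edge s b' c' & edge s c' a'].
  move=> ht; have he' h : h \in hedges t -> edge s h.1 h.2.
    move=> hh; apply: he; move: ht; rewrite !inE => /orP[] /eqP <-; rewrite !mem_cat hh ?orbT //.
  case: t ht he' => [[x y] z] _ he' a' b' c'.
  have h1 := he' (x, y); have h2 := he' (y, z); have h3 := he' (z, x).
  by rewrite !inE => /or3P[] /eqP[-> -> ->]; split; [apply: h1|apply: h2|apply: h3|
   apply: h2|apply: h3|apply: h1|apply: h3|apply: h1|apply: h2]; rewrite !inE eqxx ?orbT.
have cut_sumE t : cut_sum d t = cut_sum E t / period1 q -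
    ((cut_sum (fun a b => (winding s a b).1) t)%:~R + (cut_sum (fun a b => (winding s a b).2) t)%:~R * tau_of (dev_env q)).
  case: t => [[x y] z]; rewrite /cut_sum /d !form_ofE !rmorphD /=; ring.
have cyc a' b' c' : (a', b', c') \in cycles s ->
    [/\ edge s a' b', edge s b' c', edge s c' a' & d a' b' + d b' c' + d c' a' = 0].
  rewrite !mem_cat => /or3P[h|h|h].
  - have [e1 e2 e3] := corner_edges h; split => //; first exact: edge_sym.
    rewrite (d_anti e3) /d -(form_of_closed _ h).
    have [hE _] := develop_corner gram_gt0 h.
    have hE2 : E a' c' = E a' b' + E b' c'.
      by move: hE; rewrite -/E (anti e3) => /subr0_eq ->.
    by rewrite hE2; ring.
  - have [e1 e2 e3] := cut_edges _ (mem_head _ _) _ _ _ h; split=> //.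
    apply: rotsum h; rewrite cut_sumE c1 c2 -/(period1 q) divff //.
    by rewrite mul0r addr0 subrr.
  - have [e1 e2 e3] := cut_edges (cut2 s) (mem_last _ [:: _]) _ _ _ h; split=> //.
    apply: rotsum h; rewrite cut_sumE c3 c4 -/(period2 q) tau_of_dev_env.
    by rewrite mul1r add0r subrr.
have kE known : (forall h, h \in known -> edge s h.1 h.2 /\ d h.1 h.2 = 0) ->
    forall x y, either known x y -> d x y = 0.
  move=> K x y /orP[/K[] //|/K[/= he' h0]].
  by rewrite (d_anti he') h0 oppr0.
move: known0 cl; elim: (closure_steps s) (path_edges s) => [|[[x y] z] l IH] known K /=.
  move=> /allP cl; have [c hc] := edge_corner hab.
  by apply: kE K _ _ (cl _ hc).
move=> /and4P[k1 k2 hc]; apply: IH => h.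
rewrite inE => /orP[/eqP ->|/K //]; have [e1 e2 e3] := cyc _ _ _ hc.
by rewrite (kE _ K _ _ k1) (kE _ K _ _ k2) !add0r.
Qed.

Lemma len_exprs_dev_env : all (fun t => peval (dev_env q) t == 0) (len_exprs s).
Proof.
rewrite all_map; apply/allP => -[a b] hab.
have he : edge s a b.
  have : all (fun h => edge s h.1 h.2) (edges s) by case: (s); vm_compute.
  by move=> /allP /(_ _ hab).
rewrite -[preim _ _ _]/(peval (dev_env q) (len_expr s (a, b)) == 0).
rewrite len_exprP cfg_dev_env form_of_dev_env //.
have V1n : nrm2 (period1 q) != 0 by rewrite nrm2_eq0.
have -> : dev_env q 38 = nrm2 (period1 q) * root_len s q by [].
have nE : nrm2 (E a b / period1 q) * nrm2 (period1 q) = nrm2 (E a b).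
  by rewrite -nrm2M divfK.
rewrite [nrm2 _ * root_len _ _]mulrC -mulrA [nrm2 (period1 q) * _]mulrC nE.
rewrite develop_len // mulVKf ?subrr //.
by rewrite gt_eqF // root_len_gt0.
Qed.

End Flat.
End DevelopEnv.

(** * Continuity of the development at the base *)

Lemma near_all (T : Type) (F : set_system T) (I : eqType) (s : seq I)
    (P : I -> T -> Prop) : Filter F ->
  (forall i, i \in s -> \forall x \near F, P i x) ->
  \forall x \near F, forall i, i \in s -> P i x.
Proof.
move=> FF; elim: s => [|i s IH] H; first by near=> x.
have H1 := H i (mem_head _ _).
have H2 : \forall x \near F, forall i, i \in s -> P i x.
  by apply: IH => j hj; apply: H; rewrite inE hj orbT.
apply: filterS2 H1 H2 => x Pi Ps j; rewrite inE => /orP[/eqP -> //|].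
exact: Ps.
Unshelve. all: by end_near. Qed.

Section ComplexContinuity.
Variables (R : realType) (T : Type) (F : set_system T).
Context {FF : Filter F}.
Local Notation C := R[i].
Implicit Types (g h : T -> C) (l m : C).

Definition ccvg g l : Prop :=
  complex.Re (g x) @[x --> F] --> complex.Re l /\
  complex.Im (g x) @[x --> F] --> complex.Im l.

Lemma ccvg_cst l : ccvg (fun _ => l) l.
Proof. by split; exact: cvg_cst. Qed.

Lemma ccvg_opp g l : ccvg g l -> ccvg (fun x => - g x) (- l).
Proof.
move=> [h1 h2]; split.
  rewrite (_ : (fun x => _) = fun x => - complex.Re (g x)); last first.
    by apply/funext => x; case: (g x).
  by rewrite (_ : complex.Re (- l) = - complex.Re l); [exact: cvgN | case: (l)].
rewrite (_ : (fun x => _) = fun x => - complex.Im (g x)); last first.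
  by apply/funext => x; case: (g x).
by rewrite (_ : complex.Im (- l) = - complex.Im l); [exact: cvgN | case: (l)].
Qed.

Lemma ccvg_add g h l m : ccvg g l -> ccvg h m -> ccvg (fun x => g x + h x) (l + m).
Proof.
move=> [h1 h2] [h3 h4]; split.
  rewrite (_ : (fun x => _) = fun x => complex.Re (g x) + complex.Re (h x)); last first.
    by apply/funext => x; case: (g x) (h x) => [? ?] [].
  rewrite (_ : complex.Re (l + m) = complex.Re l + complex.Re m); first exact: cvgD.
  by case: (l) (m) => [? ?] [].
rewrite (_ : (fun x => _) = fun x => complex.Im (g x) + complex.Im (h x)); last first.
  by apply/funext => x; case: (g x) (h x) => [? ?] [].
rewrite (_ : complex.Im (l + m) = complex.Im l + complex.Im m); first exact: cvgD.
by case: (l) (m) => [? ?] [].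
Qed.

Lemma ccvg_mul g h l m : ccvg g l -> ccvg h m -> ccvg (fun x => g x * h x) (l * m).
Proof.
move=> [h1 h2] [h3 h4]; split.
  rewrite (_ : (fun x => _) = fun x => complex.Re (g x) * complex.Re (h x) -
     complex.Im (g x) * complex.Im (h x)); last first.
    by apply/funext => x; case: (g x) (h x) => [? ?] [].
  rewrite (_ : complex.Re (l * m) = complex.Re l * complex.Re m - complex.Im l * complex.Im m).
    by apply: cvgB; exact: cvgM.
  by case: (l) (m) => [? ?] [].
rewrite (_ : (fun x => _) = fun x => complex.Re (g x) * complex.Im (h x) +
     complex.Im (g x) * complex.Re (h x)); last first.
  by apply/funext => x; case: (g x) (h x) => [? ?] [].
rewrite (_ : complex.Im (l * m) = complex.Re l * complex.Im m + complex.Im l * complex.Re m).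
  by apply: cvgD; exact: cvgM.
by case: (l) (m) => [? ?] [].
Qed.

Lemma cvg_nrm2 g l : ccvg g l -> nrm2 (g x) @[x --> F] --> nrm2 l.
Proof. by move=> [h1 h2]; rewrite /nrm2; apply: cvgD; exact: cvgM. Qed.

Lemma ccvg_inv g l : l != 0 -> ccvg g l -> ccvg (fun x => (g x)^-1) l^-1.
Proof.
move=> l0 gl; have [h1 h2] := gl; have n0 : nrm2 l != 0 by rewrite nrm2_eq0.
have hn : (nrm2 (g x))^-1 @[x --> F] --> (nrm2 l)^-1.
  by apply: cvgV => //; exact: cvg_nrm2.
split.
  rewrite (_ : (fun x => _) = fun x => complex.Re (g x) * (nrm2 (g x))^-1); last first.
    by apply/funext => x; case: (g x).
  by rewrite (_ : complex.Re l^-1 = complex.Re l * (nrm2 l)^-1); [exact: cvgM h1 hn | case: (l)].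
rewrite (_ : (fun x => _) = fun x => - (complex.Im (g x) * (nrm2 (g x))^-1)); last first.
  by apply/funext => x; case: (g x).
rewrite (_ : complex.Im l^-1 = - (complex.Im l * (nrm2 l)^-1)); last by case: (l).
by apply: cvgN; exact: cvgM h2 hn.
Qed.

Lemma cvg_cross g h l m : ccvg g l -> ccvg h m ->
  cross (g x) (h x) @[x --> F] --> cross l m.
Proof.
by move=> [h1 h2] [h3 h4]; rewrite /cross; apply: cvgB; exact: cvgM.
Qed.

Lemma ccvg_path_sum (I : Type) (e : T -> I -> I -> C) (k : I -> I -> C) :
  (forall a b, ccvg (fun x => e x a b) (k a b)) ->
  forall p a, ccvg (fun x => path_sum (e x) a p) (path_sum k a p).
Proof.
move=> ek; elim=> [|b p IH] a /=; first exact: ccvg_cst.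
exact: ccvg_add.
Qed.

End ComplexContinuity.

Section DevelopContinuity.
Variables (R : realType) (s : torus_case).
Local Notation C := R[i].
Local Notation B := (base R s).
Let FB : Filter (nbhs B). Proof. exact: nbhs_filter. Qed.
Let f0 := base_env R s.
Let e := form_of s f0.

Let pos0 : all (fun t => 0 < peval f0 t) (pos_exprs s).
Proof.
by have [d d0 H] := pos_exprs_near R s; apply: H => k _; rewrite subrr normr0.
Qed.

Let form0 : flat_form s B (f0 38)^-1 e.
Proof. by rewrite -cfg_base; apply: flat_form_of => //; exact: ift_check_zero (ift_check1 s). Qed.

Let eroot := e (dev_root s).1.1 (dev_root s).1.2.

(** The form given by the certified base values obeys the same recursion as the development, because
    [turn] determines the third vertex of each face; so they differ only by the value at the root
    edge. *)
Lemma develop_base a b : edge s a b -> develop s B a b * eroot = e a b.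
Proof.
move: a b; apply: develop_ind => [|a b c ht hab|a b h hba].
- by rewrite develop_root mul1r.
- have hc : (a, b, c) \in corners s.
    by have /and4P[_ _ /allP H _] := dev_checkP s; exact: H.
  have [ebc eca] := develop_placed B ht; have [hT _ _] := ff_turn form0 hc.
  have [_ _ hac] := corner_edges hc.
  have hT' : e a b * turn_at B (a, b, c) = e a c by rewrite hT.
  rewrite ebc eca mulNr mulrBl mulrAC hab -/(e a b) hT'; split.
    by rewrite -(ff_closed form0 hc) -/(e a b) addrAC subrr add0r.
  by rewrite (ff_anti form0 hac).
- rewrite (develop_tree B h) mulNr hba.
  have hab : edge s a b.
    have /and5P[_ _ _ _ /andP[_ /and5P[_ _ _ _ /and5P[_ _ _ _ /andP[_ /allP H]]]]] := dev_checkP s.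
    by apply: (H (a, b)); rewrite !mem_cat h !orbT.
  by rewrite (ff_anti form0 hab) opprK.
Qed.

Lemma gram_base a b c : (a, b, c) \in corners s ->
  0 < gram (row b B - row a B) (row c B - row a B).
Proof. by move=> h; have [_ ? _] := ff_turn form0 h. Qed.

Lemma cvg_dot_row (a b c d : 'I_8) :
  dot (row b q - row a q) (row d q - row c q) @[q --> B] -->
  dot (row b B - row a B) (row d B - row c B).
Proof.
have dE (q : config R) : dot (row b q - row a q) (row d q - row c q) =
    \sum_(k < 3) (q b k - q a k) * (q d k - q c k).
  by apply: eq_bigr => k _; rewrite !mxE.
rewrite dE (_ : (fun q => _) = fun q : config R => \sum_(k < 3) (q b k - q a k) * (q d k - q c k)).
  apply: (@cvg_bigsum R _ (nbhs B)) => k.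
  by apply: cvgM; apply: cvgB; exact: coord_continuous.
by apply/funext => q; exact: dE.
Qed.

Lemma cvg_gram_row (a b c : 'I_8) :
  gram (row b q - row a q) (row c q - row a q) @[q --> B] -->
  gram (row b B - row a B) (row c B - row a B).
Proof.
exact: (cvgB (cvgM (@cvg_dot_row a b a b) (@cvg_dot_row a c a c))
  (cvgM (@cvg_dot_row a b a c) (@cvg_dot_row a b a c))).
Qed.

Lemma ccvg_turn_at a b c : (a, b, c) \in corners s ->
  ccvg (nbhs B) (fun q => turn_at q (a, b, c)) (turn_at B (a, b, c)).
Proof.
move=> h; have [p0 _] := gram_gt0_dot (gram_base h).
have inv0 : (dot (row b q - row a q) (row b q - row a q))^-1 @[q --> B] -->
    (dot (row b B - row a B) (row b B - row a B))^-1.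
  by apply: (cvgV _ (@cvg_dot_row a b a b)); rewrite gt_eqF.
have sg : Num.sqrt (gram (row b q - row a q) (row c q - row a q)) @[q --> B] -->
    Num.sqrt (gram (row b B - row a B) (row c B - row a B)).
  exact: (cvg_comp _ _ (@cvg_gram_row a b c) (@sqrt_continuous R _)).
by split; [exact: (cvgM (@cvg_dot_row a b a c) inv0) | exact: (cvgM sg inv0)].
Qed.

Lemma ccvg_place (E : config R -> 'I_8 -> 'I_8 -> C) t : t \in corners s ->
  (forall a b, ccvg (nbhs B) (fun q => E q a b) (E B a b)) ->
  forall a b, ccvg (nbhs B) (fun q => place q (E q) t a b) (place B (E B) t a b).
Proof.
case: t => [[a b] c] h cE x y; rewrite /place.
have hw : ccvg (nbhs B) (fun q => - E q b a * turn_at q (a, b, c)) (- E B b a * turn_at B (a, b, c)).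
  by apply: ccvg_mul; [exact: ccvg_opp | exact: ccvg_turn_at].
case: ifP => _; first exact: ccvg_opp.
case: ifP => _; first by apply: ccvg_add => //; apply/ccvg_opp/ccvg_opp.
by case: ifP => _ //; exact: ccvg_opp.
Qed.

Lemma ccvg_develop a b : ccvg (nbhs B) (fun q => develop s q a b) (develop s B a b).
Proof.
have /and4P[_ _ /allP H _] := dev_checkP s.
rewrite /develop.
suff main l (E : config R -> 'I_8 -> 'I_8 -> C) : {subset l <= corners s} ->
    (forall a b, ccvg (nbhs B) (fun q => E q a b) (E B a b)) ->
    forall a b, ccvg (nbhs B) (fun q => foldl (place q) (E q) l a b) (foldl (place B) (E B) l a b).
  apply: (main (dev_order s) (fun q => place q (fun _ _ => -1) (dev_root s))).
    by move=> t ht; apply: H; rewrite inE ht orbT.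
  apply: (ccvg_place (E := fun _ _ _ => -1)); first by apply: H; rewrite mem_head.
  by move=> *; exact: ccvg_cst.
elim: l E => [|t l IH] E sub cE //=.
apply: (IH (fun q => place q (E q) t)).
  by move=> u hu; apply: sub; rewrite inE hu orbT.
by apply: ccvg_place => //; apply: sub; rewrite mem_head.
Qed.

Let er0 : eroot != 0.
Proof.
have hr : edge s (dev_root s).1.1 (dev_root s).1.2 by case: (s); vm_compute.
have [c hc] := edge_corner hr.
exact: (cross_neq0 (ff_cross form0 hc)).1.
Qed.

Let cut_edge t h : t \in [:: cut1 s; cut2 s] -> h \in hedges t -> edge s h.1 h.2.
Proof.
have /and5P[_ _ _ _ /andP[_ /and5P[_ _ _ _ /and5P[_ _ _ _ /andP[_ /allP H]]]]] := dev_checkP s.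
by move=> ht hh; apply: H; move: ht; rewrite !inE => /orP[] /eqP <-; rewrite !mem_cat hh ?orbT.
Qed.

Lemma develop_base_neq0 a b : edge s a b -> develop s B a b != 0.
Proof.
move=> he; have [c hc] := edge_corner he.
have e0 := (cross_neq0 (ff_cross form0 hc)).1.
by apply/eqP => E; move: e0; rewrite -/(e a b) -develop_base // E mul0r eqxx.
Qed.

Let holonomy_base t : t \in [:: cut1 s; cut2 s] -> holonomy s B t = 1.
Proof.
move=> ht; rewrite /holonomy.
have he : edge s t.1.1 t.1.2.
  by apply: (cut_edge (h := (t.1.1, t.1.2)) ht); case: (t) => [[a b] c]; rewrite mem_head.
have h1 := develop_base he; have h2 := develop_base (edge_sym he).
have d0 := develop_base_neq0 he.
apply: (mulIf d0); rewrite divfK // mul1r; apply: (mulIf er0).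
by rewrite mulNr h1 h2 (ff_anti form0 he) opprK.
Qed.

Let cut_sum_base t : t \in [:: cut1 s; cut2 s] -> cut_sum (develop s B) t * eroot = cut_sum e t.
Proof.
move=> ht; have := cut_edge ht; case: t ht => [[a b] c] _ he.
rewrite /cut_sum !mulrDl !develop_base //.
- by apply: (he (c, a)); rewrite !inE eqxx !orbT.
- by apply: (he (b, c)); rewrite !inE eqxx !orbT.
- by apply: (he (a, b)); rewrite mem_head.
Qed.

Let cut_sum_form t : cut_sum e t =
    (cut_sum (fun a b => (winding s a b).1) t)%:~R +
    (cut_sum (fun a b => (winding s a b).2) t)%:~R * tau_of f0.
Proof. case: t => [[x y] z]; rewrite /cut_sum /e !form_ofE !rmorphD /=; ring. Qed.

Let period1_base : period1 s B * eroot = 1.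
Proof.
have /and5P[_ _ _ _ /andP[_ /and5P[_ _ _ _ /and5P[/eqP c1 /eqP c2 _ _ _]]]] := dev_checkP s.
rewrite /period1 cut_sum_base ?mem_head // cut_sum_form c1 c2.
by rewrite mul0r addr0.
Qed.

Let period2_base : period2 s B * eroot = tau_of f0.
Proof.
have /and5P[_ _ _ _ /andP[_ /and5P[_ _ _ _ /and5P[_ _ /eqP c1 /eqP c2 _]]]] := dev_checkP s.
rewrite /period2 cut_sum_base ?inE ?eqxx ?orbT // cut_sum_form c1 c2.
by rewrite mul1r add0r.
Qed.

Let V10 : period1 s B != 0.
Proof. by apply/eqP => E; have := period1_base; rewrite E mul0r => /esym/eqP; rewrite oner_eq0. Qed.

Let erootE : eroot = (period1 s B)^-1.
Proof. by apply: (mulfI V10); rewrite period1_base divff. Qed.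

Lemma dev_env_base k : (24 <= k < 41)%N -> dev_env s B k = f0 k.
Proof.
move=> hk.
have posE v : dev_pos s B v = pos_of f0 v.
  rewrite /dev_pos -erootE.
  have /and5P[_ _ _ _ /andP[_ /and5P[_ _ _ _ /and5P[_ _ _ _ /andP[/allP H _]]]]] := dev_checkP s.
  have [hp lp] := pathtoP s v.
  have -> : path_sum (develop s B) ord0 (pathto s v) * eroot = path_sum e ord0 (pathto s v).
    elim: (pathto s v) (ord0) hp => [|b p IH] a /=; first by rewrite mul0r.
    by move=> /andP[hab hpb]; rewrite mulrDl develop_base // IH.
  have o0E : ord0 = o0 by exact: val_inj.
  rewrite form_of_path lp o0E (eqP (H v (mem_vertices v))) /= mul0r !addr0.
  rewrite [pos_of f0 o0](_ : _ = 0) ?subr0 //.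
have [k38|k38] := ltnP k 38.
  have hk' : (24 <= k)%N by case/andP: hk.
  pose v : 'I_8 := inord ((k - 22) %/ 2).
  have vE : v = ((k - 22) %/ 2)%N :> nat by rewrite inordK //; lia.
  have v0 : (v == o0) = false by rewrite -val_eqE /= vE; lia.
  rewrite /dev_env ltnNge hk' /= k38 posE -/v /pos_of /re_expr /im_expr v0.
  rewrite [(2 * v)%N]mulnC vE; case: ifP => ok.
    by rewrite [peval _ _]/= [complex.Im _]/=; congr f0; lia.
  by rewrite [peval _ _]/= [complex.Re _]/=; congr f0; lia.
have tE : period2 s B / period1 s B = tau_of f0 by rewrite -erootE.
have k24 : (k < 24)%N = false by clear -hk; lia.
rewrite /dev_env k24 [(k < 38)%N]ltnNge k38 /= tE; have [->|[->|->]] : k = 38 \/ k = 39 \/ k = 40 by clear -hk k38; lia.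
- rewrite /=.
  have hr : edge s (dev_root s).1.1 (dev_root s).1.2 by case: (s); vm_compute.
  have l0 := pos_f38 pos0.
  have : nrm2 eroot = (f0 38)^-1 * root_len s B.
    by rewrite /eroot (ff_len form0 hr).
  have n1 : nrm2 (period1 s B) * nrm2 eroot = 1.
    by rewrite -nrm2M period1_base /nrm2 /= expr0n expr1n addr0.
  move=> E; rewrite -[RHS]mulr1 -n1 E; field; by rewrite gt_eqF.
- by [].
- by [].
Qed.

Lemma cvg_dev_env k : (24 <= k < 41)%N -> dev_env s q k @[q --> B] --> dev_env s B k.
Proof.
move=> hk.
have cV1 : ccvg (nbhs B) (period1 s) (period1 s B).
  rewrite /period1; case: (cut1 s) => [[x y] z].
  by apply: ccvg_add; [apply: ccvg_add|]; exact: ccvg_develop.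
have cV2 : ccvg (nbhs B) (period2 s) (period2 s B).
  rewrite /period2; case: (cut2 s) => [[x y] z].
  by apply: ccvg_add; [apply: ccvg_add|]; exact: ccvg_develop.
have cV1i : ccvg (nbhs B) (fun q => (period1 s q)^-1) (period1 s B)^-1.
  exact: ccvg_inv V10 cV1.
have cpos v : ccvg (nbhs B) (fun q => dev_pos s q v) (dev_pos s B v).
  apply: ccvg_mul; last exact: cV1i.
  by apply: (ccvg_path_sum (e := develop s)); exact: ccvg_develop.
have [cr ci] : ccvg (nbhs B) (fun q => period2 s q / period1 s q) (period2 s B / period1 s B).
  exact: ccvg_mul cV2 cV1i.
have k24 : (k < 24)%N = false by clear -hk; lia.
have cl : nrm2 (period1 s q) * root_len s q @[q --> B] --> nrm2 (period1 s B) * root_len s B.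
  by have h1 := @cvg_nrm2 _ _ _ FB _ _ cV1; have := cvgM h1 (@cvg_dot_row (dev_root s).1.1 (dev_root s).1.2 (dev_root s).1.1 (dev_root s).1.2); exact.
rewrite /dev_env k24; have [k38|k38] := ltnP k 38.
  by case: (odd k); [exact: (cpos _).2 | exact: (cpos _).1].
have [->|[->|->]] : k = 38 \/ k = 39 \/ k = 40 by clear -hk k38; lia.
- exact: cl.
- exact: cr.
- exact: ci.
Qed.

(** At the base both holonomies are 1 and the ratio of the periods has positive imaginary part.
    Hence the cross product required by [develop_antisym] is positive there and, by continuity, at
    nearby configurations. *)
Lemma dev_env_near d : 0 < d -> \forall q \near B, flat_locus s q ->
  [/\ cfg (dev_env s q) = q, all (fun t => peval (dev_env s q) t == 0) (len_exprs s)
    & forall k, (24 <= k < 41)%N -> `|dev_env s q k - f0 k| < d].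
Proof.
move=> d0.
have N1 : \forall q \near B, forall t, t \in corners s ->
    0 < gram (row t.1.2 q - row t.1.1 q) (row t.2 q - row t.1.1 q).
  apply: (near_all FB) => -[[a b] c] h.
  by have := @cvg_gram_row a b c; move=> /cvgr_gt /(_ _ (gram_base h)).
have cV t : t \in [:: cut1 s; cut2 s] ->
    ccvg (nbhs B) (fun q => (1 + holonomy s q t) * cut_sum (develop s q) t)
      ((1 + holonomy s B t) * cut_sum (develop s B) t).
  move=> ht; have d0' : develop s B t.1.1 t.1.2 != 0.
    apply: develop_base_neq0.
    by apply: (cut_edge (h := (t.1.1, t.1.2)) ht); case: (t) => [[a b] c]; rewrite mem_head.
  apply: ccvg_mul.
    apply: ccvg_add; first exact: ccvg_cst.
    by apply: ccvg_mul; [exact/ccvg_opp/ccvg_develop | exact/ccvg_inv/ccvg_develop].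
  case: (t) => [[x y] z].
  by apply: ccvg_add; [apply: ccvg_add|]; exact: ccvg_develop.
have N2 : \forall q \near B, 0 <
   cross ((1 + holonomy s q (cut1 s)) * cut_sum (develop s q) (cut1 s))
            ((1 + holonomy s q (cut2 s)) * cut_sum (develop s q) (cut2 s)).
  have h1 := mem_head (cut1 s) [:: cut2 s]; have h2 := mem_last (cut1 s) [:: cut2 s].
  have := @cvg_cross _ _ _ FB _ _ _ _ (cV _ h1) (cV _ h2); move=> /cvgr_gt; apply.
  rewrite !holonomy_base // -/(period1 s B) -/(period2 s B).
  have -> : period2 s B = tau_of f0 * period1 s B by rewrite -period2_base erootE divfK.
  have : 0 < nrm2 (period1 s B) by rewrite lt_def nrm2_eq0 V10 nrm2_ge0.
  have := pos_f40 pos0; rewrite /tau_of; case: (period1 s B) => x y.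
  rewrite /cross /nrm2 /= => p40 n0.
  have := mulr_gt0 p40 n0; nra.
have N3 : \forall q \near B, forall k, k \in iota 24 17 -> `|dev_env s q k - f0 k| < d.
  apply: (near_all FB) => k; rewrite mem_iota => hk.
  have hk' : (24 <= k < 41)%N by clear -hk; lia.
  have /cvgrPdist_lt /(_ _ d0) := cvg_dev_env hk'.
  by apply: filterS => q; rewrite dev_env_base // distrC.
near=> q => -[nd flat].
have g0 : forall a b c, (a, b, c) \in corners s -> 0 < gram (row b q - row a q) (row c q - row a q).
  by move=> a b c h; apply: (near N1 q _ (a, b, c)).
have cr : 0 < cross ((1 + holonomy s q (cut1 s)) * cut_sum (develop s q) (cut1 s))
            ((1 + holonomy s q (cut2 s)) * cut_sum (develop s q) (cut2 s)) by near: q.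
have anti := develop_antisym g0 flat cr.
have V1q : period1 s q != 0.
  by have [] := cross_neq0 cr; rewrite mulf_eq0 negb_or => /andP[].
split; [exact: cfg_dev_env | exact: len_exprs_dev_env |].
move=> k hk; apply: (near N3 q) => //; clear -hk; rewrite mem_iota; lia.
Unshelve. all: by end_near. Qed.

End DevelopContinuity.

(** * Embeddedness *)

Section Separators.
Local Open Scope int_scope.

(* Linear forms which are smaller on the first than on the second face of the
   corresponding pair of far_pairs, apart from a common vertex. *)
Definition separators (s : torus_case) : seq (int * int * int) :=
  match s with
  | Square => [:: (0, -1, 0); (2, -1, 2); (2, -1, 2); (1, -1, 0); (2, 0, 1); (4, -2, 3);
   (3, 1, 2); (7, -3, 6); (5, -1, 4); (2, -2, 1); (4, -2, 3); (4, -2, 3);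
   (0, 0, 1); (1, 0, 1); (2, -1, 2); (13, -5, 11); (2, 0, 1); (13, -5, 11);
   (1, 1, 1); (7, -3, 6); (1, 1, 1); (3, -2, 2); (6, -3, 5); (6, -3, 5);
   (-1, 0, -1); (0, 0, -1); (0, 1, -3); (1, -1, -1); (1, 0, -1); (0, 0, -1);
   (0, 1, -3); (0, 1, -1); (1, 0, -1); (0, 0, -1); (0, 0, -1); (1, 1, 1);
   (6, -2, 5); (1, 0, 0); (1, 0, 0); (5, -2, 4); (1, 1, 1); (6, -2, 5);
   (1, 1, 0); (1, 0, 0); (1, 1, -1); (-12, 6, -13); (1, -2, -1); (25, 5, 8);
   (-7, 3, -8); (1, 1, 1); (-12, 6, -13); (0, 1, 0); (-7, 3, -8); (-3, 2, -4);
   (-14, 7, -15); (1, -1, 0); (15, 3, 5); (-10, 5, -11); (1, 1, 1); (0, 1, 0);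
   (1, -1, 0); (-10, 5, -11); (-3, 2, -4); (1, -1, 0); (2, 0, 1); (3, 1, 2);
   (4, 0, 3); (4, -3, 2); (4, -2, 3); (4, -2, 3); (-1, 1, 0); (-1, 1, 1);
   (-1, 1, 0); (0, 1, 0); (-2, 1, 0); (-3, 2, 1); (-15, -3, -5); (-16, -3, -5);
   (-25, -5, -8); (-3, 0, -1); (-16, -3, -5); (1, 0, 2); (10, -5, 11); (7, -3, 8);
   (4, -3, 2); (4, -2, 3); (-4, -2, -3); (0, -1, -1); (-1, 0, -2); (0, 0, -1);
   (1, -1, 0); (-10, 5, -11); (-3, 2, -4); (0, -1, 0); (-7, 3, -8); (-2, 1, 0)]
  | Hexagonal => [:: (4, 1, 1); (19, 5, 4); (1, 0, -1); (1, 0, 0); (2, 4, 1); (5, 1, 1);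
   (2, -1, 0); (5, 1, 1); (1, 0, 0); (5, 1, 1); (1, 0, 0); (5, 1, 1);
   (3, 0, 2); (-20, -6, -5); (1, 0, -1); (2, 1, 0); (2, 4, 1); (2, 0, 1);
   (7, -5, 2); (2, 0, 1); (1, 0, 0); (36, 9, 7); (1, 0, 0); (36, 9, 7);
   (-2, -1, -1); (-5, 1, -4); (0, 0, -1); (1, 3, 0); (0, 1, 0); (11, -8, 3);
   (9, 1, 8); (32, -23, 8); (-5, 1, -4); (32, -23, 8); (-6, 5, -5); (-4, -1, -1);
   (-17, 5, -14); (0, 0, -1); (1, 3, 0); (0, 1, 0); (17, 1, 14); (7, -5, 2);
   (6, 0, 5); (-17, 5, -14); (7, -5, 2); (-6, 4, -5); (19, 5, 4); (1, 1, 0);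
   (0, 2, 1); (2, 1, 1); (0, 0, 1); (4, 1, 1); (9, 2, 2); (9, 2, 2);
   (9, 2, 2); (1, 0, -1); (2, 1, 0); (2, 0, 1); (7, -5, 2); (0, -1, 2);
   (1, 0, 0); (1, 0, 0); (52, 13, 10); (-1, 0, 1); (0, 0, 1); (-1, -1, 1);
   (0, 0, 1); (0, 0, 1); (-1, -1, 1); (-1, -1, 1); (-1, -3, 0); (-1, -2, 1);
   (-2, -1, 1); (-1, -2, 0); (-1, -2, 1); (-1, -3, 0); (0, -1, 0); (1, -2, 0);
   (1, -1, 0); (0, -1, 0); (1, -2, 0); (0, -1, 0); (11, -8, 3); (32, -23, 8);
   (-2, 0, -1); (32, -23, 8); (-21, 16, -6); (-7, 5, -2); (-2, 2, -1); (2, 1, -2);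
   (0, 1, -2); (2, 1, -2); (0, 1, -1); (-2, 1, -1); (-3, 2, -2); (-2, 2, -1)]
  end.

End Separators.

Definition face_pairs s : seq (face * face) :=
  let fs := faces s in
  flatten [seq [seq (nth (o0, o0, o0) fs i, g) | g <- drop i.+1 fs] | i <- iota 0 16].
Definition fverts (f : face) : seq 'I_8 := let: (a, b, c) := f in [:: a; b; c].
Definition meet (p : face * face) : seq 'I_8 := [seq v <- fverts p.1 | v \in fverts p.2].
Definition far_pairs s := [seq p <- face_pairs s | (size (meet p) <= 1)%N].
Definition edge_pairs s := [seq p <- face_pairs s | (1 < size (meet p))%N].

Definition pdiff (x y : 'I_8) (k : 'I_3) : pexpr := psub (PVar (qvar y k)) (PVar (qvar x k)).
Definition sep_expr (u : int * int * int) (x y : 'I_8) : pexpr :=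
  PAdd (PAdd (PMul (PC u.1.1) (pdiff x y c0)) (PMul (PC u.1.2) (pdiff x y c1)))
       (PMul (PC u.2) (pdiff x y c2)).
Definition sep_exprs (p : face * face) (u : int * int * int) : seq pexpr :=
  flatten [seq [seq sep_expr u x y | y <- fverts p.2 & x != y] | x <- fverts p.1].
Definition apexes (p : face * face) : seq 'I_8 := [seq v <- fverts p.2 | v \notin fverts p.1].
Definition det_expr (a b c d : 'I_8) : pexpr :=
  let m i j := psub (PMul (pdiff a c i) (pdiff a d j)) (PMul (pdiff a c j) (pdiff a d i)) in
  PAdd (PAdd (PMul (pdiff a b c0) (m c1 c2)) (PMul (pdiff a b c1) (m c2 c0)))
       (PMul (pdiff a b c2) (m c0 c1)).
(** The determinants of the edge pairs may have either sign; squaring turns their nonvanishing into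
    a strict inequality like the others. *)
Definition embed_exprs s : seq pexpr :=
  flatten [seq sep_exprs pu.1 pu.2 | pu <- zip (far_pairs s) (separators s)] ++
  [seq psqr (let: (a, b, c) := p.1 in det_expr a b c (head o0 (apexes p))) | p <- edge_pairs s].

(** The base with its zero heights replaced by the speeds, that is, the limit of the curve after
    division of the heights by t. *)
Definition lift_s3 s (k : nat) : qs3 :=
  if (k %% 3 == 2)%N && (k < 24)%N then
    nth (s3int 0) match s with
        | Square => [:: mk3 3 0 13; mk3 (-3) 0 8; mk3 (-3) 0 7; mk3 12 0 13;
                        mk3 1 0 1; mk3 (-1) 0 1; mk3 1 0 1; mk3 0 0 1]
        | Hexagonal => [:: mk3 1 0 2; mk3 (-1) 0 1; mk3 6 0 17; mk3 (-7) 0 34;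
                        mk3 (-33) 0 47; mk3 (-1) 0 1; mk3 19 0 41; mk3 1 0 1]
        end (k %/ 3)
  else base_s3 s k.

Lemma embed_exprs_check s :
  all (fun t => vars_in (iota 0 41) t && s3pos (s3eval (lift_s3 s) t)) (embed_exprs s).
Proof. by case: s; vm_compute. Qed.

(** The third alternative also covers two points of one and the same face, whose vertices lie among
    the four vertices of some edge pair. *)
Lemma embed_pairs_check s : let fp := far_pairs s in let ep := edge_pairs s in
  [/\ size fp = size (separators s),
      all (fun f => all (fun g => [|| (f, g) \in fp, (g, f) \in fp |
           has (fun p => all (fun v => v \in head o0 (apexes p) :: fverts p.1)
              (fverts f ++ fverts g)) ep]) (faces s)) (faces s) &
      all (fun p => uniq (head o0 (apexes p) :: fverts p.1)) ep].
Proof. by case: s; vm_compute; split. Qed.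

Section Embedded.
Variables (R : realType) (s : torus_case).

(** The double sum of l_x m_y (phi y - phi x) has nonnegative terms and vanishes. Thus a vertex
    carrying l and a vertex carrying m always coincide, and both points are that single vertex. *)
Lemma separated_eq (phi : 'I_8 -> R) (A B : seq 'I_8) (l m : 'rV[R]_8) :
  (forall v, 0 <= l 0 v) -> \sum_v l 0 v = 1 -> (forall v, l 0 v != 0 -> v \in A) ->
  (forall v, 0 <= m 0 v) -> \sum_v m 0 v = 1 -> (forall v, m 0 v != 0 -> v \in B) ->
  (forall x y, x \in A -> y \in B -> x != y -> phi x < phi y) ->
  \sum_v l 0 v * phi v = \sum_v m 0 v * phi v -> l = m.
Proof.
move=> l0 l1 lA m0 m1 mB sep E.
have term0 x y : 0 <= l 0 x * m 0 y * (phi y - phi x).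
  have [->|/lA xA] := eqVneq (l 0 x) 0; first by rewrite !mul0r.
  have [->|/mB yB] := eqVneq (m 0 y) 0; first by rewrite mulr0 mul0r.
  have [->|xy] := eqVneq x y; first by rewrite subrr mulr0.
  by rewrite !mulr_ge0 // subr_ge0 ltW // sep.
have sum0 : \sum_x \sum_y l 0 x * m 0 y * (phi y - phi x) = 0.
  transitivity (\sum_x (l 0 x * (\sum_y m 0 y * phi y) - l 0 x * phi x)).
    apply: eq_bigr => x _; rewrite mulr_sumr -[l 0 x * phi x]mulr1 -m1 mulr_sumr -sumrB.
    by apply: eq_bigr => y _; ring.
  by rewrite sumrB -mulr_suml l1 mul1r E subrr.
have supp x y : l 0 x != 0 -> m 0 y != 0 -> x = y.
  move=> lx my; apply/eqP; apply: contraT => xy.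
  have t0 : l 0 x * m 0 y * (phi y - phi x) = 0.
    have row0 : \sum_y l 0 x * m 0 y * (phi y - phi x) = 0.
      by apply: (psumr_eq0P _ sum0) => // z _; apply: sumr_ge0 => y' _.
    by apply: (psumr_eq0P _ row0) => // y' _.
  have : 0 < l 0 x * m 0 y * (phi y - phi x).
    by rewrite !mulr_gt0 ?lt_def ?lx ?my ?l0 ?m0 //= -lt_def subr_gt0 sep ?lA ?mB.
  by rewrite t0 ltxx.
have ex (k : 'rV[R]_8) : \sum_v k 0 v = 1 -> exists v, k 0 v != 0.
  move=> k1; apply/existsP; apply: contraT; rewrite negb_exists => /forallP h.
  have := k1; rewrite big1 => [|v _]; first by move/esym/eqP; rewrite oner_eq0.
  by apply/eqP; have := h v; rewrite negbK.
have [x lx] := ex l l1; have [y my] := ex m m1; have xy := supp x y lx my.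
have pt (k : 'rV[R]_8) v : \sum_v k 0 v = 1 -> (forall w, k 0 w != 0 -> w = x) ->
    k 0 v = (v == x)%:R.
  move=> k1 hk; have [->|vx] := eqVneq v x; last first.
    by apply/eqP; apply: contraT => /hk /eqP; rewrite (negPf vx).
  rewrite -k1 (bigD1 x) //= big1 ?addr0 // => w wx.
  by apply/eqP; apply: contraT => /hk /eqP; rewrite (negPf wx).
apply/rowP => v; rewrite (pt l) // ?(pt m) // => w hw.
  by rewrite -(supp _ _ lx hw).
by rewrite xy; exact: supp my.
Qed.

Lemma big_support (F : 'I_8 -> R) (l : seq 'I_8) : uniq l ->
  (forall v, v \notin l -> F v = 0) -> \sum_v F v = \sum_(v <- l) F v.
Proof.
move=> ul F0; rewrite (bigID (mem l)) /= [X in _ + X]big1 ?addr0; last by move=> v /F0.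
by rewrite big_uniq.
Qed.

Lemma cramer3_eq0 (u0 u1 u2 v0 v1 v2 w0 w1 w2 x y z : R) :
  u0 * (v1 * w2 - v2 * w1) + u1 * (v2 * w0 - v0 * w2) + u2 * (v0 * w1 - v1 * w0) != 0 ->
  x * u0 + y * v0 + z * w0 = 0 -> x * u1 + y * v1 + z * w1 = 0 ->
  x * u2 + y * v2 + z * w2 = 0 -> [/\ x = 0, y = 0 & z = 0].
Proof.
set D := (X in X != 0) => D0 e0 e1 e2.
have z0 t : t * D = 0 -> t = 0 by move=> /eqP; rewrite mulf_eq0 (negPf D0) orbF => /eqP.
split; apply: z0.
- transitivity ((x * u0 + y * v0 + z * w0) * (v1 * w2 - v2 * w1) +
    (x * u1 + y * v1 + z * w1) * (v2 * w0 - v0 * w2) +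
    (x * u2 + y * v2 + z * w2) * (v0 * w1 - v1 * w0)); first by rewrite /D; ring.
  by rewrite e0 e1 e2 !mul0r !addr0.
- transitivity ((x * u0 + y * v0 + z * w0) * (w1 * u2 - w2 * u1) +
    (x * u1 + y * v1 + z * w1) * (w2 * u0 - w0 * u2) +
    (x * u2 + y * v2 + z * w2) * (w0 * u1 - w1 * u0)); first by rewrite /D; ring.
  by rewrite e0 e1 e2 !mul0r !addr0.
- transitivity ((x * u0 + y * v0 + z * w0) * (u1 * v2 - u2 * v1) +
    (x * u1 + y * v1 + z * w1) * (u2 * v0 - u0 * v2) +
    (x * u2 + y * v2 + z * w2) * (u0 * v1 - u1 * v0)); first by rewrite /D; ring.
  by rewrite e0 e1 e2 !mul0r !addr0.
Qed.

(** Since the coefficients sum to zero, that of a can be eliminated; this leaves a linear relation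
    between the three vectors from a, whose determinant is [det_expr]. *)
Lemma affine_independent (f : nat -> R) (a b c e : 'I_8) (d : 'rV[R]_8) :
  uniq [:: e; a; b; c] -> (forall v, v \notin [:: e; a; b; c] -> d 0 v = 0) ->
  \sum_v d 0 v = 0 -> d *m cfg f = 0 -> peval f (det_expr a b c e) != 0 -> d = 0.
Proof.
move=> ul supp d0 dq.
have E k : d 0 e * f (qvar e k) + (d 0 a * f (qvar a k) + (d 0 b * f (qvar b k) +
    d 0 c * f (qvar c k))) = 0.
  transitivity ((d *m cfg f) 0 k); last by rewrite dq mxE.
  rewrite mxE (big_support (l := [:: e; a; b; c])) // => [|v /supp ->]; last by rewrite mul0r.
  by rewrite !big_cons big_nil addr0 !mxE.
have S : d 0 e + (d 0 a + (d 0 b + d 0 c)) = 0.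
  rewrite -d0 (big_support (l := [:: e; a; b; c])) //.
  by rewrite !big_cons big_nil addr0.
rewrite /det_expr /pdiff /= !mulN1r => det.
have S' : d 0 a = - d 0 e - d 0 b - d 0 c by lra.
have [||| hb hc he] := cramer3_eq0 (x := d 0 b) (y := d 0 c) (z := d 0 e) det.
- by have := E c0; rewrite S' => <-; ring.
- by have := E c1; rewrite S' => <-; ring.
- by have := E c2; rewrite S' => <-; ring.
apply/rowP => v; rewrite mxE.
have [|/supp //] := boolP (v \in [:: e; a; b; c]).
by rewrite !inE => /or4P[] /eqP ->; rewrite ?S' ?hb ?hc ?he ?subr0 ?oppr0.
Qed.

Lemma all_flatten (T : Type) (P : pred T) (ss : seq (seq T)) :
  all P (flatten ss) = all (all P) ss.
Proof. by elim: ss => //= t ss <-; rewrite all_cat. Qed.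

Lemma embedded_of_env (f : nat -> R) :
  all (fun t => 0 < peval f t) (embed_exprs s) -> embedded s (cfg f).
Proof.
rewrite /embed_exprs all_cat all_flatten !all_map => /andP[/allP sep /allP det].
have [sz cover un] := embed_pairs_check s.
have far p (l m : 'rV[R]_8) : p \in far_pairs s ->
    (forall v, 0 <= l 0 v) -> \sum_v l 0 v = 1 -> (forall v, l 0 v != 0 -> v \in fverts p.1) ->
    (forall v, 0 <= m 0 v) -> \sum_v m 0 v = 1 -> (forall v, m 0 v != 0 -> v \in fverts p.2) ->
    l *m cfg f = m *m cfg f -> l = m.
  move=> hp l0 l1 lA m0 m1 mB E.
  pose u := nth (0 : int, 0 : int, 0 : int) (separators s) (index p (far_pairs s)).
  have hu : (p, u) \in zip (far_pairs s) (separators s).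
    apply/(nthP (p, (0 : int, 0 : int, 0 : int))); exists (index p (far_pairs s)).
      by rewrite size_zip -sz minnn index_mem.
    by rewrite nth_zip // nth_index.
  pose phi v : R := u.1.1%:~R * f (qvar v c0) + u.1.2%:~R * f (qvar v c1) + u.2%:~R * f (qvar v c2).
  have phiE (k : 'rV[R]_8) : \sum_v k 0 v * phi v =
      u.1.1%:~R * (k *m cfg f) 0 c0 + u.1.2%:~R * (k *m cfg f) 0 c1 + u.2%:~R * (k *m cfg f) 0 c2.
    rewrite !mxE !mulr_sumr -!big_split /=; apply: eq_bigr => v _; rewrite !mxE /phi; ring.
  apply: (separated_eq (phi := phi) l0 l1 lA m0 m1 mB); last by rewrite !phiE E.
  move=> x y hx hy xy; have : 0 < peval f (sep_expr u x y).
    move: (sep _ hu); rewrite /= /sep_exprs all_flatten all_map => /allP /(_ _ hx) /=.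
    by rewrite all_map => /allP /(_ y); apply; rewrite mem_filter xy.
  rewrite /sep_expr /pdiff /phi /=; lra.
move=> l m; rewrite !inE /=.
move=> [l0 l1 [a [b [c [hf lA]]]]] [m0 m1 [a' [b' [c' [hg mB]]]]] E.
move/allP: cover => /(_ _ hf) /allP /(_ _ hg) /or3P[h|h|/hasP[p hp /allP hv]].
- exact: far h l0 l1 lA m0 m1 mB E.
- by apply/esym; exact: far h m0 m1 mB l0 l1 lA (esym E).
move/allP: un => /(_ _ hp); move: (det _ hp) => /=.
case: p.1 (head o0 _) hv => [[x y] z] w hv D uw.
have D0 : peval f (det_expr x y z w) != 0.
  by apply: contraTneq D => ->; rewrite mul0r ltxx.
apply/eqP; rewrite -subr_eq0; apply/eqP.
apply: (affine_independent uw _ _ _ D0).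
- move=> v hn; rewrite !mxE.
  have -> : l 0 v = 0.
    apply/eqP; apply: contraNT hn => /lA h; apply: hv; by rewrite mem_cat h.
  have -> : m 0 v = 0.
    apply/eqP; apply: contraNT hn => /mB h; apply: hv; by rewrite mem_cat h orbT.
  by rewrite subrr.
- under eq_bigr do rewrite !mxE.
  by rewrite sumrB l1 m1 subrr.
- by rewrite mulmxBl E subrr.
Qed.

Lemma embedded_lifted (x : 'rV[R]_9) (t : R) : t != 0 ->
  embedded s (lifted s x 1) -> embedded s (lifted s x t).
Proof.
move=> t0 H l m hl hm E; apply: H => //.
have scale : lifted s x 1 = lifted s x t *m diag_mx (\row_(k < 3) if k == ord_max then t^-1 else 1).
  apply/matrixP => v k; rewrite mul_mx_diag !mxE; case: eqP => // _; last by rewrite mulr1.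
  by rewrite mul1r mulrAC divff // mul1r.
by rewrite scale !mulmxA E.
Qed.

Lemma lifted_baseE t v k :
  lifted s (base_free R s) t v k = if k == ord_max then t * speed R s v else base R s v k.
Proof.
rewrite mxE; case: eqP => // _; case: ifP => // hf; rewrite mxE.
by rewrite (tnth_nth (v, k)) inordK ?index_mem ?size_tuple ?nth_index // -{2}(size_tuple (free_coords s)) index_mem.
Qed.

Lemma lift_s3E (v : 'I_8) (k : 'I_3) :
  KR R (lift_s3 s (qvar v k)) = lifted s (base_free R s) 1 v k.
Proof.
have hm : (qvar v k %% 3 = k)%N by rewrite /qvar mulnC modnMDl modn_small.
have hd : (qvar v k %/ 3 = v)%N by rewrite /qvar mulnC divnMDl // divn_small ?addn0.
have hq := qvar_lt v k.
rewrite lifted_baseE mul1r.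
rewrite /lift_s3 hm hd hq andbT -val_eqE /=; case: ifP => k2.
  have := mem_vertices v; rewrite !inE => /or4P[|||/or4P[|||/orP[]]] /eqP ->; case: s;
    rewrite /speed /=; rewrite /mk3 /KR !ZRE; field; exact: isT.
by rewrite -cfg_base mxE.
Qed.

Lemma embedded_near : exists2 d : R, 0 < d & forall (x : 'rV[R]_9) t,
  (forall j, `|x 0 j - base_free R s 0 j| < d) -> t != 0 -> embedded s (lifted s x t).
Proof.
have [d d0 H] := s3pos_near R (embed_exprs_check s).
exists d => // x t hx t0; apply: embedded_lifted => //.
pose f k : R := if (k < 24)%N then coord (lifted s x 1) k else KR R (lift_s3 s k).
have -> : lifted s x 1 = cfg f.
  by rewrite -[LHS]cfg_coord; apply: cfg_eq => k hk; rewrite /f hk.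
apply/embedded_of_env/H => k hk; have [k24|k24] := ltnP k 24; last first.
  by rewrite /f ltnNge k24 subrr normr0.
rewrite /f k24 (qvarE k24) coord_qvar lift_s3E.
move: (inord (k %/ 3) : 'I_8) (inord (k %% 3) : 'I_3) => v j.
rewrite [lifted s x 1 v j]mxE [lifted s (base_free R s) 1 v j]mxE.
case: ifP => _; first by rewrite subrr normr0.
by case: ifP => _; rewrite ?subrr ?normr0.
Qed.

End Embedded.

(** * Charts of the flat locus *)

Lemma nbhs_mx_entries (R : realType) m n (A : 'M[R]_(m, n)) N : nbhs A N ->
  exists2 d : R, 0 < d & forall B : 'M[R]_(m, n), (forall i j, `|B i j - A i j| < d) -> N B.
Proof.
move=> /nbhs_ballP[d /= d0 H]; exists (d / 2); first by rewrite divr_gt0.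
move=> B hB; apply: H; rewrite -ball_normE /=.
apply: (@le_lt_trans _ _ (d / 2)); last by lra.
apply: normr_mx_le => [|i j]; first by rewrite ltW // divr_gt0.
by rewrite !mxE distrC ltW.
Qed.

Lemma near_mx_entries (R : realType) m n (A : 'M[R]_(m, n)) d : 0 < d ->
  nbhs A [set B : 'M[R]_(m, n) | forall i j, `|B i j - A i j| < d].
Proof.
move=> d0; apply/nbhs_ballP; exists d => // B; rewrite -ball_normE /= distrC => hB i j.
by apply: le_lt_trans hB; have := normr_mx_entry (B - A) i j; rewrite !mxE.
Qed.

Section Rows.
Variables (R : realType) (m n : nat) (Y U : seq nat).
Hypotheses (sY : size Y = m.+1) (sU : size U = n.+1) (uYU : uniq (Y ++ U)).
Local Notation sel := (sel_of m n Y U).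

Lemma row_of_env_l (y : 'rV[R]_m.+1) (x : 'rV[R]_n.+1) : row_of _ Y (env sel y x) = y.
Proof.
apply/rowP => j; rewrite mxE /env /sel_of.
move: uYU; rewrite cat_uniq => /and3P[uY dis uU].
have hY : nth 0%N Y j \in Y by rewrite mem_nth // sY.
rewrite (_ : (_ \in U) = false); last by apply: contraNF dis => h; apply/hasP; exists (nth 0%N Y j).
by rewrite index_uniq ?sY //; congr (y _ _); apply: val_inj; rewrite /= inordK.
Qed.

Lemma row_of_env_r (y : 'rV[R]_m.+1) (x : 'rV[R]_n.+1) : row_of _ U (env sel y x) = x.
Proof.
apply/rowP => j; rewrite mxE /env /sel_of.
move: uYU; rewrite cat_uniq => /and3P[uY dis uU].
rewrite mem_nth ?sU // index_uniq ?sU //.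
by congr (x _ _); apply: val_inj; rewrite /= inordK.
Qed.

Lemma env_close (y : 'rV[R]_m.+1) (x : 'rV[R]_n.+1) (f : nat -> R) (d : R) :
  (forall i j, `|y i j - (row_of _ Y f) i j| < d) ->
  (forall i j, `|x i j - (row_of _ U f) i j| < d) ->
  forall k, k \in Y ++ U -> `|env sel y x k - f k| < d.
Proof.
move=> hy hx k hk; rewrite -[f k](env_row_of sY sU) //.
rewrite /env; case: (sel k) => j; [exact: hy | exact: hx].
Qed.

End Rows.

(* Locally the zero set of G is the graph of g; eps-closeness to the base
   values makes all the strict inequalities needed on it available. *)
Lemma implicit_function_local (R : realType) m n Y U G e A (eps : R) :
  ift_check m n Y U G e A -> perm_eq (Y ++ U) (iota 0 41) -> 0 < eps ->
  let f0 k : R := KR R (e k) in let sel := sel_of m n Y U in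
  exists (Y' : set 'rV[R]_m.+1) (g : 'rV[R]_m.+1 -> 'rV[R]_n.+1),
  [/\ open Y', smooth_on Y' g,
      forall y, Y' y -> (forall k, (k < 41)%N -> `|env sel y (g y) k - f0 k| < eps) /\
        all (fun t => peval (env sel y (g y)) t == 0) G
    & exists2 r : R, 0 < r & forall f : nat -> R,
        (forall k, (k < 41)%N -> `|f k - f0 k| < r) -> Y' (row_of _ Y f) /\
        (all (fun t => peval f t == 0) G -> row_of _ U f = g (row_of _ Y f))].
Proof.
move=> chk pm e0 f0 sel.
have := chk => /and5P[/eqP sY /eqP sU uU /eqP sG /and3P[vG _ _]].
have uYU : uniq (Y ++ U) by rewrite (perm_uniq pm) iota_uniq.
have mYU k : (k \in Y ++ U) = (k < 41)%N by rewrite (perm_mem pm) mem_iota.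
have [Y1 [X [g [[oY1 Y10] [oX X0 XN] gX gG sg]]]] :=
  implicit_function_num chk (near_mx_entries (row_of _ U f0) e0).
have [d1 d10 H1] := nbhs_mx_entries (open_nbhs_nbhs (conj oY1 Y10)).
have [d2 d20 H2] := nbhs_mx_entries (open_nbhs_nbhs (conj oX X0)).
(* The ball keeps the parameters eps-close to the base; for the unknowns this is ensured by the
   neighbourhood containing [X]. *)
pose Y2 := Y1 `&` (ball (row_of _ Y f0) eps).
have oY2 : open Y2 by apply: openI => //; exact: ball_open.
exists Y2, g; split => //; first by apply: smooth_subset sg => y [].
- move=> y [hy by0]; split.
    move=> k hk; apply: env_close => //; last by rewrite mYU.
      move: by0; rewrite -ball_normE /= distrC => hb i j; apply: le_lt_trans hb.
      by have := normr_mx_entry (y - row_of _ Y f0) i j; rewrite !mxE.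
    by move=> i j; apply: XN; exact: gX.
  apply/(all_nthP (PC 0)) => i hi; apply/eqP; move: i hi.
  by apply/gG => //; exact: gX.
- pose r := Num.min (Num.min d1 d2) (eps / 2).
  have r1 : r <= d1 by rewrite /r !ge_min lexx.
  have r2 : r <= d2 by rewrite /r !ge_min lexx orbT.
  have r3 : r <= eps / 2 by rewrite /r ge_min lexx orbT.
  exists r; first by rewrite /r !lt_min d10 d20 divr_gt0.
  move=> f hf.
  have nY j : (j < m.+1)%N -> (nth 0 Y j < 41)%N.
    by move=> hj; rewrite -mYU mem_cat mem_nth // sY.
  have nU j : (j < n.+1)%N -> (nth 0 U j < 41)%N.
    by move=> hj; rewrite -mYU mem_cat mem_nth ?sU // orbT.
  have hY : Y1 (row_of _ Y f).
    by apply: H1 => i j; rewrite !mxE; apply: lt_le_trans r1; apply: hf; exact: nY.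
  split.
    split => //; rewrite -ball_normE /=; apply: (@le_lt_trans _ _ (eps / 2)); last by lra.
    apply: normr_mx_le => [|i j]; first by rewrite ltW // divr_gt0.
    by rewrite !mxE distrC ltW //; apply: lt_le_trans r3; apply: hf; exact: nY.
  move=> /(all_nthP (PC 0)) z; apply/gG => //.
    by apply: H2 => i j; rewrite !mxE; apply: lt_le_trans r2; apply: hf; exact: nU.
  move=> i hi; have := z i hi; move=> /eqP <-.
  have : vars_in (Y ++ U) (nth (PC 0) G i) by have /all_nthP := vG; apply.
  elim: (nth _ _ _) => [k|c|a IHa b IHb|a IHa b IHb] //=.
  - by move=> hk; exact: env_row_of.
  - by move=> /andP[ha hb]; rewrite IHa ?IHb.
  - by move=> /andP[ha hb]; rewrite IHa ?IHb.
Qed.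

Section Coordinates.
Variable R : realType.

Definition coords n (P : seq nat) (q : config R) : 'rV[R]_n := row_of n P (coord q).

Lemma coords_is_linear n P : linear (coords n P).
Proof. by move=> a q r; apply/rowP => j; rewrite !mxE /coord !mxE. Qed.
HB.instance Definition _ n P := GRing.isLinear.Build R (config R) 'rV[R]_n _
  (coords n P) (coords_is_linear n P).

Lemma coords_continuous n P : continuous (coords n P).
Proof.
move=> q; apply: (@cvg_mx R _ (nbhs q)) => i j.
rewrite [X in _ --> X]mxE (_ : (fun r => _) = fun r : config R => coord r (nth 0%N P j)).
  exact: coord_continuous.
by apply/funext => r; rewrite mxE.
Qed.

Variables (m n : nat) (P U : seq nat).

Definition assemble (p : 'rV[R]_m.+1 * 'rV[R]_n.+1) : config R :=
  cfg (env (sel_of m n P U) p.1 p.2).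

Lemma assemble_is_linear : linear assemble.
Proof.
move=> a p q; apply/matrixP => v k; rewrite !mxE /env /=.
by case: (sel_of _ _ _ _ _) => j; rewrite !mxE.
Qed.
HB.instance Definition _ := GRing.isLinear.Build R ('rV[R]_m.+1 * 'rV[R]_n.+1)%type
  (config R) _ assemble assemble_is_linear.

Lemma assemble_continuous : continuous assemble.
Proof.
move=> p; apply: (@cvg_mx R _ (nbhs p)) => v k.
rewrite [X in _ --> X]mxE (_ : (fun r => _) = fun r => env (sel_of m n P U) r.1 r.2 (qvar v k)).
  exact: (@peval_continuous R m.+1 n.+1 (sel_of m n P U) (PVar (qvar v k)) p).
by apply/funext => r; rewrite mxE.
Qed.

Hypotheses (sP : size P = m.+1) (sU : size U = n.+1)
  (pPU : perm_eq (P ++ U) (iota 0 24)).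

Let uPU : uniq (P ++ U). Proof. by rewrite (perm_uniq pPU) iota_uniq. Qed.
Let mPU k : (k \in P ++ U) = (k < 24)%N. Proof. by rewrite (perm_mem pPU) mem_iota. Qed.

Lemma assembleK q : assemble (coords m.+1 P q, coords n.+1 U q) = q.
Proof.
rewrite -[RHS]cfg_coord; apply: cfg_eq => k hk; by rewrite (env_row_of sP sU) ?mPU.
Qed.

Lemma coords_assemble y x : coords m.+1 P (assemble (y, x)) = y /\ coords n.+1 U (assemble (y, x)) = x.
Proof.
have nl j : (j < m.+1)%N -> (nth 0 P j < 24)%N.
  by move=> hj; rewrite -mPU mem_cat mem_nth // sP.
have nr j : (j < n.+1)%N -> (nth 0 U j < 24)%N.
  by move=> hj; rewrite -mPU mem_cat mem_nth ?sU // orbT.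
split.
  rewrite -[RHS](row_of_env_l sP uPU y x); apply/rowP => j.
  by rewrite mxE [RHS]mxE coord_cfg // nl.
rewrite -[RHS](row_of_env_r sU uPU y x); apply/rowP => j.
by rewrite mxE [RHS]mxE coord_cfg // nr.
Qed.

(** The chart is the shear subtracting the graph from the [U] coordinates, and its inverse adds the
    graph back. The latter is defined over all of [Y], so its domain is cut down to the preimage of
    [W]. *)
Lemma graph_submanifold (M W : set (config R)) (Y : set 'rV[R]_m.+1)
    (h : 'rV[R]_m.+1 -> 'rV[R]_n.+1) :
  open W -> M `<=` W -> open Y -> smooth_on Y h ->
  (forall q, W q -> Y (coords _ P q)) ->
  (forall q, W q -> (M q <-> coords _ U q = h (coords _ P q))) ->
  smooth_submanifold m.+1 M.
Proof.
move=> oW MW oY sh WY graph p Mp.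
pose phi q := (coords m.+1 P q, coords n.+1 U q - h (coords m.+1 P q)).
pose psi (z : 'rV[R]_m.+1 * 'rV[R]_n.+1) := assemble (z.1, z.2 + h z.1).
pose O : set ('rV[R]_m.+1 * 'rV[R]_n.+1) := [set z | Y z.1].
have oO : open O by apply: (open_comp _ oY) => z _; exact: cvg_fst.
have shfst : smooth_on O (fun z => h z.1).
  apply: (smooth_ext (f := fun z => h (fst z + 0))) => // [z _|]; first by rewrite addr0.
  by apply: (smooth_precomp (L := fst) (O := Y)) => // [z|z]; [exact: cvg_fst | rewrite addr0].
have spsi : smooth_on O psi.
  apply: (smooth_postcomp (L := assemble)) => //; first exact: assemble_continuous.
  apply: smooth_pair => //; first by apply: (smooth_linear (f := fst)) => // z; exact: cvg_fst.
  by apply: smooth_add => //; apply: (smooth_linear (f := snd)) => // z; exact: cvg_snd.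
exists n.+1, W, (O `&` psi @^-1` W), phi, psi; split.
- by split => //; exact: MW.
- rewrite openE => z [Oz Wz]; apply: filterI; first exact: open_nbhs_nbhs.
  by apply: (spsi 0 z Oz); exact: open_nbhs_nbhs.
- split; last by apply: smooth_subset spsi => z [].
  apply: smooth_pair => //; first by apply: (smooth_linear (f := coords m.+1 P)) => // q; exact: coords_continuous.
  apply: smooth_add => //; first by apply: (smooth_linear (f := coords n.+1 U)) => // q; exact: coords_continuous.
  apply: (smooth_postcomp (L := -%R)) => //; first by move=> z; exact: opp_continuous.
  apply: (smooth_ext (f := fun q => h (coords m.+1 P q + 0))) => // [q _|]; first by rewrite addr0.
  apply: (smooth_precomp (L := coords m.+1 P) (O := Y)) => //; first exact: coords_continuous.
  by move=> q Wq; rewrite addr0; exact: WY.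
- have K q : psi (phi q) = q by rewrite /psi /phi /= subrK assembleK.
  split=> [q Wq|[y x] [Oy Wy]].
    by split => //; split; [exact: WY | rewrite /= K].
  split => //; rewrite /phi /psi /=.
  by have [-> ->] := coords_assemble y (x + h y); rewrite addrK.
- by move=> q Wq; rewrite graph //=; split => [->|/subr0_eq //]; rewrite subrr.
Qed.

End Coordinates.

(** These facts locate the modulus and the coordinates of the configuration inside the rows of
    parameters and unknowns. The last two conditions say that a free coordinate is neither one of
    the fifteen parameters nor a height. *)
Lemma index_check s :
  [/\ perm_eq (params1 s ++ unknowns1 s) (iota 0 41),
      perm_eq (params2 s ++ unknowns2 s) (iota 0 41),
      unknowns1 s = take 7 (unknowns1 s) ++ iota 24 17,
      params2 s = take 15 (params2 s) ++ [:: 39; 40]%N &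
      unknowns2 s = [seq qvar vk.1 vk.2 | vk <- free_coords s] ++ iota 24 15] /\
  [/\ perm_eq (params1 s ++ take 7 (unknowns1 s)) (iota 0 24),
      perm_eq (take 15 (params2 s) ++ take 9 (unknowns2 s)) (iota 0 24) &
      all (fun v => all (fun k => (qvar v k \in take 15 (params2 s)) ==>
        ((k == c2) || ((v, k) \notin tval (free_coords s)))) [:: c0; c1; c2]) vertices &&
      all (fun vk : 'I_8 * 'I_3 => vk.2 != c2) (free_coords s)].
Proof. by case: s; vm_compute. Qed.

Definition line (R : realType) n (v : 'rV[R]_n) (t : R) : 'rV[R]_n := t *: v.

Lemma line_is_linear (R : realType) n (v : 'rV[R]_n) : linear (line v : R^o -> 'rV[R]_n).
Proof. by move=> a x y; rewrite /line scalerDl scalerA. Qed.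
HB.instance Definition _ (R : realType) n (v : 'rV[R]_n) :=
  GRing.isLinear.Build R R^o 'rV[R]_n _ (line v) (line_is_linear v).

Lemma line_continuous (R : realType) n (v : 'rV[R]_n) : continuous (line v).
Proof. by move=> t; apply: cvgZl; exact: cvg_id. Qed.

Lemma differentiable_line (R : realType) n (v c : 'rV[R]_n) :
  differentiable (fun t : R => line v t + c) 0 /\
  'd (fun t : R => line v t + c) 0 = line v :> (R -> 'rV[R]_n).
Proof.
apply: (differentiable_of_bound (df := line v)); first exact: line_continuous.
move=> e e0; have F0 : Filter (nbhs (0 : R)) by exact: nbhs_filter.
apply: (@filterS _ _ F0 _ _ _ (@filterT _ _ F0)) => h _.
rewrite addr0 /line scale0r add0r addrK subrr normr0.
by rewrite mulr_ge0 // ltW.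
Qed.

Section Main.
Variables (R : realType) (s : torus_case).
Local Notation C := R[i].
Local Notation B := (base R s).
Local Notation f0 := (base_env R s).
Local Notation sel1 := (sel_of 16 23 (params1 s) (unknowns1 s)).
Local Notation sel2 := (sel_of 16 23 (params2 s) (unknowns2 s)).
Local Notation zeros f := (all (fun t => peval f t == 0) (len_exprs s)).
Local Notation close d f := (forall k, (k < 41)%N -> `|f k - f0 k| < d).
Let FB : Filter (nbhs B). Proof. exact: nbhs_filter. Qed.

Lemma flat_env_near d : 0 < d -> \forall q \near B, flat_locus s q ->
  exists f : nat -> R, [/\ close d f, zeros f & cfg f = q].
Proof.
move=> d0.
have N1 := dev_env_near s d0.
have N2 := near_mx_entries B d0.
apply: (@filterS2 _ (nbhs B) FB _ _ _ _ N1 N2) => q H1 H2 /H1[cq z cl].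
exists (dev_env s q); split => // k k41; have [k24|k24] := ltnP k 24; last by apply: cl; rewrite k24.
by rewrite /dev_env k24 -(coord_cfg f0 k24) cfg_base; exact: H2.
Qed.

Lemma nondegenerate_near : \forall q \near B, nondegenerate_faces s q.
Proof.
have N1 : \forall q \near B, forall t, t \in corners s ->
    0 < gram (row t.1.2 q - row t.1.1 q) (row t.2 q - row t.1.1 q).
  apply: (near_all FB) => -[[a b] c] h.
  by have := @cvg_gram_row R s a b c; move=> /cvgr_gt /(_ _ (gram_base R h)).
apply: filterS N1 => q H; apply: gram_nondegenerate => a b c h; exact: (H (a, b, c)).
Qed.

Definition take_row n m (x : 'rV[R]_m.+1) : 'rV[R]_n := \row_(j < n) x 0 (inord j).

Lemma take_row_of n m (U : seq nat) f : (n <= m.+1)%N -> (n <= size U)%N ->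
  take_row n (row_of m.+1 U f) = row_of n (take n U) f.
Proof.
move=> nm nU; apply/rowP => j; rewrite !mxE nth_take // inordK //.
exact: leq_trans (ltn_ord j) nm.
Qed.

(** In [unknowns1] the modulus is preceded by seven coordinates and the fifteen variables 24 to 38,
    hence the offset 22. *)
Definition tau_row (x : 'rV[R]_24) : 'rV[R]_2 := \row_(j < 2) x 0 (inord (22 + j)).

Lemma tau_row_of f : tau_row (row_of 24 (unknowns1 s) f) = plane (tau_of f).
Proof.
apply/rowP => j; rewrite !mxE; have [_ _ uE _ _] := (index_check s).1.
have -> : nth 0%N (unknowns1 s) (inord (22 + j) : 'I_24) = (39 + j)%N.
  rewrite inordK; last by case: j => [j hj] /=; lia.
  by case: j => -[|[|//]] hj; case: s.
by case: j => -[|[|//]] hj.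
Qed.

(** Restricted to [params2], this is the point with the coordinates of q and modulus z. Elsewhere
    beyond the coordinates it takes the base values, so that it is close to the base as soon as q
    and z are. *)
Definition with_modulus (q : config R) (z : C) (k : nat) : R :=
  if (k < 24)%N then coord q k else
  if k == 39 then complex.Re z else if k == 40 then complex.Im z else f0 k.

Lemma row_with_modulus q z f : cfg f = q -> tau_of f = z ->
  row_of 17 (params2 s) (with_modulus q z) = row_of 17 (params2 s) f.
Proof.
move=> <- <-; apply/rowP => j; rewrite !mxE /with_modulus.
case: ifP => h; first by rewrite coord_cfg.
have : nth 0%N (params2 s) j \in params2 s by apply: mem_nth; case: (s).
have [_ _ _ pE _] := (index_check s).1.
move: (nth _ _ _) h => k h; rewrite {1}pE mem_cat => /orP[hk|].
  have [_ /perm_mem /(_ k) + _] := (index_check s).2.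
  by rewrite mem_cat hk mem_iota h.
by rewrite !inE => /orP[] /eqP ->.
Qed.

Lemma coords_row n (P : seq nat) (f : nat -> R) q : (n <= size P)%N ->
  (forall k, k \in P -> coord q k = f k) -> coords n P q = row_of n P f.
Proof.
move=> nP hP; apply/rowP => j; rewrite !mxE hP //.
by rewrite mem_nth // (leq_trans (ltn_ord j)).
Qed.

Lemma smooth_take_row n m (V : normedModType R) (U : set V) (g : V -> 'rV[R]_m.+1) :
  open U -> smooth_on U g -> smooth_on U (fun x => take_row n (g x)).
Proof.
move=> oU sg; apply: smooth_mx => // i j.
apply: (smooth_ext (f := fun x => g x 0 (inord j))) => // [x _|]; first by rewrite mxE.
exact: smooth_entry.
Qed.

Section Charts.
Variables (eps r : R) (Y1 Y2 : set 'rV[R]_17) (g1 g2 : 'rV[R]_17 -> 'rV[R]_24) (W : set (config R)).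
Hypotheses (r0 : 0 < r) (r_eps : r <= eps) (oW : open W) (oY1 : open Y1) (oY2 : open Y2)
  (sg1 : smooth_on Y1 g1) (sg2 : smooth_on Y2 g2).
Hypothesis eps_pos : forall f, close eps f -> all (fun t => 0 < peval f t) (pos_exprs s).
Hypothesis g1_sol : forall y, Y1 y -> close eps (env sel1 y (g1 y)) /\ zeros (env sel1 y (g1 y)).
Hypothesis g2_sol : forall y, Y2 y -> close eps (env sel2 y (g2 y)) /\ zeros (env sel2 y (g2 y)).
Hypothesis r_Y1 : forall f, close r f -> Y1 (row_of 17 (params1 s) f) /\
  (zeros f -> row_of 24 (unknowns1 s) f = g1 (row_of 17 (params1 s) f)).
Hypothesis r_Y2 : forall f, close r f -> Y2 (row_of 17 (params2 s) f) /\
  (zeros f -> row_of 24 (unknowns2 s) f = g2 (row_of 17 (params2 s) f)).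
Hypothesis W_close : forall q, W q -> forall k, (k < 24)%N -> `|coord q k - f0 k| < r.
Hypothesis W_flat : forall q, W q -> flat_locus s q ->
  exists f : nat -> R, [/\ close r f, zeros f & cfg f = q].

Let M := flat_locus s `&` W.
Let U7 := take 7 (unknowns1 s).
Let U9 := take 9 (unknowns2 s).
Let P15 := take 15 (params2 s).

Let sizes : [/\ size (params1 s) = 17%N, size (unknowns1 s) = 24%N, size (params2 s) = 17%N &
  size (unknowns2 s) = 24%N].
Proof. by case: (s). Qed.

Let uniq1 : uniq (params1 s ++ unknowns1 s).
Proof. by have [/perm_uniq -> _ _ _ _] := (index_check s).1. Qed.
Let uniq2 : uniq (params2 s ++ unknowns2 s).
Proof. by have [_ /perm_uniq -> _ _ _] := (index_check s).1. Qed.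

Let perm7 : perm_eq (params1 s ++ U7) (iota 0 24).
Proof. by have [] := (index_check s).2. Qed.
Let perm9 : perm_eq (P15 ++ U9) (iota 0 24).
Proof. by have [] := (index_check s).2. Qed.

Let small7 k : k \in params1 s \/ k \in U7 -> (k < 24)%N.
Proof.
by move=> /orP h; have := perm_mem perm7 k; rewrite mem_cat h mem_iota.
Qed.
Let small9 k : k \in P15 \/ k \in U9 -> (k < 24)%N.
Proof.
by move=> /orP h; have := perm_mem perm9 k; rewrite mem_cat h mem_iota.
Qed.

Let coords7 f : coords 7 U7 (cfg f) = take_row 7 (row_of 24 (unknowns1 s) f).
Proof.
have [_ s2 _ _] := sizes; rewrite take_row_of ?s2 //.
apply: coords_row => [|k hk]; first by rewrite size_take s2.
by rewrite coord_cfg // small7 //; right.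
Qed.

Let coords9 f : coords 9 U9 (cfg f) = take_row 9 (row_of 24 (unknowns2 s) f).
Proof.
have [_ _ _ s4] := sizes; rewrite take_row_of ?s4 //.
apply: coords_row => [|k hk]; first by rewrite size_take s4.
by rewrite coord_cfg // small9 //; right.
Qed.

Let coords15 f : coords 15 P15 (cfg f) = take_row 15 (row_of 17 (params2 s) f).
Proof.
have [_ _ s3 _] := sizes; rewrite take_row_of ?s3 //.
apply: coords_row => [|k hk]; first by rewrite size_take s3.
by rewrite coord_cfg // small9 //; left.
Qed.

Let coords17 (f : nat -> R) : coords 17 (params1 s) (cfg f) = row_of 17 (params1 s) f.
Proof.
have [s1 _ _ _] := sizes; apply: coords_row => [|k hk]; first by rewrite s1.
by rewrite coord_cfg // small7 //; left.
Qed.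

Let with_modulus_cfg q z : cfg (with_modulus q z) = q.
Proof.
by rewrite -[RHS]cfg_coord; apply: cfg_eq => k hk; rewrite /with_modulus hk.
Qed.

Lemma close_flat f : close eps f -> zeros f ->
  [/\ flat_locus s (cfg f), modulus s (cfg f) = tau_of f & 0 < f 40].
Proof.
move=> cl z; have p := eps_pos cl; have [h1 h2] := flat_of_env p z.
by split => //; exact: pos_f40 p.
Qed.

Lemma W_flat_modulus q : M q -> exists f, [/\ close r f, zeros f, cfg f = q,
  modulus s q = tau_of f & 0 < f 40].
Proof.
move=> [fq Wq]; have [f [cl z fE]] := W_flat Wq fq; exists f.
have [||_ h1 h2] := @close_flat f => //.
  by move=> k hk; apply: lt_le_trans r_eps; exact: cl.
by split => //; rewrite -fE.
Qed.

Let W_Y1 q : W q -> Y1 (coords 17 (params1 s) q).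
Proof.
move=> Wq; rewrite -[q in coords _ _ q](with_modulus_cfg q (tau_of f0)) coords17.
apply: (r_Y1 _).1 => k hk; rewrite /with_modulus; case: ifP => h24; first exact: W_close.
case: eqP => [->|_]; first by rewrite subrr normr0.
by case: eqP => [->|_]; rewrite subrr normr0.
Qed.

(** A flat q comes from a solution near the base values, to which local uniqueness applies.
    Conversely, if the seven coordinates agree with those of the solution over the parameters of q,
    then all 24 agree, and q is that flat solution. *)
Lemma flat_graph q : W q ->
  M q <-> coords 7 U7 q = take_row 7 (g1 (coords 17 (params1 s) q)).
Proof.
move=> Wq; have [s1 s2 _ _] := sizes; split => [Mq|hq].
  have [f [cl z <- _ _]] := W_flat_modulus Mq.
  by rewrite coords7 coords17 (r_Y1 cl).2.
split => //; set y := coords 17 (params1 s) q in hq.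
have [cl z] := g1_sol (W_Y1 Wq); have [fl _ _] := close_flat cl z.
rewrite -/y in fl.
have qE : cfg (env sel1 y (g1 y)) = q.
  have s7 : size U7 = 7%N by rewrite size_take s2.
  rewrite -(assembleK s1 s7 perm7 (cfg _)) coords7 coords17 (row_of_env_l s1 uniq1) (row_of_env_r s2 uniq1).
  by rewrite -hq (assembleK s1 s7 perm7).
by rewrite -qE.
Qed.

Lemma flat_submanifold : smooth_submanifold 17 M.
Proof.
have [s1 s2 _ _] := sizes.
have s7 : size U7 = 7%N by rewrite size_take s2.
apply: (graph_submanifold s1 s7 perm7 oW _ oY1 (smooth_take_row 7 oY1 sg1) W_Y1 flat_graph).
by move=> q [].
Qed.

Lemma with_modulus_row q z : W q -> `|complex.Re z - f0 39| < r -> `|complex.Im z - f0 40| < r ->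
  close r (with_modulus q z).
Proof.
move=> Wq hr hi k hk; rewrite /with_modulus; case: ifP => h24; first exact: W_close.
case: eqP => [-> //|_]; case: eqP => [-> //|_]; by rewrite subrr normr0.
Qed.

(** Here the modulus is a parameter: it can be prescribed together with the fifteen coordinates of
    q, at the cost of moving the other nine. *)
Lemma solution_with_modulus q z (y := row_of 17 (params2 s) (with_modulus q z)) : Y2 y ->
  let f := env sel2 y (g2 y) in
  [/\ flat_locus s (cfg f), modulus s (cfg f) = z, coords 15 P15 (cfg f) = coords 15 P15 q &
      coords 9 U9 (cfg f) = take_row 9 (g2 y)].
Proof.
move=> Yy f; have [_ _ s3 s4] := sizes.
have [cl zf] := g2_sol Yy; have [fl mf _] := close_flat cl zf.
have yE : row_of 17 (params2 s) f = y by exact: row_of_env_l.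
split => //.
- rewrite mf -/f; have h k : k \in [:: 39; 40]%N -> f k = with_modulus q z k.
    move=> hk; have : k \in params2 s.
      by have [_ _ _ -> _] := (index_check s).1; rewrite mem_cat hk orbT.
    move=> kp; have hi : (index k (params2 s) < 17)%N by rewrite -s3 index_mem.
    by move/rowP: yE => /(_ (Ordinal hi)); rewrite !mxE /= nth_index.
  by rewrite /tau_of !h ?inE //; case: (z).
- rewrite coords15 yE take_row_of ?s3 // -[RHS]/(coords 15 P15 q).
  rewrite -[q in RHS](with_modulus_cfg q z) coords15 take_row_of ?s3 //.
- by rewrite coords9 (row_of_env_r s4 uniq2).
Qed.

Let s15 : size P15 = 15%N. Proof. by have [_ _ s3 _] := sizes; rewrite size_take s3. Qed.
Let s9 : size U9 = 9%N. Proof. by have [_ _ _ s4] := sizes; rewrite size_take s4. Qed.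

Lemma fiber_graph q z : W q -> Y2 (row_of 17 (params2 s) (with_modulus q z)) ->
  (M `&` [set p | modulus s p = z]) q <->
  coords 9 U9 q = take_row 9 (g2 (row_of 17 (params2 s) (with_modulus q z))).
Proof.
move=> Wq Yy; split => [[Mq mq]|hq].
  have [f [cl zf fE mE _]] := W_flat_modulus Mq.
  have -> : row_of 17 (params2 s) (with_modulus q z) = row_of 17 (params2 s) f.
    by apply: row_with_modulus => //; rewrite -mE.
  by rewrite -[q in LHS]fE coords9 (r_Y2 cl).2.
have [fl mf c15 c9] := solution_with_modulus Yy.
move: fl mf c15 c9; set p := cfg _ => fl mf c15 c9.
have pE : p = q.
  by rewrite -(assembleK s15 s9 perm9 p) c15 c9 -hq (assembleK s15 s9 perm9).
by rewrite -pE; split => //; split => //; rewrite pE.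
Qed.

(** For a fixed modulus the parameter row is an affine function of the fifteen coordinates, with
    linear part [extend_row] and constant [modulus_row]; this is the form that [smooth_precomp]
    accepts. *)
Definition extend_row (y : 'rV[R]_15) : 'rV[R]_17 :=
  \row_(j < 17) if (j < 15)%N then y 0 (inord j) else 0.
Lemma extend_row_is_linear : linear extend_row.
Proof.
move=> a u v; apply/rowP => j; rewrite !mxE; case: ifP => _; rewrite ?mxE //.
by rewrite mulr0 addr0.
Qed.
HB.instance Definition _ := GRing.isLinear.Build R 'rV[R]_15 'rV[R]_17 _
  extend_row extend_row_is_linear.
Lemma extend_row_continuous : continuous extend_row.
Proof.
move=> y; apply: (@cvg_mx R _ (nbhs y)) => i j.
rewrite [X in _ --> X]mxE (_ : (fun r => _) = fun y : 'rV[R]_15 =>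
  if (j < 15)%N then y 0 (inord j) else 0); last by apply/funext => u; rewrite mxE.
by case: ifP => _; [exact: coord_continuous | exact: cvg_cst].
Qed.

Definition modulus_row (z : C) : 'rV[R]_17 :=
  \row_(j < 17) if (j < 15)%N then 0 else if j == 15%N :> nat then complex.Re z else complex.Im z.

Lemma row_with_modulusE q z :
  row_of 17 (params2 s) (with_modulus q z) = extend_row (coords 15 P15 q) + modulus_row z.
Proof.
have [_ _ _ pE _] := (index_check s).1; rewrite -/P15 in pE.
apply/rowP => j; rewrite !mxE pE nth_cat s15; case: ifP => hj.
  rewrite addr0 inordK // /with_modulus small9 //; by left; rewrite mem_nth // s15.
by rewrite add0r /with_modulus; case: j hj => -[|[|[|[|[|[|[|[|[|[|[|[|[|[|[|[|[|//]]]]]]]]]]]]]]]]].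
Qed.

Lemma fiber_submanifold z : M `&` [set q | modulus s q = z] !=set0 ->
  smooth_submanifold 15 (M `&` [set q | modulus s q = z]).
Proof.
move=> [p [Mp mp]]; have [f [cl zf fE mE _]] := W_flat_modulus Mp.
have zE : z = tau_of f by rewrite -mE.
have WY q : W q -> Y2 (row_of 17 (params2 s) (with_modulus q z)).
  by move=> Wq; apply: (r_Y2 _).1; apply: with_modulus_row; rewrite // zE; exact: cl.
pose Y : set 'rV[R]_15 := [set y | Y2 (extend_row y + modulus_row z)].
have oY : open Y.
  apply: (@open_comp _ _ (fun y => extend_row y + modulus_row z) Y2 _ oY2) => y _.
  have F0 : Filter (nbhs y) by exact: nbhs_filter.
  exact: (@cvgD _ _ _ (nbhs y) F0 _ _ _ _ (@extend_row_continuous y) (cvg_cst _)).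
have sh : smooth_on Y (fun y => take_row 9 (g2 (extend_row y + modulus_row z))).
  apply: smooth_take_row => //.
  by apply: (smooth_precomp (L := extend_row) (O := Y2) (c := modulus_row z) (h := g2)) => //; exact: extend_row_continuous.
apply: (graph_submanifold s15 s9 perm9 oW _ oY sh).
- by move=> q [[]].
- by move=> q Wq; rewrite /Y /= -row_with_modulusE; exact: WY.
- by move=> q Wq; rewrite -row_with_modulusE; apply: fiber_graph => //; exact: WY.
Qed.

Lemma modulus_rowD (z w : C) (t : R) :
  modulus_row ((complex.Re z + t * complex.Re w) +i* (complex.Im z + t * complex.Im w))%C =
  modulus_row z + t *: modulus_row w.
Proof. by apply/rowP => j; rewrite !mxE; do 2?case: ifP => // _; rewrite mulr0 addr0. Qed.

Local Notation assemble2 := (@assemble R 16 23 (params2 s) (unknowns2 s)).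

Let row_cfg f : assemble2 (row_of 17 (params2 s) f, row_of 24 (unknowns2 s) f) = cfg f.
Proof.
have [_ _ s3 s4] := sizes; apply: cfg_eq => k hk; rewrite env_row_of //.
by have [_ /perm_mem -> _ _ _] := (index_check s).1; rewrite mem_iota; lia.
Qed.

(** Both charts are needed: with tau as an unknown, [g1] extends the modulus smoothly to [W]; with
    tau as a parameter, [g2] lifts the straight line of moduli with velocity w to a curve in the
    flat locus. The chain rule along this curve gives w. *)
Lemma flat_submersion : submersion_on M (fun q => plane (modulus s q)).
Proof.
move=> p Mp; have [f [cl zf fE mE _]] := W_flat_modulus Mp.
pose F q := tau_row (g1 (coords 17 (params1 s) q)).
have sF : smooth_on W F.
  apply: smooth_mx => // i j.
  apply: (smooth_ext (f := fun q => g1 (coords 17 (params1 s) q + 0) 0 (inord (22 + j)))) => //.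
    by move=> q _; rewrite addr0 [RHS]mxE.
  apply: (smooth_entry (f := fun q => g1 (coords 17 (params1 s) q + 0))) => //.
  apply: (smooth_precomp (L := coords 17 (params1 s)) (O := Y1)) => //.
    exact: coords_continuous.
  by move=> q Wq; rewrite addr0; exact: W_Y1.
have FE q : M q -> plane (modulus s q) = F q.
  move=> Mq; have [f' [cl' zf' fE' mE' _]] := W_flat_modulus Mq.
  by rewrite mE' /F -[q in coords _ _ q]fE' coords17 -(r_Y1 cl').2 // tau_row_of.
exists W, F; split => //; [by case: Mp | by move=> q Mq _; exact: FE | move=> w].
pose z0 := modulus s p; pose dz : C := (w 0 0 +i* w 0 1)%C.
pose y0 := row_of 17 (params2 s) (with_modulus p z0).
have y0E : y0 = row_of 17 (params2 s) f by apply: row_with_modulus.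
pose zt t : C := ((complex.Re z0 + t * complex.Re dz) +i* (complex.Im z0 + t * complex.Im dz))%C.
have yE t : row_of 17 (params2 s) (with_modulus p (zt t)) = line (modulus_row dz) t + y0.
  by rewrite row_with_modulusE modulus_rowD /y0 row_with_modulusE /line addrA addrC.
pose O : set R := [set t | Y2 (line (modulus_row dz) t + y0)].
have oO : open O.
  apply: (@open_comp _ _ (fun t : R => line (modulus_row dz) t + y0) Y2 _ oY2) => t _.
  have F0 : Filter (nbhs t) by exact: nbhs_filter.
  exact: (@cvgD _ _ _ (nbhs t) F0 _ _ _ _ (@line_continuous R 17 (modulus_row dz) t) (cvg_cst _)).
have O0 : O 0 by rewrite /O /= /line scale0r add0r y0E; exact: (r_Y2 cl).1.
pose c t := assemble2 (line (modulus_row dz) t + y0, g2 (line (modulus_row dz) t + y0)).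
have sc : smooth_on O c.
  apply: (smooth_postcomp (L := assemble2) oO); first exact: assemble_continuous.
  apply: smooth_pair => //; last first.
    by apply: (smooth_precomp (L := line (modulus_row dz)) (O := Y2) (c := y0) (h := g2)) => //; exact: line_continuous.
  apply: smooth_add => //; last exact: smooth_cst.
  by apply: (smooth_linear (f := line (modulus_row dz))) => //; exact: line_continuous.
have c0 : c 0 = p by rewrite /c /line scale0r add0r y0E -(r_Y2 cl).2 // row_cfg.
have near0 : \forall t \near (0 : R), O t /\ W (c t).
  apply: filterI; first exact: open_nbhs_nbhs.
  by apply: (sc 0 0 O0); apply: open_nbhs_nbhs; rewrite c0; split => //; case: Mp.
have [e /= e0 He] := iffLR (nbhs_ballP _ _) near0.
have near_e t : -e < t < e -> O t /\ W (c t).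
  by move=> te; apply: He; rewrite /ball /= sub0r normrN ltr_norml.
have Mc t : -e < t < e -> M (c t) /\ modulus s (c t) = zt t.
  move=> /near_e[Ot Wt].
  have Yt : Y2 (row_of 17 (params2 s) (with_modulus p (zt t))) by rewrite yE.
  have [h1 h2 _ _] := solution_with_modulus Yt; rewrite yE in h1 h2.
  by split => //; split.
exists (derive1 c 0).
  exists e, c; split => //.
    apply: smooth_subset sc => t /near_e[] //.
  by move=> t /Mc[].
have dc : differentiable c 0 by exact: smooth_differentiable sc O0.
have dF : differentiable F (c 0).
  by rewrite c0; apply: smooth_differentiable sF _; case: Mp.
have Fc : \forall t \near (0 : R), line w t + plane z0 = (F \o c) t.
  apply/nbhs_ballP; exists e => // t; rewrite /ball /= sub0r normrN ltr_norml => te.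
  have [Mt mt] := Mc t te; rewrite /= -FE // mt.
  by apply/rowP => j; rewrite !mxE; case: j => -[|[|//]] hj; rewrite /= addrC; congr (_ + _ * w _ _); apply: val_inj.
have [dlc dlE] := @differentiable_line _ _ w (plane z0).
have [_ dE] := near_eq_differentiable Fc dlc.
have E1 : derive1 c 0 = 'd c 0 1 by rewrite derive1E deriveE.
have E2 : 'd (F \o c) 0 1 = 'd F (c 0) ('d c 0 1) by rewrite (diff_comp dc dF).
by rewrite E1 -c0 -E2 dE dlE /line scale1r.
Qed.

Let coords9_lifted (x : 'rV[R]_9) (t : R) : coords 9 U9 (lifted s x t) = x.
Proof.
have [_ _ _ _ uE] := (index_check s).1.
have [_ _ /andP[_ /allP nz]] := (index_check s).2.
have U9E : U9 = [seq qvar vk.1 vk.2 | vk <- free_coords s].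
  by rewrite /U9 uE take_size_cat // size_map size_tuple.
have uf : uniq (free_coords s) by case: (s).
apply/rowP => j; rewrite !mxE U9E.
have sf : size (free_coords s) = 9%N by rewrite size_tuple.
rewrite (nth_map (o0, c0)) ?sf // coord_qvar.
have hj : nth (o0, c0) (free_coords s) j \in tval (free_coords s) by rewrite mem_nth // sf.
have /negPf nz2 : (nth (o0, c0) (free_coords s) j).2 != ord_max by rewrite -val_eqE; exact: nz hj.
rewrite mxE nz2.
rewrite -surjective_pairing hj index_uniq ?sf //.
by congr (x _ _); apply: val_inj; rewrite /= inordK.
Qed.

Let coords15_lifted (x : 'rV[R]_9) (t : R) : coords 15 P15 (lifted s x t) = coords 15 P15 (lifted s (base_free R s) t).
Proof.
apply: coords_row => [|k hk]; first by rewrite s15.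
have k24 : (k < 24)%N by apply: small9; left.
have [_ _ /andP[/allP H _]] := (index_check s).2.
move: hk; rewrite (qvarE k24) !coord_qvar; set v := inord _; set k' := inord _ => hk.
have /allP /(_ k') := H v (mem_vertices v).
have -> : k' \in [:: c0; c1; c2] by case: k' {hk} => -[|[|[|//]]].
move=> /(_ isT); rewrite -/P15 hk /= => h; rewrite lifted_baseE mxE.
have -> : (k' == ord_max) = (k' == c2) by rewrite -!val_eqE.
by move: h; case: (k' == c2) => //= /negPf ->.
Qed.

(** The fifteen coordinates among the parameters are the seven fixed horizontal coordinates and the
    eight heights, hence functions of t alone. With the modulus held at its target, the nine free
    coordinates of the solution form [x t]. *)
Lemma lifted_curve d : W B -> 0 < d -> exists (e : R) (x : R -> 'rV[R]_9),
  [/\ 0 < e, forall t, -e < t < e -> {for t, continuous x}, x 0 = base_free R s &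
      \forall t \near (0 : R), (M `&` [set p | modulus s p = target R s]) (lifted s (x t) t) /\
        forall j, `|x t 0 j - base_free R s 0 j| < d].
Proof.
move=> WB d0.
(* [base_free] is a placeholder: by [coords15_lifted] these parameters do not depend on the free
   coordinates. *)
pose y t := row_of 17 (params2 s) (with_modulus (lifted s (base_free R s) t) (target R s)).
have cy : continuous y.
  move=> t; apply: (@cvg_mx R _ (nbhs t)) => i j; rewrite [X in _ --> X]mxE.
  rewrite (_ : (fun u => _) = fun u => with_modulus (lifted s (base_free R s) u) (target R s)
    (nth 0%N (params2 s) j)); last by apply/funext => u; rewrite mxE.
  have F0 : Filter (nbhs t) by exact: nbhs_filter.
  move: (nth 0%N (params2 s) j) => k; rewrite /with_modulus; case: (k < 24)%N; last first.
    by case: (k == 39); [|case: (k == 40)]; exact: (@cvg_cst _ _ _ (nbhs t) F0).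
  rewrite /coord lifted_baseE; move: (inord (k %/ 3) : 'I_8) (inord (k %% 3) : 'I_3) => v l.
  rewrite (_ : (fun u => _) = fun u => if l == ord_max then u * speed R s v else base R s v l).
    case: (l == ord_max); last exact: (@cvg_cst _ _ _ (nbhs t) F0).
    exact: (@cvgM _ _ (nbhs t) F0 _ _ _ _ cvg_id (@cvg_cst _ _ _ (nbhs t) F0)).
  by apply/funext => u; rewrite lifted_baseE.
have q0 : cfg f0 = lifted s (base_free R s) 0.
  rewrite cfg_base; apply/matrixP => v k; rewrite lifted_baseE; case: eqP => // ->.
  by rewrite mul0r mxE.
have y0 : y 0 = row_of 17 (params2 s) f0 by apply: row_with_modulus => //; exact: tau_base.
have close0 : close r f0 by move=> k _; rewrite subrr normr0.
have [Y0 E0] := r_Y2 close0; rewrite -y0 in Y0 E0.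
have zf0 : zeros f0 by exact: ift_check_zero (ift_check1 s).
pose x t := take_row 9 (g2 (y t)).
have cx t : Y2 (y t) -> {for t, continuous x}.
  move=> Yt; apply: (@cvg_mx R _ (nbhs t)) => i j.
  rewrite [X in _ --> X]mxE (_ : (fun u => _) = fun u => g2 (y u) 0 (inord j)); last by apply/funext => u; rewrite mxE.
  have cg : g2 (y u) @[u --> t] --> g2 (y t) by apply: (cvg_comp _ _ (@cy t)); exact: (sg2 0%N (y t) Yt).
  exact: (cvg_comp _ _ cg (@coord_continuous _ _ _ _ _ _)).
have x0 : x 0 = base_free R s.
  have := coords9_lifted (base_free R s) 0; rewrite -q0 coords9 => <-.
  by rewrite /x -E0.
have Ynear : \forall t \near (0 : R), Y2 (y t).
  by apply: cy; apply: open_nbhs_nbhs.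
have liftE t : Y2 (y t) -> lifted s (x t) t = cfg (env sel2 (y t) (g2 (y t))).
  move=> Yt; have [_ _ c15 c9] := solution_with_modulus Yt.
  have xE : x t = coords 9 U9 (cfg (env sel2 (y t) (g2 (y t)))) by rewrite c9.
  rewrite -[LHS](assembleK s15 s9 perm9) coords9_lifted coords15_lifted -c15 xE.
  exact: (assembleK s15 s9 perm9).
have [e /= e0 He] := iffLR (nbhs_ballP _ _) Ynear.
exists e, x; split => //.
  by move=> t te; apply: cx; apply: He; rewrite /ball /= sub0r normrN ltr_norml.
have Wnear : \forall t \near (0 : R), W (assemble2 (y t, g2 (y t))).
  have ca : assemble2 (y t, g2 (y t)) @[t --> (0 : R)] --> assemble2 (y 0, g2 (y 0)).
    have F0 : Filter (nbhs (0 : R)) by exact: nbhs_filter.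
    have cg : g2 (y t) @[t --> (0 : R)] --> g2 (y 0).
      by apply: (cvg_comp _ _ (@cy 0)); exact: (sg2 0%N (y 0) Y0).
    have cp : (y t, g2 (y t)) @[t --> (0 : R)] --> (y 0, g2 (y 0)).
      exact: (@cvg_pair _ _ _ (nbhs (0 : R)) _ _ F0 _ _ _ _ (@cy 0) cg).
    exact: (cvg_comp _ _ cp (@assemble_continuous R 16 23 _ _ _)).
  apply: ca; apply: open_nbhs_nbhs; split => //.
  by rewrite -E0 // y0 row_cfg cfg_base.
have Xnear : \forall t \near (0 : R), forall i j, `|x t i j - base_free R s i j| < d.
  have cx0 : x u @[u --> (0 : R)] --> base_free R s by rewrite -x0; exact: (cx 0 Y0).
  exact: (cx0 _ (near_mx_entries (base_free R s) d0)).
near=> t.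
have Yt : Y2 (y t) by near: t.
have Wt : W (assemble2 (y t, g2 (y t))) by near: t.
have Xt : forall i j, `|x t i j - base_free R s i j| < d by near: t.
have [fl ml _ _] := solution_with_modulus Yt.
split; last by move=> j; exact: Xt.
by rewrite (liftE t Yt); split => //; split.
Unshelve. all: by end_near. Qed.

End Charts.
End Main.

Theorem theorem2 (R : realType) (s : torus_case) :
  exists W : set (config R),
    [/\ open W, W (base R s) & W `<=` nondegenerate_faces s] /\
    [/\ smooth_submanifold 17 (flat_locus s `&` W),
        [/\ (forall q, (flat_locus s `&` W) q -> 0 < complex.Im (modulus s q)),
            submersion_on (flat_locus s `&` W) (fun q => plane (modulus s q))
          & forall z : R[i], 0 < complex.Im z ->
              (flat_locus s `&` W) `&` [set q | modulus s q = z] !=set0 ->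
              smooth_submanifold 15
                ((flat_locus s `&` W) `&` [set q | modulus s q = z])]
      & exists (e : R) (x : R -> 'rV[R]_9),
          [/\ 0 < e,
              forall t, -e < t < e -> {for t, continuous x},
              x 0 = base_free R s,
              \forall t \near 0^'+,
                ((flat_locus s `&` W) `&` [set p | modulus s p = target R s])
                  (lifted s (x t) t)
            & \forall t \near 0^'+, embedded s (lifted s (x t) t)]].
Proof.
have FB : Filter (nbhs (base R s)) by exact: nbhs_filter.
have [eps eps0 eps_pos] := pos_exprs_near R s.
have [[pm1 pm2 _ _ _] _] := index_check s.
have [Y1 [g1 [oY1 sg1 sol1 [r1 r10 H1]]]] := implicit_function_local (ift_check1 s) pm1 eps0.
have [Y2 [g2 [oY2 sg2 sol2 [r2 r20 H2]]]] := implicit_function_local (ift_check2 s) pm2 eps0.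
pose r := Num.min eps (Num.min r1 r2).
have r0 : 0 < r by rewrite !lt_min eps0 r10.
have re : r <= eps by rewrite ge_min lexx.
have rr1 : r <= r1 by rewrite !ge_min lexx orbT.
have rr2 : r <= r2 by rewrite !ge_min lexx !orbT.
pose N : set (config R) := [set q | [/\ nondegenerate_faces s q,
   forall i j, `|q i j - base R s i j| < r & flat_locus s q -> exists f : nat -> R,
   [/\ forall k, (k < 41)%N -> `|f k - base_env R s k| < r,
       all (fun t => peval f t == 0) (len_exprs s) & cfg f = q]]].
have NB : nbhs (base R s) N.
  have N1 := @nondegenerate_near R s; have N2 := near_mx_entries (base R s) r0.
  have N3 := @flat_env_near R s r r0.
  have F0 : Filter (nbhs (base R s)) by exact: nbhs_filter.
  by apply: (@filterS3 _ _ F0 _ _ _ _ _ N1 N2 N3) => q h1 h2 h3; split.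
(* That flat configurations arise from solutions close to the base values is only known on some
   neighbourhood of the base, so an open set is obtained by taking the interior. *)
pose W := N^°.
have oW : open W by exact: open_interior.
have WN q : W q -> N q by exact: interior_subset.
have Wc q : W q -> forall k, (k < 24)%N -> `|coord q k - base_env R s k| < r.
  move=> /WN[_ h _] k k24; rewrite -(coord_cfg (base_env R s) k24) cfg_base; exact: h.
have Wf q : W q -> flat_locus s q -> exists f : nat -> R,
   [/\ forall k, (k < 41)%N -> `|f k - base_env R s k| < r,
       all (fun t => peval f t == 0) (len_exprs s) & cfg f = q] by move=> /WN[].
have H1' f : (forall k, (k < 41)%N -> `|f k - base_env R s k| < r) -> _ :=
  fun h => H1 f (fun k hk => lt_le_trans (h k hk) rr1).
have H2' f : (forall k, (k < 41)%N -> `|f k - base_env R s k| < r) -> _ :=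
  fun h => H2 f (fun k hk => lt_le_trans (h k hk) rr2).
exists W; split; first by split => // q /WN[].
split.
- exact: flat_submanifold re oW oY1 sg1 eps_pos sol1 H1' Wc Wf.
- split.
  + move=> q /(W_flat_modulus re eps_pos Wf)[f [_ _ _ -> h]]; exact: h.
  + exact: flat_submersion r0 re oW oY2 sg1 sg2 eps_pos sol2 H1' H2' Wc Wf.
  + move=> z _ ne; exact: (fiber_submanifold r0 re oW oY2 sg2 eps_pos sol2 H2' Wc Wf ne).
have [d d0 emb] := embedded_near R s.
have [e [x [e0 cx x0 near0]]] := lifted_curve r0 re oW oY2 sg2 eps_pos sol2 H2' NB d0.
exists e, x; split => //.
  by apply: cvg_within; apply: filterS near0 => t [].
(* The earlier claims hold on both sides of 0; the embedding requires t to be nonzero, because the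
   heights are divided by it. *)
near=> t; apply: emb.
  suff : (forall j, `|x t 0 j - base_free R s 0 j| < d) by [].
  by near: t; apply: cvg_within; apply: filterS near0 => t [].
by rewrite gt_eqF //; near: t; exact: nbhs_right_gt.
Unshelve. all: by end_near. Qed.
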